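(* Every closed connected quartic generalised projective special real curve (quartic CCGPSR curve) is equivalent to precisely one of the following quartic CCGPSR curves $\mathcal{H}\subset\{h=1\}\subset\mathbb{R}^2$ in standard form (that is, $\mathcal{H}$ is the connected component of $\{h=1\}\cap\{\text{hyperbolic points of }h\}$ containing $(x,y)=(1,0)$): a) $h=x^4-x^2y^2+\frac14 y^4$. The set $\{h=1\}\cap\{\text{hyperbolic points of }h\}$ has $4$ equivalent closed connected components, and $G^h\cong\mathbb{R}\ltimes(\mathbb{Z}_2\ltimes\mathbb{Z}_2)$, where the $\mathbb{R}$-factor acts by hyperbolic rotations with respect to the Minkowski inner product $dx^2-\frac12 dy^2$, the first $\mathbb{Z}_2$-factor acts via $y\to -y$, and the second $\mathbb{Z}_2$-factor acts via $(x,y)\to\left(-\frac{1}{\sqrt2}y,\sqrt2\,x\right)$. b) $h=x^4-x^2y^2+\frac{2\sqrt2}{3\sqrt3}xy^3-\frac1{12}y^4$. The set $\{h=1\}\cap\{\text{hyperbolic points of }h\}$ has $2$ equivalent closed connected components, and $G^h\cong\mathbb{R}\times\mathbb{Z}_2$, where the $\mathbb{R}$-factor acts on $\mathcal{H}$ by $$\exp(t\widetilde a)=\begin{pmatrix}1&\frac{\sqrt3}{\sqrt2}\\ 1&-\frac{1}{\sqrt6}\end{pmatrix}\begin{pmatrix}e^{\sqrt3t}&0\\ 0&e^{-\frac{t}{\sqrt3}}\end{pmatrix}\begin{pmatrix}\frac14&\frac34\\ \frac{\sqrt3}{2\sqrt2}&-\frac{\sqrt3}{2\sqrt2}\end{pmatrix},\quad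 t\in\mathbb{R},\qquad \widetilde a:=\sqrt2\begin{pmatrix}0&\frac12\\ 1&\frac{\sqrt2}{\sqrt3}\end{pmatrix}.$$ c) $h=x^4-x^2y^2+\frac{2}{3\sqrt3}xy^3$. The set $\{h=1\}\cap\{\text{hyperbolic points of }h\}$ has $4$ equivalent closed connected components, and $G^h\cong\mathbb{Z}_2\times\mathbb{Z}_2$. d) $h=x^4-x^2y^2+Ky^4$ for exactly one $K<\frac14$. For $0<K<\frac14$ the set $\{h=1\}\cap\{\text{hyperbolic points of }h\}$ has $4$ equivalent closed connected components, and $G^h\cong\mathbb{Z}_2\ltimes\mathbb{Z}_2$, where the first $\mathbb{Z}_2$-factor acts via $y\to-y$ and the second via $(x,y)\to\left(-\sqrt[4]{K}\,y,\sqrt[4]{K}^{\,-1}x\right)$. For $K\le0$ it has $2$ equivalent closed connected components, and $G^h\cong\mathbb{Z}_2\times\mathbb{Z}_2$, where the first $\mathbb{Z}_2$-factor acts via $y\to-y$ and the second via $x\to-x$. The curves in a) and b) are homogeneous spaces, and the curves in c) and d) are inhomogeneous. All of the curves in a), b) and c) are singular at infinity, and each element in the one-parameter family d) is not singular at infinity.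
   Context: Let $h:\mathbb{R}^{n+1}\to\mathbb{R}$, $n\ge1$, be a homogeneous polynomial. A point $p$ is a hyperbolic point of $h$ if $-\partial^2h_p$ (minus the Hessian bilinear form of $h$ at $p$) has Lorentzian signature (exactly one negative and $n$ positive eigenvalues). $h$ is hyperbolic if it has a hyperbolic point. A quartic generalised projective special real (GPSR) manifold of dimension $n$ is a hypersurface $\mathcal{H}\subset\mathbb{R}^{n+1}$ contained in $\{h=1\}$ for a hyperbolic homogeneous polynomial $h$ of degree $4$ and consisting only of hyperbolic points of $h$; it is a curve if $n=1$. It is closed if it is closed as a subset of $\mathbb{R}^{n+1}$; CCGPSR means closed connected GPSR. Two such manifolds $\mathcal{H},\overline{\mathcal{H}}\subset\mathbb{R}^{n+1}$ are equivalent if there is $A\in\mathrm{GL}(n+1)$ with $A(\mathcal{H})=\overline{\mathcal{H}}$; connected components are called equivalent in the same sense. A quartic GPSR curve $\mathcal{H}\subset\{h=1\}$ is in standard form if $(x,y)=(1,0)\in\mathcal{H}$ and $h=x^4-x^2y^2+Lxy^3+Ky^4$ for some $L,K\in\mathbb{R}$. $G^h=\{A\in\mathrm{GL}(n+1): h\circ A=h\}$ is the linear automorphism group of $h$. $\mathcal{H}$ is called a homogeneous space if the group of all $A\in\mathrm{GL}(n+1)$ with $A(\mathcal{H})=\mathcal{H}$ acts transitively on $\mathcal{H}$, and inhomogeneous otherwise. $\mathcal{H}\subset\{h=1\}$ is singular at infinity if there is a point $p\in\partial(\mathbb{R}_{>0}\cdot\mathcal{H})\setminus\{0\}$ (boundary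 in $\mathbb{R}^{n+1}$ of the cone spanned by $\mathcal{H}$) with $h(p)=0$ and $dh_p=0$.
   Formalization: In a) and in d) for 0<K<1/4 the map (x,y)→(−ky,x/k) squares to −1, so its factor is Z_4, not Z_2 (Z_2⋉Z_2 becomes Z_4⋊Z_2, of order 8); in b) the printed matrix product is not exp(tã), so its outer matrices are corrected and ã is kept. *)

(* Defs.v *)
From HB Require Import structures.
From mathcomp Require Import all_boot all_order all_algebra.
From mathcomp Require Import all_classical all_reals all_analysis.
(* The notations of mpoly clash with those of mathcomp-analysis. *)
From mathcomp Require Import -(notations) mpoly.

Set Implicit Arguments.
Unset Strict Implicit.
Unset Printing Implicit Defensive.

Import Order.TTheory GRing.Theory Num.Theory.
Import numFieldNormedType.Exports.

Local Open Scope classical_set_scope.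
Local Open Scope ring_scope.

Section Homogeneous.
Variables (R : realType) (n : nat).
Local Notation V := 'cV[R]_n.+1.
Local Notation M := 'M[R]_n.+1.
Local Notation P := (mpoly n.+1 R).

Definition peval (h : P) (p : V) : R := meval (fun i => p i 0) h.

Definition homogeneous_poly (d : nat) (h : P) : Prop :=
  h \is @ishomog1 n.+1 R d (@mdeg n.+1).

Definition hessian (h : P) (p : V) : M :=
  \matrix_(i, j) peval (mderiv i (mderiv j h)) p.

(* Eigenvalues are counted with multiplicity; the factorisation forces s to
   have size n.+1. *)
Definition lorentzian (S : M) : Prop :=
  exists s : seq R, [/\ char_poly S = \prod_(a <- s) ('X - a%:P),
    count (fun a => a < 0) s = 1%N & count (fun a => 0 < a) s = n].

Definition hyperbolic_point (h : P) (p : V) : Prop :=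
  lorentzian (- hessian h p).

Definition hyperbolic (h : P) : Prop := exists p, hyperbolic_point h p.

Definition hyperbolic_locus (h : P) : set V :=
  [set p | peval h p = 1 /\ hyperbolic_point h p].

Fixpoint Ck (k : nat) (U : set V) (f : V -> R) : Prop :=
  match k with
  | 0 => forall p, U p -> {for p, continuous f}
  | k'.+1 => (forall p, U p -> differentiable f p) /\
             (forall v : V, Ck k' U (fun p => 'D_v f p))
  end.

Definition smooth (U : set V) (f : V -> R) : Prop := forall k, Ck k U f.

Definition hypersurface (H : set V) : Prop :=
  forall p, H p -> exists U (f : V -> R),
    [/\ open U, U p, smooth U f, exists v : V, 'D_v f p != 0
      & H `&` U = [set q | f q = 0] `&` U].

(* Manifolds are required to be nonempty: the empty set would otherwise be a
   closed connected one. *)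
Definition gpsr (d : nat) (h : P) (H : set V) : Prop :=
  [/\ homogeneous_poly d h, hyperbolic h, hypersurface H,
      H !=set0 & H `<=` hyperbolic_locus h].

Definition ccgpsr (d : nat) (h : P) (H : set V) : Prop :=
  [/\ gpsr d h H, closed H & connected H].

Definition act (A : M) (H : set V) : set V := [set A *m v | v in H].

Definition equivalent (H H' : set V) : Prop :=
  exists2 A : M, A \in unitmx & act A H = H'.

Definition linear_automorphisms (h : P) : set M :=
  [set A | A \in unitmx /\ forall v, peval h (A *m v) = peval h v].

Definition homogeneous_space (H : set V) : Prop :=
  forall p q, H p -> H q ->
    exists A : M, [/\ A \in unitmx, act A H = H & A *m p = q].

Definition cone (H : set V) : set V :=
  [set p | exists c v, [/\ 0 < c, H v & p = c *: v]].

Definition singular_at_infinity (h : P) (H : set V) : Prop :=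
  exists p : V, [/\ closure (cone H) p, ~ interior (cone H) p, p != 0,
    peval h p = 0 & forall i, peval (mderiv i h) p = 0].

Definition components (A : set V) : set (set V) :=
  [set C | exists2 p, A p & C = connected_component A p].

Definition equivalent_closed_components (k : nat) (A : set V) : Prop :=
  [/\ (components A #= `I_k)%card,
      forall C, components A C -> closed C
    & forall C C', components A C -> components A C' -> equivalent C C'].

Definition subgroup (G : set M) : Prop :=
  [/\ G `<=` [set A | A \in unitmx], G 1,
      forall A B, G A -> G B -> G (A *m B)
    & forall A, G A -> G (invmx A)].

Definition group_iso (T : zmodType) (f : T -> M) (G : set M) : Prop :=
  [/\ subgroup G, set_bij [set: T] G f
    & forall a b, f (a + b) = f a *m f b].

(* G is the internal semidirect product of N (normal) and H. *)
Definition is_sdprod (N H G : set M) : Prop :=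
  [/\ subgroup N, subgroup H, subgroup G,
      forall A B, H A -> N B -> N (A *m B *m invmx A)
    & N `&` H = [set 1] /\ G = [set A *m B | A in N & B in H]].

Definition mxexp (A : M) : M :=
  limn (series (fun k => (k`!%:R)^-1 *: A ^+ k)).

(* eta must be diagonal of signature (+,-,..,-) on the coordinates for the
   last condition to select the time-orientation preserving isometries. *)
Definition hyperbolic_rotations (eta : M) : set M :=
  [set A | [/\ A^T *m eta *m A = eta, \det A = 1 & 0 < A ord0 ord0]].

End Homogeneous.

Section Curves.
Variable R : realType.

Definition pt (x y : R) : 'cV[R]_2 := \col_(i < 2) (if i == 0 then x else y).

Definition mx22 (a b c d : R) : 'M[R]_2 :=
  \matrix_(i < 2, j < 2) if i == 0 then (if j == 0 then a else b)
                         else (if j == 0 then c else d).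

Definition std_poly (L K : R) : mpoly 2 R :=
  let x : mpoly 2 R := mpolyX R (mnm1 0) in
  let y : mpoly 2 R := mpolyX R (mnm1 1) in
  x ^+ 4 - x ^+ 2 * y ^+ 2 + L *: (x * y ^+ 3) + K *: y ^+ 4.

Definition quartic_ccgpsr_curve (H : set 'cV[R]_2) : Prop :=
  exists h : mpoly 2 R, ccgpsr 4 h H.

Definition standard_form (h : mpoly 2 R) (H : set 'cV[R]_2) : Prop :=
  H (pt 1 0) /\ exists L K, h = std_poly L K.

Inductive normal_form : Type :=
  | FormA | FormB | FormC | FormD (K : R) of K < 4^-1.

Definition nf_poly (c : normal_form) : mpoly 2 R :=
  match c with
  | FormA => std_poly 0 4^-1
  | FormB => std_poly (2 * Num.sqrt 2 / (3 * Num.sqrt 3)) (- 12^-1)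
  | FormC => std_poly (2 / (3 * Num.sqrt 3)) 0
  | FormD K _ => std_poly 0 K
  end.

Definition nf_curve (c : normal_form) : set 'cV[R]_2 :=
  connected_component (hyperbolic_locus (nf_poly c)) (pt 1 0).

Definition flip_x : 'M[R]_2 := mx22 (- 1) 0 0 1.
Definition flip_y : 'M[R]_2 := mx22 1 0 0 (- 1).

(* (x, y) |-> (- k y, k^-1 x); its square is -1, so that it has order 4 and
   becomes an involution only modulo {1, -1}. *)
Definition turn (k : R) : 'M[R]_2 := mx22 0 (- k) k^-1 0.

(* D is the internal semidirect product of the cyclic group of order 4
   generated by turn k (normal) and the group of order 2 generated by
   flip_y. *)
Definition turn_flip_group (k : R) (D : set 'M[R]_2) : Prop :=
  exists C S : set 'M[R]_2,
    [/\ group_iso (fun i : 'Z_4 => turn k ^+ i) C,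
        group_iso (fun i : 'Z_2 => flip_y ^+ i) S & is_sdprod C S D].

Definition generator_b : 'M[R]_2 :=
  Num.sqrt 2 *: mx22 0 2^-1 1 (Num.sqrt 2 / Num.sqrt 3).

(* The columns of the first factor are eigenvectors of generator_b for the
   eigenvalues sqrt 3 and - 1 / sqrt 3; the last factor is its inverse. *)
Definition flow_b (t : R) : 'M[R]_2 :=
  mx22 1 (Num.sqrt 3 / Num.sqrt 2) (Num.sqrt 6) (- 1)
  *m mx22 (expR (Num.sqrt 3 * t)) 0 0 (expR (- (t / Num.sqrt 3)))
  *m mx22 4^-1 (3 / (4 * Num.sqrt 6))
          (Num.sqrt 3 / (2 * Num.sqrt 2)) (- 4^-1).

End Curves.

Arguments FormA {R}.
Arguments FormB {R}.
Arguments FormC {R}.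

(* Main.v *)
(* A closed connected quartic curve is determined by the cone over it. Closedness
   means that this cone can only end on lines where the quartic h vanishes, and
   it has to end on both sides: in coordinates where a point of the curve is
   (1, 0) and h is in standard form, put P(t) = h(1, t) = 1 - t^2 + L t^3 + K t^4.
   At the first critical point t > 0 of P hyperbolicity forces P''(t) < 0, which
   is impossible since P decreases up to there; so P would decrease on the whole
   half-line while remaining positive. In coordinates (x, y) along the two
   boundary lines
     h = x y (al x^2 + be x y + ga y^2),
   and the curve is {h = 1, x > 0, y > 0}. The Hessian determinant of h is
     - 9 (al x^2 - ga y^2)^2 - 12 be h,
   so hyperbolicity on the quadrant means al, ga >= 0 and either be > 0, or
   be = 0 and exactly one of al, ga vanishes. A linear map between two such
   curves maps the quadrant onto itself, hence it is monomial with positive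
   entries. Up to positive monomial maps the triple (al, be, ga) is determined by
   its zero pattern and the invariant al ga / be^2, which gives the four normal
   forms, with K = 1/4 - al ga / be^2 for the family d. An automorphism of h
   permutes the sectors on which h is positive and hyperbolic, and in null
   coordinates the stabiliser of a sector consists of positive monomial maps. *)

Require Import Defs.
From HB Require Import structures.
From mathcomp Require Import all_boot all_order all_algebra.
From mathcomp Require Import all_classical all_reals all_analysis.
From mathcomp Require Import -(notations) mpoly.
From mathcomp Require Import ring lra.

Set Implicit Arguments.
Unset Strict Implicit.
Unset Printing Implicit Defensive.

Import Order.TTheory GRing.Theory Num.Theory.
Import numFieldNormedType.Exports.

Local Open Scope classical_set_scope.
Local Open Scope ring_scope.

(** A curve [H] is only known to be a closed connected set cut out locally by some smooth function
    with nonzero differential, and nothing ties that function to [h - 1]. The obstacle is to show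
    that the set of rays through [H] is open. The intermediate value theorem suffices for this,
    without an implicit function: [H] must be transversal to its rays, because a piece of [H]
    running through [p] in the radial direction would contain points near [p] where [h < 1].
    Openness and the closedness of [H] then let the family of rays stop only at zeros of [h]. Once
    the cone over [H] contains a sector bounded by zero lines of [h], connectedness gives equality,
    since the curve in the sector is already a whole component of the hyperbolic locus. The
    components are counted with the product of the two null coordinates: this quadratic form is
    positive exactly on a sector and its opposite, so sign computations replace any discussion of
    angles. *)

(** * Binary quartics, and those that vanish on both coordinate axes *)

Section BinaryQuartics.
Variable R : realType.
Implicit Types a b c d e x y p q r s t u v w al be ga : R.

Definition quart a b c d e x y : R :=
  a * x ^+ 4 + b * x ^+ 3 * y + c * x ^+ 2 * y ^+ 2 + d * x * y ^+ 3 +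
  e * y ^+ 4.

Definition quartx a b c d x y : R :=
  4 * a * x ^+ 3 + 3 * b * x ^+ 2 * y + 2 * c * x * y ^+ 2 + d * y ^+ 3.

Definition quarty b c d e x y : R :=
  b * x ^+ 3 + 2 * c * x ^+ 2 * y + 3 * d * x * y ^+ 2 + 4 * e * y ^+ 3.

(** The Hessian determinant [h_xx h_yy - h_xy ^ 2]. In two variables it is the same for [h] and
    [- h], so its sign decides hyperbolicity. *)
Definition hdet a b c d e x y : R :=
  (12 * a * x ^+ 2 + 6 * b * x * y + 2 * c * y ^+ 2) *
    (2 * c * x ^+ 2 + 6 * d * x * y + 12 * e * y ^+ 2) -
  (3 * b * x ^+ 2 + 4 * c * x * y + 3 * d * y ^+ 2) ^+ 2.

(** The chain rule for a linear substitution: the gradient is multiplied by the transpose, and the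
    Hessian changes by congruence, which gives the squared determinant. The existential keeps the
    expanded coefficients out of every later argument. *)
Lemma quart_subst a b c d e p q r s : exists a' b' c' d' e',
  [/\ forall x y, quartx a' b' c' d' x y =
                p * quartx a b c d (p * x + q * y) (r * x + s * y) +
                r * quarty b c d e (p * x + q * y) (r * x + s * y),
    forall x y, quarty b' c' d' e' x y =
                q * quartx a b c d (p * x + q * y) (r * x + s * y) +
                s * quarty b c d e (p * x + q * y) (r * x + s * y),
    forall x y, quart a' b' c' d' e' x y =
                quart a b c d e (p * x + q * y) (r * x + s * y)
  & forall x y, hdet a' b' c' d' e' x y = (p * s - q * r) ^+ 2 *
                hdet a b c d e (p * x + q * y) (r * x + s * y)].
Proof.
exists (quart a b c d e p r).
exists (4 * a * p ^+ 3 * q + b * (3 * p ^+ 2 * q * r + p ^+ 3 * s) +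
  c * (2 * p * q * r ^+ 2 + 2 * p ^+ 2 * r * s) +
  d * (q * r ^+ 3 + 3 * p * r ^+ 2 * s) + 4 * e * r ^+ 3 * s).
exists (6 * a * p ^+ 2 * q ^+ 2 +
  b * (3 * p * q ^+ 2 * r + 3 * p ^+ 2 * q * s) +
  c * (q ^+ 2 * r ^+ 2 + 4 * p * q * r * s + p ^+ 2 * s ^+ 2) +
  d * (3 * q * r ^+ 2 * s + 3 * p * r * s ^+ 2) + 6 * e * r ^+ 2 * s ^+ 2).
exists (4 * a * p * q ^+ 3 + b * (q ^+ 3 * r + 3 * p * q ^+ 2 * s) +
  c * (2 * q ^+ 2 * r * s + 2 * p * q * s ^+ 2) +
  d * (3 * q * r * s ^+ 2 + p * s ^+ 3) + 4 * e * r * s ^+ 3).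
exists (quart a b c d e q s).
by split=> x y; rewrite /quart /quartx /quarty /hdet; ring.
Qed.

(** Five pairwise non-proportional points determine a binary quartic; they are taken in the open
    quadrant because equality is only available there. *)
Lemma quart_inj a b c d e a' b' c' d' e' :
  (forall x y, 0 < x -> 0 < y ->
     quart a b c d e x y = quart a' b' c' d' e' x y) ->
  [/\ a = a', b = b', c = c', d = d' & e = e'].
Proof.
move=> E.
have := (E 1 1, E 1 2, E 2 1, E 1 3, E 3 1).
rewrite /quart => -[[[[]]]].
do 5 (move=> /(_ ltac:(lra) ltac:(lra)) ?); split; lra.
Qed.

Definition nullq al be ga x y : R :=
  x * y * (al * x ^+ 2 + be * (x * y) + ga * y ^+ 2).

Lemma nullqE al be ga x y : nullq al be ga x y = quart 0 al be ga 0 x y.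
Proof. by rewrite /nullq /quart; ring. Qed.

Lemma nullq_inj al be ga al' be' ga' :
  (forall x y, 0 < x -> 0 < y ->
     nullq al be ga x y = nullq al' be' ga' x y) ->
  [/\ al = al', be = be' & ga = ga'].
Proof.
move=> E; have [|_ -> -> -> _] := @quart_inj 0 al be ga 0 0 al' be' ga' 0 => //.
by move=> x y x0 y0; rewrite -!nullqE E.
Qed.

Definition good al be ga : Prop :=
  [/\ 0 <= al, 0 <= ga &
      0 < be \/ [/\ be = 0, al * ga = 0 & 0 < al + ga]].

Lemma hdet_null al be ga x y : hdet 0 al be ga 0 x y =
  - 9 * (al * x ^+ 2 - ga * y ^+ 2) ^+ 2 - 12 * be * nullq al be ga x y.
Proof. by rewrite /hdet /nullq; ring. Qed.

Lemma nullq_gt0 al be ga x y : good al be ga -> 0 < x -> 0 < y ->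
  0 < nullq al be ga x y.
Proof.
move=> [a0 c0 H] x0 y0.
have xy := mulr_gt0 x0 y0.
have a1 : 0 <= al * x ^+ 2 by rewrite mulr_ge0 // sqr_ge0.
have c1 : 0 <= ga * y ^+ 2 by rewrite mulr_ge0 // sqr_ge0.
rewrite /nullq mulr_gt0 //; case: H => [b0|[-> _ ac]].
  have := mulr_gt0 b0 xy; lra.
have [a2|a2] := ltrP 0 al; last have {}a2: 0 < ga by lra.
  have : 0 < al * x ^+ 2 by rewrite mulr_gt0 // exprn_gt0.
  lra.
have : 0 < ga * y ^+ 2 by rewrite mulr_gt0 // exprn_gt0.
lra.
Qed.

Lemma hdet_good al be ga x y : good al be ga -> 0 < x -> 0 < y ->
  hdet 0 al be ga 0 x y < 0.
Proof.
move=> H x0 y0; have q0 := nullq_gt0 H x0 y0.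
rewrite hdet_null; case: H => [a0 c0 [b0|[-> ac acp]]].
  have := mulr_gt0 b0 q0.
  have := sqr_ge0 (al * x ^+ 2 - ga * y ^+ 2); lra.
suff : 0 < (al * x ^+ 2 - ga * y ^+ 2) ^+ 2 by lra.
rewrite exprn_even_gt0 //=; apply/eqP.
move/eqP: ac; rewrite mulf_eq0 => /orP[] /eqP e; rewrite e.
  have : 0 < ga * y ^+ 2 by rewrite mulr_gt0 ?exprn_gt0 //; lra.
  lra.
have : 0 < al * x ^+ 2 by rewrite mulr_gt0 ?exprn_gt0 //; lra.
lra.
Qed.

(** Replaces the limit for [t] tending to 0 from the right; it reads off values on the boundary of
    the quadrant. *)
Lemma quad_limit_ge0 u v w :
  (forall t, 0 < t -> 0 < u + v * t + w * t ^+ 2) -> 0 <= u.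
Proof.
move=> H; case: (lerP 0 u) => // u0.
(* With this [m] the point [t = - u / m] is below 1, so [w * t ^ 2] is at most [|w| * t] and the two
   perturbation terms together stay below [- u]. *)
pose m := `|v| + `|w| + 1 - u.
have m0 : 0 < m by rewrite /m; have := normr_ge0 v; have := normr_ge0 w; lra.
have t0 : 0 < - u / m by apply: divr_gt0; lra.
have := H _ t0; set t := _ / _ in t0 *.
have tm : t * m = - u by rewrite /t; field; lra.
have t1 : t < 1 by rewrite /t ltr_pdivrMr //; rewrite /m; have := normr_ge0 v;
  have := normr_ge0 w; lra.
have : v * t <= `|v| * t by rewrite ler_wpM2r ?ler_norm // ltW.
have : w * t ^+ 2 <= `|w| * t.
have h1 : w * t ^+ 2 <= `|w| * t ^+ 2 by rewrite ler_wpM2r ?ler_norm ?sqr_ge0.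
apply: le_trans h1 _; rewrite ler_wpM2l // expr2; nra.
have : t * m = `|v| * t + `|w| * t + t - u * t by rewrite /m; ring.
have : 0 < t * (- u) by rewrite mulr_gt0 //; lra.
lra.
Qed.

Lemma good_of_hyp al be ga :
  (forall x y, 0 < x -> 0 < y -> 0 < nullq al be ga x y) ->
  (forall x y, 0 < x -> 0 < y -> hdet 0 al be ga 0 x y < 0) ->
  good al be ga.
Proof.
move=> Hg Hd.
have Hq x y : 0 < x -> 0 < y -> 0 < al * x ^+ 2 + be * (x * y) + ga * y ^+ 2.
  by move=> x0 y0; have := Hg x y x0 y0; rewrite /nullq pmulr_rgt0 // mulr_gt0.
have a0 : 0 <= al.
  by apply: (@quad_limit_ge0 al be ga) => t t0; have := Hq 1 t ltr01 t0;
    rewrite expr1n mulr1 mul1r.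
have c0 : 0 <= ga.
  by apply: (@quad_limit_ge0 ga be al) => t t0; have := Hq t 1 t0 ltr01;
    rewrite expr1n !mulr1; lra.
split=> //.
have H11 := Hq 1 1 ltr01 ltr01.
have [ac|ac] := eqVneq (al * ga) 0.
  (* One outer coefficient vanishes, so the quadratic factor is divisible by a variable, and [be] is
     the limit of the quotient at the axis. *)
  have b0 : 0 <= be.
    move/eqP: (ac); rewrite mulf_eq0 => /orP[] /eqP e.
      apply: (@quad_limit_ge0 be ga 0) => t t0; rewrite mul0r addr0;
        have := Hq 1 t ltr01 t0.
      rewrite e !(mul0r, add0r, mul1r).
      have -> : be * t + ga * t ^+ 2 = (be + ga * t) * t by ring.
      by rewrite pmulr_lgt0.
    apply: (@quad_limit_ge0 be al 0) => t t0; rewrite mul0r addr0;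
      have := Hq t 1 t0 ltr01.
    rewrite e !(mul0r, addr0, mulr1).
    have -> : al * t ^+ 2 + be * t = (be + al * t) * t by ring.
    by rewrite pmulr_lgt0.
  move: b0; rewrite le_eqVlt => /orP[/eqP b0|]; last by left.
  by right; split=> //; rewrite -b0 in H11; lra.
left.
have a1 : 0 < al by rewrite lt_def a0 andbT; apply: contraNneq ac => ->;
  rewrite mul0r.
have c1 : 0 < ga by rewrite lt_def c0 andbT; apply: contraNneq ac => ->;
  rewrite mulr0.
(* At [(sqrt ga, sqrt al)] the square in [hdet_null] vanishes, and only [- 12 be h] remains. *)
have x0 : 0 < Num.sqrt ga by rewrite sqrtr_gt0.
have y0 : 0 < Num.sqrt al by rewrite sqrtr_gt0.
have := Hd _ _ x0 y0; have := Hg _ _ x0 y0.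
rewrite hdet_null !sqr_sqrtr //.
have -> : al * ga - ga * al = 0 by ring.
rewrite expr0n /= mulr0 sub0r oppr_lt0 => g0.
by rewrite -mulrA pmulr_rgt0 ?ltr0n // pmulr_lgt0.
Qed.

End BinaryQuartics.

(** * Lorentzian signature of a 2 by 2 matrix *)

Section Lorentz.
Variable R : realType.

Lemma det_mx22 (S : 'M[R]_2) : \det S = S 0 0 * S 1 1 - S 0 1 * S 1 0.
Proof.
rewrite (expand_det_row _ 0) !big_ord_recl big_ord0 /cofactor !det_mx11 !mxE /=.
have -> : lift 0 0 = 1 :> 'I_2 by apply/val_inj.
have -> : lift 1 0 = 0 :> 'I_2 by apply/val_inj.
by rewrite addr0 /bump /= expr0 expr1; ring.
Qed.

Lemma char_poly_mx22 (S : 'M[R]_2) (a b : R) :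
  a + b = S 0 0 + S 1 1 -> a * b = \det S ->
  char_poly S = \prod_(c <- [:: a; b]) ('X - c%:P).
Proof.
move=> tr dt; apply/polyP => i.
have sz : size (\prod_(c <- [:: a; b]) ('X - c%:P)) = 3%N
  by rewrite size_prod_XsubC.
have E : \prod_(c <- [:: a; b]) ('X - c%:P) =
  'X^2 - (a + b)%:P * 'X + (a * b)%:P :> {poly R}.
  by rewrite !big_cons big_nil polyCD polyCM; ring.
case: i => [|[|[|i]]].
- rewrite char_poly_det E !coefE /=.
  rewrite -dt; ring.
- rewrite (@char_poly_trace _ 2) // E !coefE /= tr /mxtrace !big_ord_recl
  big_ord0.
  by have -> : lift 0 0 = 1 :> 'I_2 by [apply/val_inj]; ring.
- have /monicP := char_poly_monic S; rewrite /lead_coef size_char_poly /= => ->.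
  by rewrite E !coefE /=; ring.
- by rewrite !nth_default ?sz ?size_char_poly.
Qed.

(** The determinant is the product of the two eigenvalues. Conversely, a negative determinant makes
    the discriminant of the characteristic polynomial positive, so the quadratic formula gives two
    real roots, and their signs are opposite. *)
Lemma lorentzian2P (S : 'M[R]_2) : lorentzian S <-> \det S < 0.
Proof.
split=> [[s [E c1 c2]]|d0].
  have sz : size s = 2%N.
    have := congr1 (fun p : {poly R} => size p) E.
    by rewrite size_char_poly size_prod_XsubC => -[].
  have dt := char_poly_det S; rewrite E expr2 mulrNN !mul1r in dt.
  case: s sz c1 c2 E dt => [|a [|b []]] //= _.
  rewrite !addn0 => c1 c2 _ dt; rewrite -dt !big_cons big_nil mulr1.
  rewrite -horner_coef0 !hornerE.
  by move: c1 c2; case: (ltrgtP a 0) => a0; case: (ltrgtP b 0) => b0 //= _ _;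
    nra.
pose t := S 0 0 + S 1 1; pose D := t ^+ 2 - 4 * \det S.
have D0 : 0 < D by rewrite /D; have := sqr_ge0 t; lra.
pose w := Num.sqrt D; have w2 : w ^+ 2 = D by rewrite sqr_sqrtr // ltW.
pose a := (t - w) / 2; pose b := (t + w) / 2.
have ab : a * b = \det S.
  have <- : (t ^+ 2 - w ^+ 2) / 4 = \det S by rewrite w2 /D; field.
  by rewrite /a /b; field.
have w0 : 0 <= w := sqrtr_ge0 D.
have a_lt_b : a <= b by rewrite /a /b; lra.
have a0 : a < 0 by nra.
have b0 : 0 < b by nra.
exists [:: a; b]; split.
- by apply: char_poly_mx22 => //; rewrite /a /b -/t; field.
- by rewrite /= a0 (ltNge b) (ltW b0).
- by rewrite /= b0 (ltNge _ a) (ltW a0).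
Qed.

End Lorentz.

(** * Homogeneous polynomials of degree 4 in two variables and their derivatives *)

Section Polynomials.
Variable R : realType.
Implicit Types (h : mpoly 2 R) (v : 'cV[R]_2).

Definition mon (i j : nat) : mpoly 2 R :=
  mpolyX R (mnm1 0) ^+ i * mpolyX R (mnm1 1) ^+ j.

Lemma ord2P (P : 'I_2 -> Prop) : P 0 -> P 1 -> forall i, P i.
Proof.
move=> P0 P1 [[|[|//]] lti];
  [have -> : Ordinal lti = 0|have -> : Ordinal lti = 1] => //;
  exact/val_inj.
Qed.

Lemma monE (m : multinom 2) : mpolyX R m = mon (m 0) (m 1).
Proof.
rewrite /mon !mpolyXn -mpolyXD; congr mpolyX; apply/mnmP.
by apply: ord2P; rewrite mnmDE !mulmnE !mnmE /= ?muln1 ?muln0 ?addn0 ?mul1n.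
Qed.

Lemma peval_mon i j v : peval (mon i j) v = v 0 0 ^+ i * v 1 0 ^+ j.
Proof. by rewrite /peval /mon mevalM !rmorphXn /= !mevalXU. Qed.

Lemma mderiv0_mon i j : mderiv 0 (mon i j) = i%:R *: mon i.-1 j.
Proof.
rewrite {1}/mon !mpolyXn -mpolyXD mderivX monE.
by rewrite !(mnmBE, mnmDE, mulmnE, mnmE) /= ?muln1 ?muln0 ?mul1n ?mul0n ?addn0
  ?subn0 ?subn1 /=.
Qed.

Lemma mderiv1_mon i j : mderiv 1 (mon i j) = j%:R *: mon i j.-1.
Proof.
rewrite {1}/mon !mpolyXn -mpolyXD mderivX monE.
by rewrite !(mnmBE, mnmDE, mulmnE, mnmE) /= ?muln1 ?muln0 ?mul1n ?mul0n ?addn0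
  ?subn0 ?subn1 /=.
Qed.

Definition quartp (a b c d e : R) : mpoly 2 R :=
  a *: mon 4 0 + b *: mon 3 1 + c *: mon 2 2 + d *: mon 1 3 + e *: mon 0 4.

Lemma pevalD h h' v : peval (h + h') v = peval h v + peval h' v.
Proof. exact: mevalD. Qed.

Lemma pevalZ (c : R) h v : peval (c *: h) v = c * peval h v.
Proof. exact: mevalZ. Qed.

Definition pevalE := (pevalD, pevalZ, peval_mon).

Lemma peval_quartp a b c d e v :
  peval (quartp a b c d e) v = quart a b c d e (v 0 0) (v 1 0).
Proof.
by rewrite /quartp /quart !pevalE; ring.
Qed.

Definition mderivE := (@mderivD, @mderivZ, mderiv0_mon, mderiv1_mon).

Lemma peval_mderiv0_quartp a b c d e v :
  peval (mderiv 0 (quartp a b c d e)) v = quartx a b c d (v 0 0) (v 1 0).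
Proof.
by rewrite /quartp /quartx /quarty !mderivE /= !pevalE; ring.
Qed.

Lemma peval_mderiv1_quartp a b c d e v :
  peval (mderiv 1 (quartp a b c d e)) v = quarty b c d e (v 0 0) (v 1 0).
Proof.
by rewrite /quartp /quartx /quarty !mderivE /= !pevalE; ring.
Qed.

Lemma hyperbolic_quartpP a b c d e v :
  hyperbolic_point (quartp a b c d e) v <-> hdet a b c d e (v 0 0) (v 1 0) < 0.
Proof.
rewrite /hyperbolic_point lorentzian2P det_mx22 !mxE /quartp !mderivE /=
  !pevalE.
rewrite [X in X < 0 <-> _](_ : _ = hdet a b c d e (v 0 0) (v 1 0)) //.
by rewrite /hdet; ring.
Qed.

Lemma quartp_homog h : homogeneous_poly 4 h ->
  exists a b c d e, h = quartp a b c d e.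
Proof.
move=> /dhomogP hh; rewrite (mpolyE h) big_seq.
apply: (big_ind (fun h => exists a b c d e, h = quartp a b c d e)).
- by exists 0, 0, 0, 0, 0; rewrite /quartp !scale0r !addr0.
- move=> _ _ [a [b [c [d [e ->]]]]] [a' [b' [c' [d' [e' ->]]]]].
  exists (a + a'), (b + b'), (c + c'), (d + d'), (e + e').
  by rewrite /quartp !scalerDl; do 4 (rewrite addrACA; congr (_ + _)).
move=> m /hh dm; set k := mcoeff m h; rewrite monE.
have : addn (m 0) (m 1) = 4%N.
  have <- : mdeg m = 4%N := dm.
  rewrite mdegE !big_ord_recl big_ord0 addn0; congr (addn _ (m _)).
  exact/val_inj.
move: (m 0) (m 1) => [|[|[|[|[|//]]]]] j /=; rewrite ?addSn ?add0n; move=> [->].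
- by exists 0, 0, 0, 0, k; rewrite /quartp !scale0r ?addr0 ?add0r.
- by exists 0, 0, 0, k, 0; rewrite /quartp !scale0r ?addr0 ?add0r.
- by exists 0, 0, k, 0, 0; rewrite /quartp !scale0r ?addr0 ?add0r.
- by exists 0, k, 0, 0, 0; rewrite /quartp !scale0r ?addr0 ?add0r.
- by exists k, 0, 0, 0, 0; rewrite /quartp !scale0r ?addr0 ?add0r.
Qed.

Lemma quartp_homogeneous a b c d e : homogeneous_poly 4 (quartp a b c d e).
Proof.
have H i j : (i + j = 4)%N -> mon i j \is @ishomog1 2 R 4 (@mdeg 2).
  move=> ij; rewrite /mon !mpolyXn -mpolyXD dhomogX /=.
  by rewrite mdegD !mdegMn !mdeg1 !mul1n ij.
by rewrite /homogeneous_poly /quartp !rpredD // rpredZ // H.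
Qed.

Lemma std_polyE (L K : R) : std_poly L K = quartp 1 0 (- 1) L K.
Proof.
rewrite /std_poly /quartp /mon !expr0 !mulr1 !mul1r !expr1 scale1r scale0r
  addr0.
by rewrite scaleN1r.
Qed.

End Polynomials.

(** * Linear algebra, smoothness and continuity in the plane *)

Section Plane.
Variable R : realType.
Local Notation V := 'cV[R]_2.
Implicit Types (A B : 'M[R]_2) (u v w : V) (f g : V -> R).

Lemma ptE (x y : R) : (pt x y 0 0 = x) * (pt x y 1 0 = y).
Proof. by rewrite !mxE. Qed.

Lemma pt_eta v : v = pt (v 0 0) (v 1 0).
Proof.
apply/matrixP => i j; rewrite mxE (ord1 j).
by move: i; apply: ord2P.
Qed.

Lemma eq_col2 v w : v 0 0 = w 0 0 -> v 1 0 = w 1 0 -> v = w.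
Proof. by move=> e0 e1; rewrite (pt_eta v) (pt_eta w) e0 e1. Qed.

Lemma mulmx_col2 A v i : (A *m v) i 0 = A i 0 * v 0 0 + A i 1 * v 1 0.
Proof.
rewrite mxE !big_ord_recl big_ord0 addr0.
by have -> : lift 0 0 = 1 :> 'I_2 by exact/val_inj.
Qed.

Lemma mulmx_ptE A (x y : R) :
  A *m pt x y = x *: (A *m pt 1 0) + y *: (A *m pt 0 1).
Proof.
rewrite !scalemxAr -mulmxDr; congr (_ *m _).
by apply: eq_col2; rewrite !mxE /= ?mulr1 ?mulr0 ?addr0 ?add0r.
Qed.

Lemma mx22_eta A : A = mx22 (A 0 0) (A 0 1) (A 1 0) (A 1 1).
Proof.
by apply/matrixP => i j; rewrite mxE; move: i j; apply: ord2P; apply: ord2P.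
Qed.

Lemma mx22E (a b c d : R) : (mx22 a b c d 0 0 = a) * (mx22 a b c d 0 1 = b) *
  (mx22 a b c d 1 0 = c) * (mx22 a b c d 1 1 = d).
Proof. by rewrite !mxE. Qed.

Lemma mul_mx22 (a b c d a' b' c' d' : R) :
  mx22 a b c d *m mx22 a' b' c' d' =
  mx22 (a * a' + b * c') (a * b' + b * d') (c * a' + d * c') (c * b' + d * d').
Proof.
apply/matrixP => i j; rewrite mxE !big_ord_recl big_ord0 addr0.
have -> : lift 0 0 = 1 :> 'I_2 by exact/val_inj.
by rewrite !mxE; move: i j; apply: ord2P; apply: ord2P.
Qed.

Lemma mul_mx22_pt (a b c d x y : R) :
  mx22 a b c d *m pt x y = pt (a * x + b * y) (c * x + d * y).
Proof. by apply: eq_col2; rewrite mulmx_col2 !mx22E !ptE. Qed.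

Lemma det_mx22E (a b c d : R) : \det (mx22 a b c d) = a * d - b * c.
Proof. by rewrite det_mx22 !mx22E. Qed.

Lemma unitmx22 A : (A \in unitmx) = (\det A != 0).
Proof. by rewrite unitmxE unitfE. Qed.

Lemma mx22_1 : 1%:M = mx22 1 0 0 1 :> 'M[R]_2.
Proof. by rewrite [LHS]mx22_eta !mxE. Qed.

Lemma mx22_1R : 1 = mx22 1 0 0 1 :> 'M[R]_2.
Proof. exact: mx22_1. Qed.

(** A class closed under all directional derivatives, as the induction on the order of
    differentiability requires. *)
Inductive polyfun : (V -> R) -> Prop :=
| polyfun_cst (c : R) : polyfun (cst c)
| polyfun_coord (i : 'I_2) : polyfun (fun v => v i 0)
| polyfunD f g : polyfun f -> polyfun g -> polyfun (f + g)
| polyfunM f g : polyfun f -> polyfun g -> polyfun (f * g).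

Lemma polyfun_differentiable f : polyfun f -> forall p, differentiable f p.
Proof.
elim=> [c|i|{}f g _ IHf _ IHg|{}f g _ IHf _ IHg] p.
- exact: differentiable_cst.
- exact: differentiable_coord.
- exact: differentiableD.
- exact: differentiableM.
Qed.

#[global] Instance is_derive_coord (i : 'I_2) (p v : V) :
  is_derive p v (fun w : V => w i 0) (v i 0).
Proof.
apply: DeriveDef; first exact/diff_derivable/differentiable_coord.
rewrite /derive; apply: cvg_lim => //; apply: cvg_near_cst.
near=> h; rewrite /= !mxE addrK scalerA mulVf ?scale1r //.
by near: h; exact: nbhs_dnbhs_neq.
Unshelve. all: by end_near. Qed.

Lemma polyfun_derive f v : polyfun f -> polyfun (fun p => 'D_v f p).
Proof.
elim=> [c|i|{}f g pf IHf pg IHg|{}f g pf IHf pg IHg].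
- rewrite (_ : (fun _ => _) = cst 0); first exact: polyfun_cst.
  by apply/funext => p; rewrite derive_cst.
- rewrite (_ : (fun _ => _) = cst (v i 0)); first exact: polyfun_cst.
  by apply/funext => p; rewrite derive_val.
- rewrite (_ : (fun _ => _) = (fun p => 'D_v f p) + (fun p => 'D_v g p)).
    exact: polyfunD.
  by apply/funext => p; rewrite deriveD //;
    exact/diff_derivable/polyfun_differentiable.
- rewrite (_ : (fun _ => _) = f * (fun p => 'D_v g p) + g *
  (fun p => 'D_v f p)).
    by apply: polyfunD; apply: polyfunM.
  by apply/funext => p; rewrite deriveM //;
    exact/diff_derivable/polyfun_differentiable.
Qed.

Lemma polyfun_continuous f : polyfun f -> continuous f.
Proof. by move=> pf p;
  exact/differentiable_continuous/polyfun_differentiable. Qed.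

Lemma polyfun_smooth U f : polyfun f -> smooth U f.
Proof.
move=> pf k; elim: k f pf => [|k IH] f pf /=.
  by move=> p _; exact: polyfun_continuous.
by split=> [p _|v]; [exact: polyfun_differentiable|exact/IH/polyfun_derive].
Qed.

Lemma polyfunX f n : polyfun f -> polyfun (f ^+ n).
Proof.
move=> pf; elim: n => [|n IH]; first by rewrite expr0; exact: (polyfun_cst 1).
by rewrite exprS; exact: polyfunM.
Qed.

Lemma quart_fctE a b c d e (t : R) :
  (fun v : V => quart a b c d e (v 0 0) (v 1 0) + t) =
  cst a * (fun v : V => v 0 0) ^+ 4
  + cst b * (fun v : V => v 0 0) ^+ 3 * (fun v : V => v 1 0)
  + cst c * (fun v : V => v 0 0) ^+ 2 * (fun v : V => v 1 0) ^+ 2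
  + cst d * (fun v : V => v 0 0) * (fun v : V => v 1 0) ^+ 3
  + cst e * (fun v : V => v 1 0) ^+ 4 + cst t.
Proof. by apply/funext => v; rewrite /quart !fctE. Qed.

Lemma polyfun_quart a b c d e (t : R) :
  polyfun (fun v => quart a b c d e (v 0 0) (v 1 0) + t).
Proof.
rewrite quart_fctE.
by repeat (first [exact: polyfun_cst|exact: polyfun_coord|apply: polyfunD|
  apply: polyfunM|apply: polyfunX]).
Qed.

(** Euler's identity: on the level set [h = 1] the radial derivative of [h] is 4, so the level set
    is regular at each of its points. *)
Lemma euler_quart a b c d e (t : R) p :
  'D_p (fun v : V => quart a b c d e (v 0 0) (v 1 0) + t) p =
  4 * quart a b c d e (p 0 0) (p 1 0).
Proof.
have dx := is_derive_coord 0 p p; have dy := is_derive_coord 1 p p.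
have dc (r : R) := is_derive_cst r p p.
have D := is_deriveD (is_deriveD (is_deriveD (is_deriveD (is_deriveD
  (is_deriveM (dc a) (is_deriveX 4 dx))
  (is_deriveM (is_deriveM (dc b) (is_deriveX 3 dx)) dy))
  (is_deriveM (is_deriveM (dc c) (is_deriveX 2 dx)) (is_deriveX 2 dy)))
  (is_deriveM (is_deriveM (dc d) dx) (is_deriveX 3 dy)))
  (is_deriveM (dc e) (is_deriveX 4 dy))) (dc t).
rewrite quart_fctE; case: D => _ ->.
by rewrite !fctE /quart /GRing.scale /=; ring.
Qed.

Lemma continuous_mulmx_coord A (i : 'I_2) :
  continuous (fun v : V => (A *m v) i 0).
Proof.
rewrite (_ : (fun _ => _) = cst (A i 0) * (fun v : V => v 0 0) +
    cst (A i 1) * (fun v : V => v 1 0)).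
  by apply: polyfun_continuous; apply: polyfunD; apply: polyfunM;
    first [exact: polyfun_cst|exact: polyfun_coord].
by apply/funext => w; rewrite mulmx_col2 !fctE.
Qed.

Lemma continuous_quart a b c d e :
  continuous (fun v : V => quart a b c d e (v 0 0) (v 1 0)).
Proof.
have := polyfun_continuous (polyfun_quart a b c d e 0).
by under eq_fun do rewrite addr0.
Qed.

(** Neighbourhoods of a matrix are generated by products of neighbourhoods of its finitely many
    entries. *)
Lemma cvg_mx (T : Type) (F : set_system T) {FF : Filter F} m n
  (f : T -> 'M[R]_(m, n)) (M : 'M[R]_(m, n)) :
  (forall i j, f t i j @[t --> F] --> M i j) -> f @ F --> M.
Proof.
move=> H X [P MP sPX].
have : \forall t \near F, forall k : 'I_m * 'I_n, P k.1 k.2 (f t k.1 k.2).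
  by apply: filter_forall => -[i j]; exact: H (MP i j).
by apply: filterS => t Pt; apply: sPX => i j; exact: Pt (i, j).
Qed.

Lemma continuous_pt (T : topologicalType) (x y : T -> R) :
  continuous x -> continuous y -> continuous (fun t => pt (x t) (y t)).
Proof.
move=> cx cy t; apply: cvg_mx => i j.
rewrite mxE (_ : (fun _ => _) = fun t => if i == 0 then x t else y t).
  by case: ifP => _; [exact: cx|exact: cy].
by apply/funext => s; rewrite mxE.
Qed.

Lemma continuous_mulmx A : continuous (fun v : V => A *m v).
Proof.
move=> v; apply: (@cvg_mx _ (nbhs v)) => i j; rewrite (ord1 j);
  exact: continuous_mulmx_coord.
Qed.

End Plane.

(** * The curve in a sector is a closed connected component of the hyperbolic locus *)

Section Sectors.
Variable R : realType.
Local Notation V := 'cV[R]_2.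
Implicit Types (A B : 'M[R]_2) (u v w p : V) (h : mpoly 2 R) (al be ga : R).

Definition quad : set V := [set v : V | 0 < v 0 0 /\ 0 < v 1 0].

Definition nullcurve al be ga : set V :=
  [set v : V | quad v /\ nullq al be ga (v 0 0) (v 1 0) = 1].

(** Null coordinates for one sector of [h]: the matrix [A] carries the open quadrant onto a sector
    bounded by two lines on which [h] vanishes. *)
Definition sector h A al be ga : Prop :=
  [/\ A \in unitmx, good al be ga, homogeneous_poly 4 h
    & forall v, peval h (A *m v) = nullq al be ga (v 0 0) (v 1 0)].

Lemma actE A (H : set V) v : A \in unitmx -> act A H v <-> H (invmx A *m v).
Proof.
move=> uA; split; first by case=> w Hw <-; rewrite mulKmx.
by move=> Hv; exists (invmx A *m v) => //; rewrite mulKVmx.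
Qed.

Lemma peval_homog h : homogeneous_poly 4 h -> exists a b c d e,
  [/\ h = quartp a b c d e,
      forall v, peval h v = quart a b c d e (v 0 0) (v 1 0)
    & forall v, hyperbolic_point h v <-> hdet a b c d e (v 0 0) (v 1 0) < 0].
Proof.
move=> /quartp_homog [a [b [c [d [e ->]]]]]; exists a, b, c, d, e.
by split=> // v; [exact: peval_quartp|exact: hyperbolic_quartpP].
Qed.

Lemma peval_mulmx h A : homogeneous_poly 4 h -> exists a b c d e,
  [/\ forall v, quartx a b c d (v 0 0) (v 1 0) =
     A 0 0 * peval (mderiv 0 h) (A *m v) + A 1 0 * peval (mderiv 1 h) (A *m v),
   forall v, quarty b c d e (v 0 0) (v 1 0) =
     A 0 1 * peval (mderiv 0 h) (A *m v) + A 1 1 * peval (mderiv 1 h) (A *m v),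
   forall v, peval h (A *m v) = quart a b c d e (v 0 0) (v 1 0)
  & A \in unitmx -> forall v, hyperbolic_point h (A *m v) <->
      hdet a b c d e (v 0 0) (v 1 0) < 0].
Proof.
move=> /quartp_homog [a [b [c [d [e ->]]]]].
have [a' [b' [c' [d' [e' [ex ey eq ed]]]]]] :=
  quart_subst a b c d e (A 0 0) (A 0 1) (A 1 0) (A 1 1).
exists a', b', c', d', e'; split.
- by move=> v; rewrite ex peval_mderiv0_quartp peval_mderiv1_quartp !mulmx_col2.
- by move=> v; rewrite ey peval_mderiv0_quartp peval_mderiv1_quartp !mulmx_col2.
- by move=> v; rewrite peval_quartp eq !mulmx_col2.
move=> uA v; rewrite hyperbolic_quartpP ed !mulmx_col2 -det_mx22 pmulr_rlt0 //.
by rewrite exprn_even_gt0 //= -unitmx22.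
Qed.

Lemma nullq_scale al be ga (c : R) x y :
  nullq al be ga (c * x) (c * y) = c ^+ 4 * nullq al be ga x y.
Proof. by rewrite /nullq; ring. Qed.

Lemma quad_scale (c : R) v : 0 < c -> quad v -> quad (c *: v).
Proof. by move=> c0 [v0 v1]; rewrite /quad /= !mxE !mulr_gt0. Qed.

Lemma nullcurve_scale al be ga v : good al be ga -> quad v ->
  exists2 c, 0 < c & nullcurve al be ga (c *: v).
Proof.
move=> gd qv; have [v0 v1] := qv; have g0 := nullq_gt0 gd v0 v1.
pose g := nullq al be ga (v 0 0) (v 1 0).
exists (Num.sqrt (Num.sqrt g))^-1; first by rewrite invr_gt0 !sqrtr_gt0.
split; first by apply: quad_scale; rewrite ?invr_gt0 ?sqrtr_gt0 ?sqrtr_gt0.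
rewrite ![(_ *: v) _ _]mxE nullq_scale exprVn (exprM _ 2 2) !sqr_sqrtr
  ?sqrtr_ge0 ?ltW //.
by rewrite mulVf // gt_eqF.
Qed.

Lemma cone_sector A al be ga : good al be ga ->
  cone (act A (nullcurve al be ga)) = act A quad.
Proof.
move=> gd; apply/seteqP; split=> [_ [c [_ [c0 [v [qv _] <-] ->]]]|_ [v qv <-]].
  by exists (c *: v); [exact: quad_scale|rewrite scalemxAr].
have [c c0 Hc] := nullcurve_scale gd qv.
exists c^-1, (A *m (c *: v)); split; [by rewrite invr_gt0|by exists (c *: v)|].
by rewrite -scalemxAr scalerA mulVf ?scale1r // gt_eqF.
Qed.

Section OneSector.
Variables (h : mpoly 2 R) (A : 'M[R]_2) (al be ga : R).
Hypothesis sec : sector h A al be ga.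

Let uA : A \in unitmx. Proof. by case: sec. Qed.
Let gd : good al be ga. Proof. by case: sec. Qed.
Let hA v : peval h (A *m v) = nullq al be ga (v 0 0) (v 1 0).
Proof. by case: sec. Qed.

Lemma sector_hyperbolic v : quad v -> hyperbolic_point h (A *m v).
Proof.
case: sec => _ _ /(@peval_mulmx _ A) [a [b [c [d [e [_ _ E H]]]]]] _ [v0 v1].
apply/(H uA).
have [|<- <- <- <- <-] := @quart_inj _ 0 al be ga 0 a b c d e.
  by move=> x y _ _; have := E (pt x y); rewrite hA !ptE nullqE.
exact: hdet_good.
Qed.

Lemma sector_gradient v :
  quartx 0 al be ga (v 0 0) (v 1 0) =
    A 0 0 * peval (mderiv 0 h) (A *m v) + A 1 0 * peval (mderiv 1 h) (A *m v) /\
  quarty al be ga 0 (v 0 0) (v 1 0) =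
    A 0 1 * peval (mderiv 0 h) (A *m v) + A 1 1 * peval (mderiv 1 h) (A *m v).
Proof.
case: sec => _ _ /(@peval_mulmx _ A) [a [b [c [d [e [ex ey E _]]]]]] _.
rewrite -ex -ey.
have [|<- <- <- <- <-] // := @quart_inj _ 0 al be ga 0 a b c d e.
by move=> x y _ _; have := E (pt x y); rewrite hA !ptE nullqE.
Qed.

Lemma sector_curve_locus v : nullcurve al be ga v ->
  hyperbolic_locus h (A *m v).
Proof. by case=> qv gv; split; [rewrite hA|exact: sector_hyperbolic]. Qed.

Lemma sector_curveP v : act A (nullcurve al be ga) v <->
  peval h v = 1 /\ quad (invmx A *m v).
Proof.
rewrite actE // -{2}(mulKVmx uA v) hA.
by split=> -[].
Qed.

(** The quartic vanishes on both axes, so on the level set the open and the closed quadrant contain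
    the same points. Closedness of the curve and its separation from the rest of the level set both
    come from here. *)
Lemma quad_closure v : peval h v = 1 ->
  0 <= (invmx A *m v) 0 0 -> 0 <= (invmx A *m v) 1 0 -> quad (invmx A *m v).
Proof.
rewrite -{1}(mulKVmx uA v) hA /nullq; set x := _ 0 0; set y := _ 1 0.
rewrite /quad /= -/x -/y !le_eqVlt => E /orP[/eqP x0|x0] /orP[/eqP y0|y0] //.
- by move: E; rewrite -x0 !mul0r => /eqP; rewrite eq_sym oner_eq0.
- by move: E; rewrite -x0 !mul0r => /eqP; rewrite eq_sym oner_eq0.
- by move: E; rewrite -y0 mulr0 !mul0r => /eqP; rewrite eq_sym oner_eq0.
Qed.

Lemma open_quad : open [set v : V | quad (invmx A *m v)].
Proof.
apply: openI.
  apply: (@open_comp _ _ (fun v => (invmx A *m v) 0 0) [set x | 0 < x]).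
    by move=> v _; exact: continuous_mulmx_coord.
  exact: open_gt.
apply: (@open_comp _ _ (fun v => (invmx A *m v) 1 0) [set x | 0 < x]).
  by move=> v _; exact: continuous_mulmx_coord.
exact: open_gt.
Qed.

Lemma closed_quad : closed [set v : V | 0 <= (invmx A *m v) 0 0 /\
  0 <= (invmx A *m v) 1 0].
Proof.
apply: closedI.
  apply: (@preimage_closed _ _ (fun v => (invmx A *m v) 0 0) [set x | 0 <= x]).
    by move=> v _; exact: continuous_mulmx_coord.
  exact: closed_ge.
apply: (@preimage_closed _ _ (fun v => (invmx A *m v) 1 0) [set x | 0 <= x]).
  by move=> v _; exact: continuous_mulmx_coord.
exact: closed_ge.
Qed.

Lemma closed_level : closed [set v : V | peval h v = 1].
Proof.
case: sec => _ _ /peval_homog [a [b [c [d [e [_ E _]]]]]] _.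
rewrite (_ : mkset _ =
  (fun v : V => quart a b c d e (v 0 0) (v 1 0)) @^-1` [set 1]).
  apply: preimage_closed; last exact: closed_eq.
  by move=> v _; exact: continuous_quart.
by apply/seteqP; split=> v /=; rewrite E.
Qed.

Lemma sector_closed : closed (act A (nullcurve al be ga)).
Proof.
rewrite (_ : act _ _ = [set v : V | peval h v = 1] `&`
  [set v : V | 0 <= (invmx A *m v) 0 0 /\ 0 <= (invmx A *m v) 1 0]).
  exact: closedI closed_level closed_quad.
apply/seteqP; split=> v /=.
  by move=> /sector_curveP[hv [x0 y0]]; split=> //; split; exact: ltW.
by case=> hv [x0 y0]; apply/sector_curveP; split=> //; exact: quad_closure.
Qed.

(** Each ray of the quadrant meets the curve exactly once. With [s] the logarithm of [x / y], the
    ray is spanned by [(expR s, 1)] and the intersection is reached after division by [rho s], the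
    fourth root of the value of the quartic; so the curve is a continuous image of the line. *)
Lemma sector_connected : connected (act A (nullcurve al be ga)).
Proof.
pose g (s : R) := nullq al be ga (expR s) 1.
have g0 s : 0 < g s by apply: nullq_gt0 => //; exact: expR_gt0.
pose rho s := Num.sqrt (Num.sqrt (g s)).
have rho0 s : 0 < rho s by rewrite /rho !sqrtr_gt0.
have rho4 s : rho s ^+ 4 = g s.
  by rewrite (exprM _ 2 2) !sqr_sqrtr ?sqrtr_ge0 // ltW.
have cg : continuous g.
  move=> s; have -> : g = (fun v : V => quart 0 al be ga 0 (v 0 0) (v 1 0)) \o
     (fun s => pt (expR s) 1).
    by apply/funext => t; rewrite /= !ptE /g nullqE.
  apply: continuous_comp; last exact: continuous_quart.
  apply: continuous_pt; first exact: continuous_expR.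
  by move=> ?; exact: cvg_cst.
have crho : continuous rho.
  move=> s; apply: continuous_comp; last exact: sqrt_continuous.
  by apply: continuous_comp; [exact: cg|exact: sqrt_continuous].
pose F s := A *m pt (expR s * (rho s)^-1) (rho s)^-1.
have cF : continuous F.
  move=> s; apply: continuous_comp; last exact: continuous_mulmx.
  have crV : continuous (fun s => (rho s)^-1).
    by move=> t; apply: continuousV; [rewrite gt_eqF|exact: crho].
  apply: continuous_pt => // t.
  by apply: continuousM; [exact: continuous_expR|exact: crV].
rewrite (_ : act _ _ = F @` setT).
  apply: connected_continuous_connected.
    by apply/connected_intervalP => x y z.
  exact: continuous_subspaceT.
apply/seteqP; split=> [_ [v [[x0 y0] gv] <-]|_ [s _ <-]].
  exists (ln (v 0 0 / v 1 0)) => //; rewrite /F; congr (_ *m _).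
  have e : expR (ln (v 0 0 / v 1 0)) = v 0 0 / v 1 0
    by rewrite lnK // posrE divr_gt0.
  have r : rho (ln (v 0 0 / v 1 0)) = (v 1 0)^-1.
    rewrite /rho /g e.
    have -> : nullq al be ga (v 0 0 / v 1 0) 1 = ((v 1 0)^-1 ^+ 2) ^+ 2.
      have -> : nullq al be ga (v 0 0 / v 1 0) 1 =
          nullq al be ga (v 0 0) (v 1 0) * ((v 1 0)^-1 ^+ 2) ^+ 2.
        by rewrite /nullq; field; rewrite gt_eqF.
      by rewrite gv mul1r.
    by rewrite sqrtr_sqr ger0_norm ?sqr_ge0 // sqrtr_sqr ger0_norm // invr_ge0
      ltW.
  by apply: eq_col2; rewrite !ptE r invrK // e divfK // gt_eqF.
exists (pt (expR s * (rho s)^-1) (rho s)^-1) => //.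
split; first by rewrite /quad /= !ptE invr_gt0 rho0 mulr_gt0 // ?expR_gt0
  ?invr_gt0.
rewrite !ptE.
have -> : nullq al be ga (expR s * (rho s)^-1) (rho s)^-1 =
  g s * (rho s ^+ 4)^-1.
  by rewrite /g /nullq; field; rewrite gt_eqF.
by rewrite rho4 divff // gt_eqF.
Qed.

(** The part of the component inside the sector is relatively open, and by [quad_closure] also
    relatively closed, so it is the whole component. *)
Lemma sector_component p : act A (nullcurve al be ga) p ->
  connected_component (hyperbolic_locus h) p = act A (nullcurve al be ga).
Proof.
move=> Hp; set C := connected_component _ _; apply/seteqP; split; last first.
  apply: connected_component_max => //; last exact: sector_connected.
  by move=> _ [v Hv <-]; exact: sector_curve_locus.
have CS : C `<=` hyperbolic_locus h by exact: connected_component_sub.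
have Cp : C p.
  apply: connected_component_refl; case: Hp => v Hv <-;
    exact: sector_curve_locus.
pose B := C `&` [set v : V | quad (invmx A *m v)].
suff -> : C = B by move=> v [/CS [hv _] qv]; apply/sector_curveP.
symmetry; apply: (@component_connected _ (hyperbolic_locus h) p).
- by exists p; split=> //; have /sector_curveP[] := Hp.
- by exists [set v : V | quad (invmx A *m v)]; [exact: open_quad|].
exists [set v : V | 0 <= (invmx A *m v) 0 0 /\ 0 <= (invmx A *m v) 1 0].
  exact: closed_quad.
apply/seteqP; split=> v [Cv]; first by case=> x0 y0; split=> //; split;
  exact: ltW.
by case=> x0 y0; split=> //; apply: quad_closure => //; have [] := CS _ Cv.
Qed.

Lemma sector_hypersurface : hypersurface (act A (nullcurve al be ga)).
Proof.
move=> p /sector_curveP [hp qp].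
case: sec => _ _ /peval_homog [a [b [c [d [e [hE E _]]]]]] _.
exists [set v : V | quad (invmx A *m v)].
pose f := (fun v : V => quart a b c d e (v 0 0) (v 1 0) + (-1)).
exists f; split=> //.
- exact: open_quad.
- by apply: polyfun_smooth; exact: polyfun_quart.
- exists p.
  by rewrite euler_quart -E hp mulr1 pnatr_eq0.
apply/seteqP; split=> v [].
  by move=> /sector_curveP[hv _] qv; split=> //=; rewrite /f -E hv subrr.
move=> /= fv qv; split=> //; apply/sector_curveP; split=> //.
by rewrite E; apply/eqP; rewrite -subr_eq0; apply/eqP.
Qed.

Lemma sector_ccgpsr : ccgpsr 4 h (act A (nullcurve al be ga)).
Proof.
have [v qv] : nullcurve al be ga !=set0.
  have q1 : quad (pt 1 1) by rewrite /quad /= !ptE.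
  by have [c _ Hc] := nullcurve_scale gd q1; exists (c *: pt 1 1).
split; [|exact: sector_closed|exact: sector_connected].
split.
- by case: sec.
- by exists (A *m v); apply: sector_hyperbolic; case: qv.
- exact: sector_hypersurface.
- by exists (A *m v); exists v.
- by move=> _ [w Hw <-]; exact: sector_curve_locus.
Qed.

End OneSector.

End Sectors.

(** * Linear maps between curves in the quadrant *)

Section Rigidity.
Variable R : realType.
Local Notation V := 'cV[R]_2.
Implicit Types (A B : 'M[R]_2) (H : set V) (v : V) (al be ga : R).

Lemma scale_colE (c : R) v i : (c *: v) i 0 = c * v i 0.
Proof. by rewrite mxE. Qed.

Lemma actM A B H : act A (act B H) = act (A *m B) H.
Proof.
apply/seteqP; split=> [_ [_ [v Hv <-] <-]|_ [v Hv <-]].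
  by exists v => //; rewrite mulmxA.
by exists (B *m v); [exists v|rewrite mulmxA].
Qed.

Lemma act1 H : act 1%:M H = H.
Proof.
apply/seteqP; split=> [_ [v Hv <-]|v Hv]; first by rewrite mul1mx.
by exists v => //; rewrite mul1mx.
Qed.

Lemma actK A H : A \in unitmx -> act (invmx A) (act A H) = H.
Proof. by move=> uA; rewrite actM mulVmx // act1. Qed.

Lemma equivalent_sym H H' : equivalent H H' -> equivalent H' H.
Proof. by case=> A uA <-; exists (invmx A);
  [rewrite unitmx_inv|exact: actK]. Qed.

Lemma equivalent_trans H1 H2 H3 :
  equivalent H1 H2 -> equivalent H2 H3 -> equivalent H1 H3.
Proof.
case=> A uA <- [B uB <-]; exists (B *m A); last by rewrite actM.
by rewrite unitmx_mul uB.
Qed.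

Lemma cone_act A H : cone (act A H) = act A (cone H).
Proof.
apply/seteqP; split=> [_ [c [_ [c0 [v Hv <-] ->]]]|_ [_ [c [v [c0 Hv ->]]] <-]].
  by exists (c *: v); [exists c, v|rewrite -scalemxAr].
by exists c, (A *m v); split=> //; [exists v|rewrite -scalemxAr].
Qed.

Lemma cone_nullcurve al be ga : good al be ga -> cone (nullcurve al be ga) =
  @quad R.
Proof. by move=> gd; have := cone_sector 1%:M gd; rewrite !act1. Qed.

Lemma quad_pt (x y : R) : 0 < x -> 0 < y -> quad (pt x y).
Proof. by move=> x0 y0; rewrite /quad /= !ptE. Qed.

Lemma quad_stable_ge0 B : (forall v, quad v -> quad (B *m v)) ->
  [/\ 0 <= B 0 0, 0 <= B 0 1, 0 <= B 1 0 & 0 <= B 1 1].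
Proof.
move=> Bq; split; apply: (@quad_limit_ge0 _ _ _ 0) => t t0.
- have [+ _] := Bq _ (quad_pt ltr01 t0).
  by rewrite mulmx_col2 !ptE mul0r addr0 mulr1; apply.
- have [+ _] := Bq _ (quad_pt t0 ltr01).
  by rewrite mulmx_col2 !ptE mul0r addr0 mulr1 addrC; apply.
- have [_] := Bq _ (quad_pt ltr01 t0).
  by rewrite mulmx_col2 !ptE mul0r addr0 mulr1; apply.
- have [_] := Bq _ (quad_pt t0 ltr01).
  by rewrite mulmx_col2 !ptE mul0r addr0 mulr1 addrC; apply.
Qed.

Definition pos_monomial B : Prop := exists l m : R,
  [/\ 0 < l, 0 < m & B = mx22 l 0 0 m \/ B = mx22 0 l m 0].

(** A nonnegative matrix with nonnegative inverse is monomial: the off-diagonal entries of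
    [B *m invmx B] are sums of nonnegative products, and each product has to vanish. *)
Lemma quad_stable_monomial B : B \in unitmx ->
  (forall v, quad v -> quad (B *m v)) ->
  (forall v, quad v -> quad (invmx B *m v)) -> pos_monomial B.
Proof.
move=> uB /quad_stable_ge0 [b0 b1 b2 b3] /quad_stable_ge0.
set C := invmx B => -[c0 c1 c2 c3].
have BC : B *m C = 1%:M by rewrite mulmxV.
have e00 : B 0 0 * C 0 0 + B 0 1 * C 1 0 = 1.
  by have := congr1 (fun M : 'M[R]_2 => M 0 0) BC;
    rewrite (mx22_eta B) (mx22_eta C) mul_mx22 mx22_1 !mx22E.
have e01 : B 0 0 * C 0 1 + B 0 1 * C 1 1 = 0.
  by have := congr1 (fun M : 'M[R]_2 => M 0 1) BC;
    rewrite (mx22_eta B) (mx22_eta C) mul_mx22 mx22_1 !mx22E.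
have e10 : B 1 0 * C 0 0 + B 1 1 * C 1 0 = 0.
  by have := congr1 (fun M : 'M[R]_2 => M 1 0) BC;
    rewrite (mx22_eta B) (mx22_eta C) mul_mx22 mx22_1 !mx22E.
have e11 : B 1 0 * C 0 1 + B 1 1 * C 1 1 = 1.
  by have := congr1 (fun M : 'M[R]_2 => M 1 1) BC;
    rewrite (mx22_eta B) (mx22_eta C) mul_mx22 mx22_1 !mx22E.
rewrite (mx22_eta B);
  move: (B 0 0) (B 0 1) (B 1 0) (B 1 1) (C 0 0) (C 0 1) (C 1 0) (C 1 1)
  b0 b1 b2 b3 c0 c1 c2 c3 e00 e01 e10 e11 => {B C uB BC} a b c d a' b' c' d'.
move=> a0 b0 c0 d0 a'0 b'0 c'0 d'0 e00 e01 e10 e11.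
have sum0 (x y z t : R) : 0 <= x -> 0 <= y -> 0 <= z -> 0 <= t ->
  x * y + z * t = 0 ->
    x * y = 0 /\ z * t = 0.
  move=> x0 y0 z0 t0 E; have := mulr_ge0 x0 y0; have := mulr_ge0 z0 t0; split;
    lra.
have [/eqP + /eqP +] := sum0 _ _ _ _ a0 b'0 b0 d'0 e01.
have [/eqP + /eqP +] := sum0 _ _ _ _ c0 a'0 d0 c'0 e10.
rewrite !mulf_eq0.
have pos (x : R) : 0 <= x -> x <> 0 -> 0 < x by move=> x0 /eqP xn;
  rewrite lt_def xn.
(* There are sixteen ways to choose a vanishing factor in the four products; the diagonal entries
   being 1 leaves the diagonal and the antidiagonal shape. *)
move=> /orP[]/eqP E1 /orP[]/eqP E2 /orP[]/eqP E3 /orP[]/eqP E4; subst;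
  rewrite ?(mul0r, mulr0, addr0, add0r) in e00 e11;
  try (by move/eqP: e00; rewrite eq_sym oner_eq0);
  try (by move/eqP: e11; rewrite eq_sym oner_eq0).
- exists a, d; split; [| |by left]; apply: pos => // E; subst.
    by move/eqP: e00; rewrite mul0r eq_sym oner_eq0.
  by move/eqP: e11; rewrite mul0r eq_sym oner_eq0.
- exists b, c; split; [| |by right]; apply: pos => // E; subst.
    by move/eqP: e00; rewrite mul0r eq_sym oner_eq0.
  by move/eqP: e11; rewrite mul0r eq_sym oner_eq0.
Qed.

(** Says that the quartic with primed coefficients pulls back along [B] to the one without. In the
    second alternative [B] exchanges the boundary lines, and with them the outer coefficients. *)
Definition monomial_rel B al be ga al' be' ga' : Prop := exists l m : R,
  [/\ 0 < l, 0 < m &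
      [/\ B = mx22 l 0 0 m, al = l ^+ 3 * m * al', be = l ^+ 2 * m ^+ 2 * be'
        & ga = l * m ^+ 3 * ga'] \/
      [/\ B = mx22 0 l m 0, al = l * m ^+ 3 * ga', be = l ^+ 2 * m ^+ 2 * be'
        & ga = l ^+ 3 * m * al']].

Lemma monomial_relP B al be ga al' be' ga' : pos_monomial B ->
  (forall v, quad v -> nullq al' be' ga' ((B *m v) 0 0) ((B *m v) 1 0) =
                       nullq al be ga (v 0 0) (v 1 0)) ->
  monomial_rel B al be ga al' be' ga'.
Proof.
move=> [l [m [l0 m0 BE]]] E; exists l, m; split=> //.
case: BE => BE; [left|right].
  have [x y x0 y0|ea eb ec] := @nullq_inj _ al be ga (l ^+ 3 * m * al')
    (l ^+ 2 * m ^+ 2 * be') (l * m ^+ 3 * ga'); last by split.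
  have := E _ (quad_pt x0 y0); rewrite BE mul_mx22_pt !ptE => <-.
  by rewrite /nullq; ring.
have [x y x0 y0|ea eb ec] := @nullq_inj _ al be ga (l * m ^+ 3 * ga')
  (l ^+ 2 * m ^+ 2 * be') (l ^+ 3 * m * al'); last by split.
have := E _ (quad_pt x0 y0); rewrite BE mul_mx22_pt !ptE => <-.
by rewrite /nullq; ring.
Qed.

(** Passing to cones shows that [B] preserves the quadrant, hence is monomial; homogeneity extends
    the equality of the quartics from the curve to the quadrant. *)
Lemma act_nullcurve_rel B al be ga al' be' ga' :
  B \in unitmx -> good al be ga -> good al' be' ga' ->
  act B (nullcurve al be ga) = nullcurve al' be' ga' ->
  monomial_rel B al be ga al' be' ga'.
Proof.
move=> uB gd gd' E.
have Bq : act B (@quad R) = @quad R.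
  by have := cone_nullcurve gd'; rewrite -E cone_act cone_nullcurve.
apply: monomial_relP => [|v qv].
  apply: quad_stable_monomial => // v qv; first by rewrite -Bq; exists v.
  by apply/actE => //; rewrite Bq.
have [c c0 Hc] := nullcurve_scale gd qv.
have [_ gc] := Hc.
have [_] : nullcurve al' be' ga' (B *m (c *: v)) by rewrite -E; exists (c *: v).
move: gc; rewrite -scalemxAr !scale_colE !nullq_scale => <-.
by apply: mulfI; rewrite expf_neq0 // gt_eqF.
Qed.

Lemma monomial_rel_unit B al be ga al' be' ga' :
  monomial_rel B al be ga al' be' ga' -> B \in unitmx.
Proof.
move=> [l [m [l0 m0 [[-> _ _ _]|[-> _ _ _]]]]]; rewrite unitmx22 det_mx22E.
  by rewrite mulr0 subr0 mulf_neq0 // gt_eqF.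
by rewrite mulr0 sub0r oppr_eq0 mulf_neq0 // gt_eqF.
Qed.

Lemma monomial_rel_act B al be ga al' be' ga' :
  monomial_rel B al be ga al' be' ga' ->
  act B (nullcurve al be ga) = nullcurve al' be' ga'.
Proof.
move=> [l [m [l0 m0 D]]].
have vE v : v = pt (v 0 0) (v 1 0) := pt_eta v.
apply/seteqP; split=> [_ [v [[v0 v1] Hv] <-]|v [[v0 v1] Hv]].
  case: D => [[-> ea eb ec]|[-> ea eb ec]]; rewrite (vE v) mul_mx22_pt;
    (split; first by apply: quad_pt; rewrite !mul0r ?addr0 ?add0r mulr_gt0);
    by rewrite !ptE -Hv /nullq ea eb ec; ring.
case: D => [[-> ea eb ec]|[-> ea eb ec]].
  exists (pt (v 0 0 / l) (v 1 0 / m)).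
    split; first by apply: quad_pt; rewrite divr_gt0.
    by rewrite !ptE -Hv /nullq ea eb ec; field; rewrite !gt_eqF.
  by rewrite mul_mx22_pt [RHS]vE; congr pt; field; rewrite !gt_eqF.
exists (pt (v 1 0 / m) (v 0 0 / l)).
  split; first by apply: quad_pt; rewrite divr_gt0.
  by rewrite !ptE -Hv /nullq ea eb ec; field; rewrite !gt_eqF.
by rewrite mul_mx22_pt [RHS]vE; congr pt; field; rewrite !gt_eqF.
Qed.

(** The zero pattern and the ratio [al ga / be ^ 2], with denominators cleared so that [be = 0] is
    allowed. *)
Lemma monomial_rel_inv B al be ga al' be' ga' :
  monomial_rel B al be ga al' be' ga' ->
  [/\ be = 0 <-> be' = 0, al * ga = 0 <-> al' * ga' = 0,
      al = 0 /\ ga = 0 <-> al' = 0 /\ ga' = 0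
    & al * ga * be' ^+ 2 = al' * ga' * be ^+ 2].
Proof.
have pe0 (x y z : R) : 0 < x -> y = x * z -> y = 0 <-> z = 0.
  by move=> x0 ->; split=> [/eqP|->]; rewrite ?mulr0 // mulf_eq0 gt_eqF //= =>
    /eqP.
move=> [l [m [l0 m0 D]]].
have p13 : 0 < l * m ^+ 3 by rewrite mulr_gt0 // exprn_gt0.
have p31 : 0 < l ^+ 3 * m by rewrite mulr_gt0 // exprn_gt0.
have p22 : 0 < l ^+ 2 * m ^+ 2 by rewrite mulr_gt0 // exprn_gt0.
have p44 : 0 < l ^+ 4 * m ^+ 4 by rewrite mulr_gt0 // exprn_gt0.
case: D => [[_ ea eb ec]|[_ ea eb ec]]; split.
- exact: pe0 p22 eb.
- by apply: pe0 p44 _; rewrite ea ec; ring.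
- by have := pe0 _ _ _ p31 ea; have := pe0 _ _ _ p13 ec; tauto.
- by rewrite ea eb ec; ring.
- exact: pe0 p22 eb.
- by apply: pe0 p44 _; rewrite ea ec; ring.
- by have := pe0 _ _ _ p13 ea; have := pe0 _ _ _ p31 ec; tauto.
- by rewrite ea eb ec; ring.
Qed.

End Rigidity.

(** * Standard form of a quartic at a hyperbolic point *)

Section StandardForm.
Variable R : realType.
Local Notation V := 'cV[R]_2.

Lemma standard_form_at (h : mpoly 2 R) (p : V) :
  homogeneous_poly 4 h -> hyperbolic_locus h p -> exists A L K,
  [/\ A \in unitmx, A *m pt 1 0 = p,
      forall v, peval h (A *m v) = quart 1 0 (- 1) L K (v 0 0) (v 1 0)
    & forall v, hyperbolic_point h (A *m v) ->
        hdet 1 0 (- 1) L K (v 0 0) (v 1 0) < 0].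
Proof.
move=> /peval_homog [a [b [c [d [e [_ E D]]]]]] [hp /D].
rewrite E in hp; move: (p 0 0) (p 1 0) hp (pt_eta p) => x y hp -> Dp.
(* The second basis vector [(- hy, hx)] is tangent to the level set, which removes the coefficient
   of [x ^ 3 y]; Euler's identity makes the determinant of the new basis equal to 4. *)
pose hx := quartx a b c d x y; pose hy := quarty b c d e x y.
have det4 : x * hx - (- hy) * y = 4.
  have -> : x * hx - (- hy) * y = 4 * quart a b c d e x y.
    by rewrite /hx /hy /quartx /quarty /quart; ring.
  by rewrite hp mulr1.
have [a' [b' [c' [d' [e' [_ eb eq ed]]]]]] :=
  quart_subst a b c d e x (- hy) y hx.
have b0 : b' = 0.
  have -> : b' = quarty b' c' d' e' 1 0 by rewrite /quarty; ring.
  by rewrite eb !mulr1 !mulr0 !addr0 -/hx -/hy; ring.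
have a1 : a' = 1.
  have := eq 1 0; rewrite !mulr1 !mulr0 !addr0 hp /quart => <-.
  by ring.
rewrite {eb}b0 {}a1 in eq ed.
have c0 : c' < 0.
  have : hdet 1 0 c' d' e' 1 0 < 0.
    by rewrite ed !mulr1 !mulr0 !addr0 det4 pmulr_rlt0 // exprn_gt0.
  have -> : hdet 1 0 c' d' e' 1 0 = 24 * c' by rewrite /hdet; ring.
  by lra.
(* Hyperbolicity at the base point gives [c' < 0], and rescaling the tangent vector by [mu] turns
   this coefficient into -1. *)
pose mu := (Num.sqrt (- c'))^-1.
have mu0 : 0 < mu by rewrite invr_gt0 sqrtr_gt0 oppr_gt0.
have mu2 : c' * mu ^+ 2 = -1.
  by rewrite exprVn sqr_sqrtr ?oppr_ge0 ?ltW //; field; rewrite lt_eqF.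
exists (mx22 x (- hy * mu) y (hx * mu)), (d' * mu ^+ 3), (e' * mu ^+ 4).
have A_mul v : mx22 x (- hy * mu) y (hx * mu) *m v =
    pt (x * v 0 0 + - hy * (mu * v 1 0)) (y * v 0 0 + hx * (mu * v 1 0)).
  by rewrite {1}(pt_eta v) mul_mx22_pt !mulrA.
split.
- rewrite unitmx22 det_mx22E (_ : _ - _ = (x * hx - (- hy) * y) * mu); last
  by ring.
  by rewrite det4 mulf_neq0 ?pnatr_eq0 // gt_eqF.
- by rewrite A_mul !ptE !mulr0 !mulr1 !addr0.
- by move=> v; rewrite E A_mul !ptE -eq /quart -mu2; ring.
move=> v /D; rewrite A_mul !ptE => H.
have : hdet 1 0 c' d' e' (v 0 0) (mu * v 1 0) < 0.
  by rewrite ed det4 pmulr_rlt0 // exprn_gt0.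
have -> : hdet 1 0 (- 1) (d' * mu ^+ 3) (e' * mu ^+ 4) (v 0 0) (v 1 0) =
   mu ^+ 2 * hdet 1 0 c' d' e' (v 0 0) (mu * v 1 0).
  by rewrite -mu2 /hdet; ring.
by move=> ?; rewrite pmulr_rlt0 // exprn_gt0.
Qed.

End StandardForm.

(** * Zeros of a function near a regular zero *)

Section Openness.
Variable R : realType.
Local Notation V := 'cV[R]_2.
Implicit Types (f : V -> R) (p q r : V) (U H : set V).

(** Near 0 the difference quotient has the sign of the derivative, so [f (p + t r)] changes sign
    together with [t]. *)
Lemma sign_change f p r (e : R) : derivable f p r -> 'D_r f p != 0 -> f p = 0 ->
  0 < e -> exists s, [/\ 0 < s, s < e & f (p + s *: r) * f (p - s *: r) < 0].
Proof.
move=> df D0 fp e0; set a := 'D_r f p in D0.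
have cv : h^-1 *: (f (h *: r + p) - f p) @[h --> 0^'] --> a by exact: df.
have cv2 : a * (h^-1 *: (f (h *: r + p) - f p)) @[h --> 0^'] --> a * a.
  by apply: cvgM => //; exact: cvg_cst.
have aa : 0 < a * a by rewrite -expr2 exprn_even_gt0.
have : \forall h \near 0^', 0 < a * (h^-1 *: (f (h *: r + p) - f p)).
  exact: cvgr_gt cv2 _ aa.
rewrite near_withinE => /nbhs_ballP [d /= d0 Hd].
pose s := Num.min d e / 2.
have m0 : 0 < Num.min d e by rewrite lt_min d0.
have s0 : 0 < s by rewrite divr_gt0.
have sm : s < Num.min d e by rewrite /s; lra.
have [sd se] : s < d /\ s < e by move: sm; rewrite lt_min => /andP[].
have H (t : R) : `|t| = s -> 0 < a * t * f (p + t *: r).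
  move=> ts; have t0 : t != 0 by rewrite -normr_gt0 ts.
  have := Hd t; rewrite /ball /= sub0r normrN ts => /(_ sd t0).
  rewrite fp subr0 addrC => Hp.
  have -> : a * t * f (p + t *: r) = t ^+ 2 * (a * (t^-1 *: f (p + t *: r))).
    by rewrite /GRing.scale /=; field.
  by rewrite mulr_gt0 // exprn_even_gt0.
exists s; split=> //.
have := H s (gtr0_norm s0); have := H (- s).
rewrite normrN gtr0_norm // scaleNr => /(_ erefl) h1 h2.
have := mulr_gt0 h1 h2; set x := f (p - _); set y := f (p + _).
have -> : a * - s * x * (a * s * y) = (a * a * s ^+ 2) * - (y * x) by ring.
by rewrite pmulr_rgt0 ?oppr_gt0 // mulr_gt0 // exprn_gt0.
Qed.

(** The mixed term serves the choice [r = p], [w = q]: the map is then [(1 + s) (p + t q)] and stays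
    on the ray of [p + t q]. With [q = p] and [w = 0] it is [(1 + t) p + s r]. *)
Definition plane_map p r q w (s t : R) : V := p + s *: r + t *: q + (s * t) *:
  w.

(** A weak implicit function theorem, without uniqueness or regularity of [s]: the opposite signs at
    the ends of a short segment in direction [r] persist for small [t], and the intermediate value
    theorem finds a zero between them. *)
Lemma zero_near f U p r q w (e : R) : open U -> U p ->
  (forall x, U x -> {for x, continuous f}) -> derivable f p r ->
    'D_r f p != 0 ->
  f p = 0 -> 0 < e -> exists2 d, 0 < d & forall t, `|t| < d ->
  exists s, [/\ `|s| < e,
    U (plane_map p r q w s t) & f (plane_map p r q w s t) = 0].
Proof.
move=> oU Up cf df D0 fp e0.
pose Phi (z : V) : V := plane_map p r q w (z 0 0) (z 1 0).
have cPhi : continuous Phi.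
  move=> z; apply: (@cvg_mx _ _ (nbhs z)) => i j.
  rewrite (_ : (fun _ => _) = cst (p i j) + (fun v : V => v 0 0) * cst (r i j) +
    (fun v : V => v 1 0) * cst (q i j) +
    (fun v : V => v 0 0) * (fun v : V => v 1 0) * cst (w i j)).
    rewrite (_ : Phi z i j = (cst (p i j) + (fun v : V => v 0 0) * cst (r i j) +
      (fun v : V => v 1 0) * cst (q i j) +
      (fun v : V => v 0 0) * (fun v : V => v 1 0) * cst (w i j)) z).
      apply: polyfun_continuous;
        repeat (first [exact: polyfun_cst|exact: polyfun_coord|
        apply: polyfunD|apply: polyfunM]).
    by rewrite !fctE /Phi /plane_map !mxE.
  by apply/funext => v; rewrite !fctE /Phi /plane_map !mxE.
have Phi0 : Phi 0 = p by rewrite /Phi /plane_map !mxE mul0r !scale0r !addr0.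
have oPU : open (Phi @^-1` U) by apply: open_comp => // z _; exact: cPhi.
have : nbhs (0 : V) (Phi @^-1` U) by apply: open_nbhs_nbhs; split => //=;
  rewrite Phi0.
move=> /nbhs_ballP [d0 /= d0p Hd0].
have in_U (s t : R) : `|s| < d0 -> `|t| < d0 -> U (plane_map p r q w s t).
  move=> sd td; have := Hd0 (pt s t); rewrite /= /Phi !ptE; apply.
  split=> // i j; rewrite /ball /= mxE sub0r normrN (ord1 j).
  by move: i; apply: ord2P; rewrite ptE.
have cfP (s t : R) : `|s| < d0 -> `|t| < d0 ->
    {for pt s t, continuous (f \o Phi)}.
  move=> sd td; apply: continuous_comp; first exact: cPhi.
  by apply: cf; rewrite /Phi !ptE; exact: in_U.
have m0 : 0 < Num.min d0 e by rewrite lt_min d0p.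
have [s0 [s0p]] := sign_change df D0 fp m0.
rewrite lt_min => /andP[s0d s0e] sc.
have s0n : `|s0| < d0 by rewrite gtr0_norm.
have s0n' : `|- s0| < d0 by rewrite normrN.
have n0 : `|0 : R| < d0 by rewrite normr0.
have ct (s : R) : `|s| < d0 -> f (Phi (pt s t)) @[t --> 0] --> f (Phi (pt s 0)).
  move=> sd; apply: (continuous_comp (g := f \o Phi)); last exact: cfP.
  by apply: continuous_pt => ?; [exact: cvg_cst|exact: cvg_id].
have : \forall t \near 0, f (Phi (pt s0 t)) * f (Phi (pt (- s0) t)) < 0.
  apply: cvgr_lt (cvgM (ct _ s0n) (ct _ s0n')) _ _.
  by rewrite /Phi /plane_map !ptE mulr0 !scale0r !addr0 mulr0 scale0r addr0
    scaleNr.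
move=> /nbhs_ballP [d1 /= d1p Hd1].
exists (Num.min d0 d1); first by rewrite lt_min d0p.
move=> t; rewrite lt_min => /andP[td0 td1].
have {}sc : f (Phi (pt s0 t)) * f (Phi (pt (- s0) t)) < 0.
  by apply: Hd1; rewrite /ball /= sub0r normrN.
pose g s := f (Phi (pt s t)).
have bnd (s : R) : s \in `[- s0, s0] -> `|s| <= s0
  by rewrite in_itv /= ler_norml.
have [|||s si gs] := @IVT _ g (- s0) s0 0.
- lra.
- apply: continuous_in_subspaceT => s; rewrite inE /= => /bnd sb.
  apply: (@continuous_comp _ _ _ (fun s => pt s t) (f \o Phi)).
    by apply: continuous_pt => ?; [exact: cvg_id|exact: cvg_cst].
  by apply: cfP => //; lra.
- rewrite /g ge_min le_max.
  move: sc; set x := f (Phi (pt s0 t)); set y := f (Phi (pt (- s0) t)) => sc.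
  by case: (ltrgtP x 0) => x0; case: (ltrgtP y 0) => y0 //=; nra.
exists s; have sb := bnd _ si; split; first by lra.
- by apply: in_U => //; lra.
- by rewrite -gs /g /Phi !ptE.
Qed.

End Openness.

(** * Openness of the cone over the curve, and its first boundary line *)

Section Existence.
Variable R : realType.
Local Notation V := 'cV[R]_2.
Implicit Types (h : mpoly 2 R) (f : V -> R) (p q r v w : V) (U H : set V).

(** Near [(1, 0)] the level set of a standard form stays in [x >= 1]. With [x = 1 + t] the value is
    [x ^ 4] plus [s ^ 2] times a bracket in which [- x ^ 2 <= - 1/4] outweighs the terms in [L] and
    [K]. *)
Lemma no_level_below (L K t e : R) : 0 < e -> e <= 1 ->
  e * (`|L| + `|K|) <= 4^-1 ->
  -2^-1 <= t -> t < 0 -> forall s, `|s| < e -> quart 1 0 (- 1) L K (1 + t) s <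
    1.
Proof.
move=> e0 e1 eLK t1 t0 s se.
pose c := 1 + t; have c1 : 2^-1 <= c by rewrite /c; lra.
have c2 : c < 1 by rewrite /c; lra.
have c4 : c ^+ 4 < 1 by rewrite exprn_ilt1 //; lra.
suff : s ^+ 2 * (- c ^+ 2 + L * c * s + K * s ^+ 2) <= 0.
  rewrite -/c /quart; have -> :
    1 * c ^+ 4 + 0 * c ^+ 3 * s + -1 * c ^+ 2 * s ^+ 2 +
    L * c * s ^+ 3 + K * s ^+ 4 =
      c ^+ 4 + s ^+ 2 * (- c ^+ 2 + L * c * s + K * s ^+ 2) by ring.
  lra.
apply: mulr_ge0_le0; first exact: sqr_ge0.
have cc : 4^-1 <= c ^+ 2 by rewrite expr2; nra.
have h1 : L * c * s <= e * `|L|.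
  apply: le_trans (ler_norm _) _; rewrite !normrM (ger0_norm (_ : 0 <= c));
    last lra.
  rewrite [leRHS]mulrC -mulrA ler_wpM2l //.
  by have := normr_ge0 s; nra.
have h2 : K * s ^+ 2 <= e * `|K|.
  apply: le_trans (ler_norm _) _; rewrite normrM [leRHS]mulrC ler_wpM2l //.
  by rewrite normrX; have := normr_ge0 s; nra.
by move: eLK; rewrite mulrDr; lra.
Qed.

Lemma small_radius (L K : R) :
  exists e, [/\ 0 < e, e <= 1 & e * (`|L| + `|K|) <= 4^-1].
Proof.
have L0 := normr_ge0 L; have K0 := normr_ge0 K.
exists (4 * (1 + `|L| + `|K|))^-1.
have e0 : 0 < (4 * (1 + `|L| + `|K|))^-1 by rewrite invr_gt0; lra.
have em : (4 * (1 + `|L| + `|K|))^-1 * (1 + `|L| + `|K|) = 4^-1 by field; lra.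
by split=> //; nra.
Qed.

(** If the local equation [f] has nonzero radial derivative at [p], varying the scale along each
    nearby ray produces a zero of [f]. If the radial derivative vanishes, the derivative in the
    tangent direction [r] does not, and then [H] contains a point [(1 + t) p + s r] with [t < 0] and
    [s] small, contrary to [no_level_below]. *)
Lemma open_cone h H p q : homogeneous_poly 4 h -> hypersurface H ->
  H `<=` hyperbolic_locus h -> H p ->
  exists2 d, 0 < d & forall t, `|t| < d -> cone H (p + t *: q).
Proof.
move=> hh hyp HS Hp.
have [U [f [oU Up smf [v Dv] HU]]] := hyp p Hp.
have cf x : U x -> {for x, continuous f} by exact: smf 0%N x.
have df : differentiable f p by have [+ _] := smf 1%N; exact.
have der r : derivable f p r by exact: diff_derivable.
have inH x : U x -> f x = 0 -> H x.
  move=> Ux fx; have : ([set q | f q = 0] `&` U) x by [].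
  by rewrite -HU => -[].
have fp : f p = 0.
  have : (H `&` U) p by [].
  by rewrite HU => -[].
have [Dp|Dp] := eqVneq ('D_p f p) 0; last first.
  have [d d0 Hd] := @zero_near _ f U p p q q 2^-1 oU Up cf (der p) Dp fp
    ltac:(by rewrite invr_gt0 ltr0n).
  exists d => // t /Hd [s [s2 Us fs]].
  have s1 : 0 < 1 + s by move: s2; rewrite ltr_norml; lra.
  exists (1 + s)^-1, (plane_map p p q q s t); split.
  - by rewrite invr_gt0.
  - exact: inH.
  - have -> : plane_map p p q q s t = (1 + s) *: (p + t *: q).
      rewrite /plane_map scalerDl scale1r scalerDr scalerA !addrA.
      by rewrite -!addrA; congr (_ + _); rewrite addrCA.
    by rewrite scalerA mulVf ?scale1r // gt_eqF.
have [A [L [K [uA Ap hA _]]]] := standard_form_at hh (HS _ Hp).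
pose r := A *m pt 0 1.
(* The vectors [p] and [r] form a basis, so the derivatives along both cannot vanish when the one
   along [v] does not. *)
have Dr : 'D_r f p != 0.
  apply: contraNneq Dv => Dr; rewrite deriveE //.
  rewrite -(mulKVmx uA v) (pt_eta (invmx A *m v)) mulmx_ptE Ap -/r.
  by rewrite linearD !linearZ /= -!deriveE // Dp Dr !scaler0 addr0.
have [e [e0 e1 em]] := small_radius L K.
have [d d0 Hd] := @zero_near _ f U p r p 0 e oU Up cf (der r) Dr fp e0.
pose t := - (Num.min d 1 / 2).
have md : 0 < Num.min d 1 by rewrite lt_min d0 ltr01.
have [dm1 dm2] : Num.min d 1 <= d /\ Num.min d 1 <= 1.
  by rewrite !ge_min !lexx orbT.
have td : `|t| < d by rewrite normrN gtr0_norm; lra.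
have [s [se Us fs]] := Hd t td.
have [+ _] := HS _ (inH _ Us fs).
rewrite /plane_map scaler0 addr0 -Ap /r -addrA (addrC (s *: _))
  addrA -{1}[A *m pt 1 0]scale1r.
rewrite -scalerDl -mulmx_ptE hA !ptE => E.
have := @no_level_below L K t e e0 e1 _ _ _ s se; rewrite E ltxx => H0.
have // : false by apply: H0; rewrite /t; nra.
Qed.

Lemma no_total_ray (L K : R) :
  (forall t, 0 < t -> 0 < quart 1 0 (- 1) L K 1 t) ->
  (forall t, 0 < t -> hdet 1 0 (- 1) L K 1 t < 0) -> False.
Proof.
move=> P0 D0.
(* - 2 + 3 L t + 4 K t^2 = P'(t) / t, and at its zeros 3 L + 8 K t = P''(t) / t
   has the sign of the Hessian determinant 12 P P'' - 9 P'^2. *)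
have DP (t : R) : 0 < t -> - 2 + 3 * L * t + 4 * K * t ^+ 2 = 0 ->
  3 * L + 8 * K * t < 0.
  move=> t0 mt; have := D0 t t0; have := P0 t t0.
  set P := quart _ _ _ _ _ _ _ => Pp.
  have -> : hdet 1 0 (- 1) L K 1 t =
    12 * P * (- 2 + 6 * L * t + 12 * K * t ^+ 2) -
      9 * (t * (- 2 + 3 * L * t + 4 * K * t ^+ 2)) ^+ 2.
    by rewrite /hdet /P /quart; ring.
  rewrite mt mulr0 expr0n /= mulr0 subr0 -mulrA !pmulr_rlt0 //.
  have -> : - 2 + 6 * L * t + 12 * K * t ^+ 2 = (3 * L + 8 * K * t) * t by lra.
  by rewrite pmulr_llt0.
(* [K] is the limit of [P(s) / s ^ 4] at infinity. The substitution [s = (1 + t) / t] moves infinity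
   to [t = 0]; as [x = 1 / s] lies below 1, [x ^ 4 - x ^ 2] may be dropped, which leaves
   [L x + K > 0]. *)
have K0 : 0 <= K.
  apply: (@quad_limit_ge0 _ K (K + L) 0) => t t0; rewrite mul0r addr0.
  have t1 : 0 < 1 + t by lra.
  have := P0 ((1 + t) / t) (divr_gt0 t1 t0).
  have -> : quart 1 0 (- 1) L K 1 ((1 + t) / t) = ((1 + t) / t) ^+ 4 *
      ((t / (1 + t)) ^+ 4 - (t / (1 + t)) ^+ 2 + L * (t / (1 + t)) + K).
    by rewrite /quart; field; rewrite !gt_eqF.
  rewrite pmulr_rgt0 ?exprn_gt0 ?divr_gt0 //.
  set x := t / (1 + t); have xt : x * (1 + t) = t by rewrite /x; field;
    rewrite gt_eqF.
  have x0 : 0 < x by rewrite divr_gt0.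
  have x1 : x < 1 by rewrite ltr_pdivrMr // mul1r; lra.
  move=> H; have {}H : 0 < L * x + K.
    by have : x ^+ 4 <= x ^+ 2; [rewrite ler_wiXn2l // ltW|lra].
  have -> : K + (K + L) * t = (L * x + K) * (1 + t).
    have -> : (L * x + K) * (1 + t) = L * (x * (1 + t)) + K * (1 + t) by ring.
    by rewrite xt; ring.
  by rewrite mulr_gt0.
(* At a zero, [(3 L + 8 K t) t = 2 + 4 K t ^ 2] is positive, against [DP]. Below, [L + K > 0] and
   the negative value -2 at [t = 0] produce such a zero after all. *)
have nm (t : R) : 0 < t -> - 2 + 3 * L * t + 4 * K * t ^+ 2 <> 0.
  move=> t0 mt; have := DP t t0 mt; rewrite ltNge => /negP; apply.
  rewrite -(pmulr_lge0 _ t0); have := mulr_ge0 K0 (sqr_ge0 t); lra.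
have LK : 0 < L + K by have := P0 1 ltr01; rewrite /quart; lra.
move: K0; rewrite le_eqVlt => /orP[/eqP K0|K0].
  rewrite -K0 addr0 in LK nm.
  have t0 : 0 < 2 / (3 * L) by rewrite divr_gt0 // mulr_gt0.
  by apply: (nm _ t0); field; rewrite gt_eqF.
pose D := 9 * L ^+ 2 + 32 * K.
have L2 := sqr_ge0 L; have D_0 : 0 <= D by rewrite /D; lra.
have wD : Num.sqrt D ^+ 2 = D by rewrite sqr_sqrtr.
have w0 := sqrtr_ge0 D; move: (Num.sqrt D) wD w0 => w; rewrite /D => wD w0.
have t0 : 0 < (w - 3 * L) / (8 * K).
  rewrite divr_gt0 ?mulr_gt0 // subr_gt0.
  have [L0|L0] := ltrP L 0; first by lra.
  by rewrite -(@ltr_pXn2r _ 2) ?nnegrE ?mulr_ge0 // wD; lra.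
apply: (nm _ t0).
have -> : -2 + 3 * L * ((w - 3 * L) / (8 * K)) +
  4 * K * ((w - 3 * L) / (8 * K)) ^+ 2 =
  (w ^+ 2 - (9 * L ^+ 2 + 32 * K)) / (16 * K) by field; rewrite gt_eqF.
by rewrite wD subrr mul0r.
Qed.

(** [T] stands for the parameters whose ray meets the curve: it is open, and closed wherever the
    quartic is positive. It cannot contain the half-line, so [b] is the end of its initial interval;
    there the quartic is not positive, as [b] would belong to [T], and not negative, as [b] is a
    limit of points of [T]. *)
Lemma exit_point (L K : R) (T : set R) : T 0 ->
  (forall t, T t -> exists2 d, 0 < d & forall t', `|t' - t| < d -> T t') ->
  (forall t, T t -> 0 < quart 1 0 (- 1) L K 1 t /\
    hdet 1 0 (- 1) L K 1 t < 0) ->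
  (forall t, 0 < quart 1 0 (- 1) L K 1 t ->
    (forall d, 0 < d -> exists2 s, T s & `|s - t| < d) -> T t) ->
  exists b, [/\ 0 < b, quart 1 0 (- 1) L K 1 b = 0 & forall s, 0 <= s ->
    s < b -> T s].
Proof.
move=> T0 To Tp Tc.
pose E := [set t | 0 <= t /\ forall s, 0 <= s -> s <= t -> T s].
have E0 : E 0 by split=> // s s0 s1; have -> : s = 0 by apply/eqP;
  rewrite eq_le s0 s1.
have [x [x0 nTx]] : exists x, 0 <= x /\ ~ T x.
  apply: contrapT => /forallNP nT.
  have aT t : 0 < t -> T t.
    by move=> t0; apply: contrapT => nt; apply: (nT t); split=> //; exact: ltW.
  by apply: (@no_total_ray L K) => t /aT /Tp[].
have Eub : ubound E x.
  move=> t [t0 Ht]; rewrite leNgt; apply/negP => xt; apply: nTx;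
    apply: Ht => //.
  exact: ltW.
have hs : has_sup E by split; [exists 0|exists x].
pose b := sup E.
have b0 : 0 <= b by exact: sup_upper_bound.
have below s : 0 <= s -> s < b -> T s.
  move=> s0 sb.
  have bs : 0 < b - s by rewrite subr_gt0.
  have [t [t0 Ht]] := sup_adherent bs hs.
  by rewrite -/b subKr => st; apply: Ht => //; exact: ltW.
have nTb : ~ T b.
  move=> Tb; have [d d0 Hd] := To b Tb.
  have : E (b + d / 2).
    split=> [|s s0 sb]; first by lra.
    have [sb'|sb'] := ltrP s b; first exact: below.
    by apply: Hd; rewrite ger0_norm; lra.
  move=> /(sup_upper_bound hs); rewrite -/b; lra.
have bp : 0 < b.
  rewrite lt_def b0 andbT; apply/eqP => bE; apply: nTb; by rewrite bE.
exists b; split=> //.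
have acc d : 0 < d -> exists2 s, T s & `|s - b| < d.
  move=> d0; have [bd|bd] := lerP b (d / 2).
    by exists 0 => //; rewrite sub0r normrN gtr0_norm //; lra.
  by exists (b - d / 2);
    [apply: below; lra|rewrite addrAC subrr sub0r normrN gtr0_norm; lra].
have cP : continuous (fun t : R => quart 1 0 (- 1) L K 1 t).
  move=> t; have -> : (fun t : R => quart 1 0 (- 1) L K 1 t) =
     (fun v : V => quart 1 0 (- 1) L K (v 0 0) (v 1 0)) \o (fun t => pt 1 t).
    by apply/funext => s; rewrite /= !ptE.
  apply: continuous_comp; last exact: continuous_quart.
  by apply: continuous_pt => ?; [exact: cvg_cst|exact: cvg_id].
case: (ltrgtP (quart 1 0 (- 1) L K 1 b) 0) => // Pb; last by case: nTb;
  apply: Tc.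
have : \forall t \near b, quart 1 0 (- 1) L K 1 t < 0
  by exact: cvgr_lt (cP b) _ Pb.
move=> /nbhs_ballP [d /= d0 Hd]; have [s Ts sb] := acc d d0.
have [Ps _] := Tp s Ts; have := Hd s; rewrite /ball /= distrC =>
  /(_ sb) /(lt_trans Ps).
by rewrite ltxx.
Qed.

End Existence.

(** * Every closed connected quartic curve fills a sector *)

Section SectorExistence.
Variable R : realType.
Local Notation V := 'cV[R]_2.
Implicit Types (h : mpoly 2 R) (p q r v w : V) (H : set V).

Lemma peval_scale h (c : R) v : homogeneous_poly 4 h ->
  peval h (c *: v) = c ^+ 4 * peval h v.
Proof.
move=> /peval_homog [a [b [k [d [e [_ E _]]]]]].
by rewrite !E !scale_colE /quart; ring.
Qed.

Lemma hyperbolic_scale h (c : R) v : homogeneous_poly 4 h -> 0 < c ->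
  hyperbolic_point h (c *: v) <-> hyperbolic_point h v.
Proof.
move=> /peval_homog [a [b [k [d [e [_ _ D]]]]]] c0.
rewrite !D !scale_colE.
have -> : hdet a b k d e (c * v 0 0) (c * v 1 0) =
  c ^+ 4 * hdet a b k d e (v 0 0) (v 1 0) by rewrite /hdet; ring.
by rewrite pmulr_rlt0 // exprn_gt0.
Qed.

Lemma cone_scale H (c : R) v : 0 < c -> cone H v -> cone H (c *: v).
Proof.
move=> c0 [d [w [d0 Hw ->]]]; exists (c * d), w.
by split=> //; [exact: mulr_gt0|rewrite scalerA].
Qed.

Lemma cone_level h H v : homogeneous_poly 4 h ->
  (forall w, H w -> peval h w = 1) ->
  cone H v -> peval h v = 1 -> H v.
Proof.
move=> hh H1 [c [w [c0 Hw ->]]].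
rewrite peval_scale // (H1 _ Hw) mulr1 => /eqP.
by rewrite pexpr_eq1 // ?ltW // => /eqP ->; rewrite scale1r.
Qed.

(** The sign [sg] treats both directions at once: replacing [y] by [- y] keeps the standard form and
    only changes [L] to [- L]. *)
Lemma rays_exit h H A (L K : R) (sg : R) : ccgpsr 4 h H -> A \in unitmx ->
  sg ^+ 2 = 1 -> H (A *m pt 1 0) ->
  (forall v, peval h (A *m v) = quart 1 0 (- 1) L K (v 0 0) (v 1 0)) ->
  (forall v, hyperbolic_point h (A *m v) ->
        hdet 1 0 (- 1) L K (v 0 0) (v 1 0) < 0) ->
  exists b, [/\ 0 < b, quart 1 0 (- 1) L K 1 (sg * b) = 0 &
    forall s, 0 <= s -> s < b -> cone H (A *m pt 1 (sg * s))].
Proof.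
move=> [[hh _ Hyp _ HS] cH _] uA sg2 H0 hA DA.
have H1 w : H w -> peval h w = 1 by case/HS.
have Psg t : quart 1 0 (- 1) (sg * L) K 1 t = quart 1 0 (- 1) L K 1 (sg * t).
  rewrite /quart !exprMn (exprM sg 2 2) (exprS sg 2) sg2 expr1n; ring.
have Dsg t : hdet 1 0 (- 1) (sg * L) K 1 t = hdet 1 0 (- 1) L K 1 (sg * t).
  have -> : hdet 1 0 (- 1) L K 1 (sg * t) =
    (12 - 2 * (sg ^+ 2 * t ^+ 2)) *
      (- 2 + 6 * L * sg * t + 12 * K * (sg ^+ 2 * t ^+ 2)) -
    sg ^+ 2 * (- 4 * t + 3 * L * sg * t ^+ 2) ^+ 2 by rewrite /hdet; ring.
  by rewrite sg2 /hdet; ring.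
pose ray t := A *m pt 1 (sg * t).
have ray_shift t d : ray (t + d) = ray t + (sg * d) *: (A *m pt 0 1).
  rewrite /ray mulmx_ptE [in RHS]mulmx_ptE -addrA -scalerDl.
  by congr (_ + _ *: _); ring.
pose T := [set t | cone H (ray t)].
have Hcone w : H w -> cone H w by move=> Hw; exists 1, w; rewrite scale1r.
have [||||b [b0 Pb bT]] := @exit_point _ (sg * L) K T.
- by rewrite /T /= /ray mulr0; apply: Hcone.
- move=> t [c [q [c0 Hq E]]].
  have [d d0 Hd] := open_cone (A *m pt 0 1) hh Hyp HS Hq.
  exists (c * d); first exact: mulr_gt0.
  move=> t' tt'; rewrite /T /= -(subrK t t') addrC ray_shift E.
  have -> : c *: q + (sg * (t' - t)) *: (A *m pt 0 1) =
      c *: (q + (sg * (t' - t) / c) *: (A *m pt 0 1)).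
    by rewrite scalerDr scalerA (mulrC c) divfK // gt_eqF.
  apply: cone_scale => //; apply: Hd.
  have sg1 : `|sg| = 1.
    by apply/eqP; rewrite -(@pexpr_eq1 _ _ 2) ?normr_ge0 // -normrX sg2 normr1.
  by rewrite !normrM sg1 mul1r normfV (gtr0_norm c0) ltr_pdivrMr // mulrC.
- move=> t [c [q [c0 Hq E]]]; have [hq Dq] := HS _ Hq.
  rewrite Psg Dsg; have := hA (pt 1 (sg * t)); have := DA (pt 1 (sg * t)).
  rewrite !ptE -/(ray t) E => D <-; split; last exact/D/hyperbolic_scale.
  by rewrite peval_scale // hq mulr1 exprn_gt0.
(* Relative closedness of [T]: on nearby rays of [T] the points at level 1 belong to [H], and they
   converge to the point at level 1 on the ray of [t], which lies in [H] because [H] is closed. *)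
- move=> t Pt acc.
  pose P s := quart 1 0 (- 1) L K 1 (sg * s).
  pose rho s := (Num.sqrt (Num.sqrt (P s)))^-1.
  have hray s : peval h (ray s) = P s by rewrite hA !ptE.
  have hrho s : 0 < P s -> 0 < rho s /\ peval h (rho s *: ray s) = 1.
    move=> Ps; rewrite peval_scale // hray exprVn (exprM _ 2 2) !sqr_sqrtr
      ?sqrtr_ge0 ?ltW //.
    by rewrite mulVf ?gt_eqF // invr_gt0 !sqrtr_gt0.
  rewrite Psg -/(P t) in Pt.
  have [r0 h1] := hrho t Pt.
  suff Hq : H (rho t *: ray t).
    rewrite /T /= -(scale1r (ray t)) -(@mulVf _ (rho t)) ?gt_eqF // -scalerA.
    by apply: cone_scale; [rewrite invr_gt0|exact: Hcone].
  have craysg : continuous (fun s => pt 1 (sg * s)).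
    apply: continuous_pt => s; first exact: cvg_cst.
    by apply: cvgM; [exact: cvg_cst|exact: cvg_id].
  have cP : continuous P.
    move=> s; have -> : P =
      (fun v : V => quart 1 0 (- 1) L K (v 0 0) (v 1 0)) \o
        (fun s => pt 1 (sg * s)).
      by apply/funext => x; rewrite /= !ptE.
    by apply: continuous_comp; [exact: craysg|exact: continuous_quart].
  have crho : {for t, continuous rho}.
    apply: continuousV; first by rewrite gt_eqF // !sqrtr_gt0.
    apply: continuous_comp; last exact: sqrt_continuous.
    by apply: continuous_comp; [exact: cP|exact: sqrt_continuous].
  have cq : (rho s *: ray s) @[s --> t] --> rho t *: ray t.
    apply: cvgZ; first exact: crho.
    by apply: continuous_comp; [exact: craysg|exact: continuous_mulmx].
  apply: cH => B /cq /nbhs_ballP [d /= d0 Hd].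
  have : \forall s \near t, 0 < P s by exact: cvgr_gt (cP t) _ Pt.
  move=> /nbhs_ballP [d' /= d'0 Hd'].
  have m0 : 0 < Num.min d d' by rewrite lt_min d0.
  have [s Ts] := acc _ m0; rewrite lt_min => /andP[sd sd'].
  exists (rho s *: ray s); split; last by apply: Hd; rewrite /ball /= distrC.
  have [|rs hs] := hrho s; first by apply: Hd'; rewrite /ball /= distrC.
  by apply: cone_level hs => //; apply: cone_scale.
by exists b; split; rewrite -?Psg.
Qed.

(** All rays strictly between the two exits belong to the cone over [H], and [h] vanishes at the
    exits, so in the basis of exit directions [h] has no fourth powers. *)
Lemma ccgpsr_sector h H : ccgpsr 4 h H -> exists A al be ga,
  sector h A al be ga /\ H = act A (nullcurve al be ga).
Proof.
move=> cc; have [[hh _ Hyp [p Hp] HS] cH coH] := cc.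
have H1 w : H w -> peval h w = 1 by case/HS.
have [A [L [K [uA Ap hA DA]]]] := standard_form_at hh (HS _ Hp).
have HA : H (A *m pt 1 0) by rewrite Ap.
have [b [b0 Pb bT]] := rays_exit cc uA (expr1n _ 2) HA hA DA.
have sgN : (-1) ^+ 2 = 1 :> R by rewrite sqrrN expr1n.
have [a [a0 Pa aT]] := rays_exit cc uA sgN HA hA DA.
rewrite mul1r in Pb; rewrite mulN1r in Pa.
have rayT t : - a < t -> t < b -> cone H (A *m pt 1 t).
  move=> ta tb; have [t0|t0] := lerP 0 t.
    by have := bT t t0 tb; rewrite mul1r.
  by have := aT (- t); rewrite mulN1r opprK; apply; lra.
(* The columns are the images under [A] of the exit directions [(1, b)] and [(1, - a)]. *)
pose B := A *m mx22 1 1 b (- a).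
have uB : B \in unitmx.
  by rewrite unitmx_mul uA unitmx22 det_mx22E !mul1r lt_eqF // subr_lt0; lra.
have coneB v : quad v -> cone H (B *m v).
  move=> [v0 v1]; have vv : 0 < v 0 0 + v 1 0 by lra.
  pose t := (b * v 0 0 - a * v 1 0) / (v 0 0 + v 1 0).
  have -> : B *m v = (v 0 0 + v 1 0) *: (A *m pt 1 t).
    rewrite -mulmxA scalemxAr; congr (_ *m _).
    rewrite {1}(pt_eta v) mul_mx22_pt; apply: eq_col2; rewrite scale_colE !ptE;
      first by ring.
    by rewrite /t; field; rewrite gt_eqF.
  apply: cone_scale => //; apply: rayT.
    by rewrite /t ltr_pdivlMr //; nra.
  by rewrite /t ltr_pdivrMr //; nra.
have [a' [b' [c' [d' [e' [_ _ hB hypB]]]]]] := peval_mulmx B hh.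
have Bpt (x y : R) : B *m pt x y = A *m pt (x + y) (b * x - a * y).
  by rewrite -mulmxA mul_mx22_pt; congr (_ *m pt _ _); ring.
have a0' : a' = 0.
  have := hB (pt 1 0); rewrite Bpt hA !ptE mulr1 mulr0 subr0 addr0 Pb => ->.
  by rewrite /quart; ring.
have e0' : e' = 0.
  have := hB (pt 0 1); rewrite Bpt hA !ptE mulr1 mulr0 sub0r add0r Pa => ->.
  by rewrite /quart; ring.
rewrite a0' e0' in hB hypB.
have coneh w : cone H w -> 0 < peval h w /\ hyperbolic_point h w.
  move=> [c [q [c0 Hq ->]]];
    rewrite peval_scale // (H1 _ Hq) mulr1 exprn_gt0 //.
  by split=> //; apply/hyperbolic_scale => //; have [] := HS _ Hq.
have gd : good b' c' d'.
  apply: good_of_hyp => x y x0 y0.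
    by have [] := coneh _ (coneB _ (quad_pt x0 y0)); rewrite hB !ptE nullqE.
  by have [_ /(hypB uB)] := coneh _ (coneB _ (quad_pt x0 y0)); rewrite !ptE.
exists B, b', c', d'.
have sec : sector h B b' c' d' by split=> // v; rewrite hB nullqE.
split=> //.
have sub : act B (nullcurve b' c' d') `<=` H.
  move=> _ [v [qv gv] <-]; apply: (cone_level hh H1 (coneB _ qv)).
  by rewrite hB -nullqE.
apply/seteqP; split=> //.
(* The sector curve inside [H] is a component of the hyperbolic locus, and [H] is connected, so
   nothing else fits into [H]. *)
have [[_ _ _ [q Hq] _] _ _] := sector_ccgpsr sec.
rewrite -(sector_component sec Hq).
by apply: connected_component_max => //; exact: sub.
Qed.

End SectorExistence.

(** * Null coordinates of the four normal forms, and the classification *)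

Section NormalForms.
Variable R : realType.
Local Notation V := 'cV[R]_2.
Implicit Types (c : normal_form R) (k K al be ga : R).

Lemma peval_std (L K : R) (v : V) :
  peval (std_poly L K) v = quart 1 0 (- 1) L K (v 0 0) (v 1 0).
Proof. by rewrite std_polyE peval_quartp. Qed.

Lemma std_homog (L K : R) : homogeneous_poly 4 (std_poly L K).
Proof. by rewrite std_polyE; exact: quartp_homogeneous. Qed.

(** The columns span the zero lines of [x^2 - k y^2] and add up to [(1, 0)]. For [k >= 1/2] these
    are the first zero lines met from [(1, 0)]. *)
Definition matD k : 'M[R]_2 :=
  mx22 2^-1 2^-1 (2 * Num.sqrt k)^-1 (- (2 * Num.sqrt k)^-1).

(** The first column spans the double zero line [y = sqrt 3 x], the second the simple zero line
    [y = - (sqrt 3 / 2) x]; they add up to [(1, 0)]. *)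
Definition matC : 'M[R]_2 :=
  mx22 3^-1 (2 / 3) (Num.sqrt 3)^-1 (- (Num.sqrt 3)^-1).

(** The first column spans the triple zero line [y = sqrt 6 x], the second the simple one; the
    scaling is that of the eigenvectors in [flow_b]. *)
Definition matB : 'M[R]_2 :=
  mx22 1 (Num.sqrt 6 / 2) (Num.sqrt 6) (- 1).

Lemma sectorD k : 2^-1 <= k ->
  sector (std_poly 0 (k * (1 - k))) (matD k)
    ((2 * k - 1) / (4 * k)) (2 * k)^-1 ((2 * k - 1) / (4 * k)).
Proof.
move=> k1; have k0 : 0 < k by lra.
have l0 : 0 < Num.sqrt k by rewrite sqrtr_gt0.
have l2 : Num.sqrt k ^+ 2 = k by rewrite sqr_sqrtr // ltW.
have a0 : 0 <= (2 * k - 1) / (4 * k) by rewrite divr_ge0 //; lra.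
split; last 2 first.
- exact: std_homog.
- move=> v; rewrite peval_std {1 2}(pt_eta v) mul_mx22_pt !ptE.
  move: (v 0 0) (v 1 0) => x y.
  have -> : (2 * Num.sqrt k)^-1 * x + - (2 * Num.sqrt k)^-1 * y =
    (Num.sqrt k)^-1 * ((x - y) / 2) by field; rewrite gt_eqF.
  have i2 : (Num.sqrt k)^-1 ^+ 2 = k^-1 by rewrite exprVn l2.
  rewrite /quart mulrA !mul0r !addr0 !exprMn i2 (exprM _ 2 2) i2 /nullq.
  by field; rewrite gt_eqF.
- rewrite unitmx22 det_mx22E lt_eqF //.
  have : 0 < (2 * Num.sqrt k)^-1 by rewrite invr_gt0 mulr_gt0.
  lra.
- by split=> //; left; rewrite invr_gt0; lra.
Qed.

Lemma sectorC : sector (std_poly (2 / (3 * Num.sqrt 3)) 0) matC 0 3^-1 (2 / 3).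
Proof.
have s0 : 0 < Num.sqrt 3 :> R by rewrite sqrtr_gt0.
have s2 : Num.sqrt 3 ^+ 2 = 3 :> R by rewrite sqr_sqrtr.
split; last 2 first.
- exact: std_homog.
- move=> v; rewrite peval_std {1 2}(pt_eta v) mul_mx22_pt !ptE.
  move: (v 0 0) (v 1 0) => x y.
  have -> : (Num.sqrt 3)^-1 * x + - (Num.sqrt 3)^-1 * y =
    Num.sqrt 3 * ((x - y) / Num.sqrt 3 ^+ 2) by field; rewrite gt_eqF.
  move: (Num.sqrt 3) s0 s2 => s s0 s2.
  have Q (X t : R) : quart 1 0 (- 1) (2 / (3 * s)) 0 X (s * t) =
      X ^+ 4 - s ^+ 2 * X ^+ 2 * t ^+ 2 + 2 / 3 * s ^+ 2 * X * t ^+ 3.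
    by rewrite /quart; field; rewrite gt_eqF.
  by rewrite Q s2 /nullq; field.
- by rewrite unitmx22 det_mx22E lt_eqF.
- by split=> //; left; rewrite invr_gt0.
Qed.

Lemma sqrt6E : Num.sqrt 6 = Num.sqrt 2 * Num.sqrt 3 :> R.
Proof. by rewrite -sqrtrM // -natrM. Qed.

Lemma coefB : 2 * Num.sqrt 2 / (3 * Num.sqrt 3) = 2 * Num.sqrt 6 / 9 :> R.
Proof.
have s0 : 0 < Num.sqrt 3 :> R by rewrite sqrtr_gt0.
have s2 : Num.sqrt 3 ^+ 2 = 3 :> R by rewrite sqr_sqrtr.
have -> : 9 = 3 * Num.sqrt 3 ^+ 2 :> R by rewrite s2 -natrM.
by rewrite sqrt6E; field; rewrite gt_eqF.
Qed.

Lemma sectorB : sector (std_poly (2 * Num.sqrt 2 / (3 * Num.sqrt 3)) (- 12^-1))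
  matB
  0 0 (64 * Num.sqrt 6 / 9).
Proof.
have w0 : 0 < Num.sqrt 6 :> R by rewrite sqrtr_gt0.
have w2 : Num.sqrt 6 ^+ 2 = 6 :> R by rewrite sqr_sqrtr.
rewrite coefB; split; last 2 first.
- exact: std_homog.
- move=> v; rewrite peval_std {1 2}(pt_eta v) mul_mx22_pt !ptE.
  move: (v 0 0) (v 1 0) => x y.
  (* After scaling [y] by [w] only even powers of [w] occur, and [w2] makes them rational. *)
  set w := Num.sqrt 6 in w0 w2 *; pose z := w * y / 6.
  have -> : y = w * z.
    by rewrite /z mulrA [w * (w * y)]mulrA -expr2 w2; field.
  have -> : w / 2 * (w * z) = 3 * z.
    by rewrite (_ : _ * _ = w ^+ 2 * z / 2); [rewrite w2; field|field].
  have -> : w * x + -1 * (w * z) = w * (x - z) by ring.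
  have Q (X t : R) : quart 1 0 (- 1) (2 * w / 9) (- 12^-1) X (w * t) =
      X ^+ 4 - w ^+ 2 * X ^+ 2 * t ^+ 2 + 2 / 9 * (w ^+ 2) ^+ 2 * X * t ^+ 3 -
      12^-1 * (w ^+ 2) ^+ 2 * t ^+ 4.
    by rewrite /quart; field.
  have N : nullq 0 0 (64 * w / 9) x (w * z) =
    64 / 9 * (w ^+ 2) ^+ 2 * x * z ^+ 3.
    by rewrite /nullq; field.
  by rewrite Q N w2; field.
- by rewrite unitmx22 det_mx22E lt_eqF.
- by split=> //; right; rewrite mul0r add0r divr_gt0 // mulr_gt0.
Qed.

(* x^4 - x^2 y^2 + K y^4 = (x^2 - k y^2) (x^2 - (1 - k) y^2) with k = kap K. *)
Definition kap K : R := (1 + Num.sqrt (1 - 4 * K)) / 2.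

Lemma kap_gt K : K < 4^-1 -> 2^-1 < kap K.
Proof.
move=> K1; have : 0 < Num.sqrt (1 - 4 * K) by rewrite sqrtr_gt0; lra.
by rewrite /kap; lra.
Qed.

Lemma kapM K : K < 4^-1 -> kap K * (1 - kap K) = K.
Proof.
move=> K1; have w2 : Num.sqrt (1 - 4 * K) ^+ 2 = 1 - 4 * K
  by rewrite sqr_sqrtr; lra.
have -> : kap K * (1 - kap K) = (1 - Num.sqrt (1 - 4 * K) ^+ 2) / 4.
  by rewrite /kap; field.
by rewrite w2; field.
Qed.

Definition nf_matrix c : 'M[R]_2 :=
  match c with
  | FormA => matD 2^-1
  | FormB => matB
  | FormC => matC
  | FormD K _ => matD (kap K)
  end.

Definition nf_coef c : R * R * R :=
  match c with
  | FormA => (0, 1, 0)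
  | FormB => (0, 0, 64 * Num.sqrt 6 / 9)
  | FormC => (0, 3^-1, 2 / 3)
  | FormD K _ => ((2 * kap K - 1) / (4 * kap K), (2 * kap K)^-1,
                  (2 * kap K - 1) / (4 * kap K))
  end.

Definition nf_null c : set V :=
  nullcurve (nf_coef c).1.1 (nf_coef c).1.2 (nf_coef c).2.

Lemma nf_sector c :
  sector (nf_poly c) (nf_matrix c) (nf_coef c).1.1 (nf_coef c).1.2
    (nf_coef c).2.
Proof.
case: c => [|||K hK] /=; [|exact: sectorB|exact: sectorC|].
  have := sectorD (lexx 2^-1).
  have -> : 2^-1 * (1 - 2^-1) = 4^-1 :> R by field.
  have -> : (2 * 2^-1 - 1) / (4 * 2^-1) = 0 :> R by field.
  by have -> : (2 * 2^-1)^-1 = 1 :> R by field.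
by have := sectorD (ltW (kap_gt hK)); rewrite kapM.
Qed.

Lemma peval_std10 (L K : R) : peval (std_poly L K) (pt 1 0) = 1.
Proof. by rewrite peval_std !ptE /quart; ring. Qed.

Lemma nf_base c : act (nf_matrix c) (nf_null c) (pt 1 0).
Proof.
have S := nf_sector c; have [uA gd _ hA] := S.
suff [v qv Av] : exists2 v, quad v & nf_matrix c *m v = pt 1 0.
  exists v => //; split=> //; rewrite -hA Av.
  by case: (c) => *; exact: peval_std10.
have q11 : quad (pt (1 : R) 1) by exact: quad_pt.
case: c {S uA gd hA} => [|||K hK] /=.
- exists (pt 1 1) => //; rewrite mul_mx22_pt !mulr1 subrr.
  by congr pt; field.
- exists (pt 4^-1 (Num.sqrt 6 / 4)).
    by apply: quad_pt; rewrite ?divr_gt0 ?sqrtr_gt0 ?invr_gt0.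
  rewrite mul_mx22_pt; congr pt; last by field.
  have -> : 1 / 4 + Num.sqrt 6 / 2 * (Num.sqrt 6 / 4) =
    4^-1 + Num.sqrt 6 ^+ 2 / 8 :> R.
    by field.
  by rewrite sqr_sqrtr //; field.
- exists (pt 1 1) => //; rewrite mul_mx22_pt !mulr1 subrr.
  by congr pt; field.
- exists (pt 1 1) => //; rewrite mul_mx22_pt !mulr1 subrr.
  by congr pt; field.
Qed.

Lemma nf_curveE c : nf_curve c = act (nf_matrix c) (nf_null c).
Proof. exact: (sector_component (nf_sector c) (nf_base c)). Qed.

Lemma nf_unit c : nf_matrix c \in unitmx.
Proof. by case: (nf_sector c). Qed.

Lemma nf_good c : good (nf_coef c).1.1 (nf_coef c).1.2 (nf_coef c).2.
Proof. by case: (nf_sector c). Qed.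

Lemma nf_ccgpsr c :
  ccgpsr 4 (nf_poly c) (nf_curve c) /\ standard_form (nf_poly c) (nf_curve c).
Proof.
split; first by rewrite nf_curveE; exact: sector_ccgpsr (nf_sector c).
split; first by rewrite nf_curveE; exact: nf_base.
by case: c => [|||K hK] /=; eexists _, _.
Qed.

(** The equations for [be] and [ga] determine [s = l m] and then [m]; the equation for [al] follows
    from the invariant. As [al] and [al'] may vanish, forms c and d are both covered. *)
Lemma monomial_solve al be ga al' be' ga' : 0 < be -> 0 < be' -> 0 < ga ->
  0 < ga' ->
  al * ga * be' ^+ 2 = al' * ga' * be ^+ 2 ->
  exists l m : R, [/\ 0 < l, 0 < m, al = l ^+ 3 * m * al',
    be = l ^+ 2 * m ^+ 2 * be' & ga = l * m ^+ 3 * ga'].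
Proof.
move=> b0 b'0 c0 c'0 E.
pose s := Num.sqrt (be / be'); have s0 : 0 < s by rewrite sqrtr_gt0 divr_gt0.
have s2 : s ^+ 2 = be / be' by rewrite sqr_sqrtr // ltW // divr_gt0.
have r0 : 0 < ga / (ga' * s) by rewrite divr_gt0 // mulr_gt0.
pose m := Num.sqrt (ga / (ga' * s)); have m0 : 0 < m by rewrite sqrtr_gt0.
have m2 : m ^+ 2 = ga / (ga' * s) by rewrite sqr_sqrtr // ltW.
have nz : [/\ be != 0, be' != 0, ga != 0, ga' != 0 & s != 0] by rewrite !gt_eqF.
have mn : m != 0 by rewrite gt_eqF.
case: nz => n1 n2 n3 n4 n5.
exists (s / m), m; split=> //; first by rewrite divr_gt0.
- have -> : (s / m) ^+ 3 * m * al' = (s ^+ 2) * s / m ^+ 2 * al' by field.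
  rewrite m2.
  have -> : s ^+ 2 * s / (ga / (ga' * s)) * al' =
    s ^+ 2 * s ^+ 2 * al' * ga' / ga.
    by field; rewrite n3 n4 n5.
  rewrite s2 (_ : be / be' * (be / be') * al' * ga' / ga =
    (al' * ga' * be ^+ 2) / (be' ^+ 2 * ga)).
    by rewrite -E; field; rewrite n2 n3.
  by field; rewrite n2 n3.
- by rewrite (_ : (s / m) ^+ 2 * m ^+ 2 = s ^+ 2); [rewrite s2; field|field].
- rewrite (_ : s / m * m ^+ 3 = s * m ^+ 2); last by field.
  by rewrite m2; field; rewrite n4 n5.
Qed.

Lemma null_classification al be ga : good al be ga ->
  exists c B, monomial_rel B al be ga (nf_coef c).1.1 (nf_coef c).1.2
    (nf_coef c).2.
Proof.
move=> [a0 c0 [b0|[b0 ac acp]]]; last first.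
  have g0 : 0 < 64 * Num.sqrt 6 / 9 :> R
    by rewrite divr_gt0 ?mulr_gt0 ?sqrtr_gt0.
  exists FormB => /=; set g := _ / 9 in g0 *.
  move/eqP: ac; rewrite mulf_eq0 => /orP[] /eqP z;
    rewrite z ?addr0 ?add0r in acp *.
    exists (mx22 (ga / g) 0 0 1), (ga / g), 1; split=> //;
      first exact: divr_gt0.
    by left; split; rewrite ?mulr0 //; field; rewrite gt_eqF.
  exists (mx22 0 (al / g) 1 0), (al / g), 1; split=> //; first exact: divr_gt0.
  by right; split; rewrite ?mulr0 //; field; rewrite gt_eqF.
have [a1|a1] := eqVneq al 0; have [c1|c1] := eqVneq ga 0.
- exists FormA => /=.
  have r0 : 0 < Num.sqrt be by rewrite sqrtr_gt0.
  exists (mx22 (Num.sqrt be) 0 0 1), (Num.sqrt be), 1; split=> //; left.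
  by rewrite a1 c1 !mulr0 expr1n !mulr1 sqr_sqrtr // ltW.
- have c2 : 0 < ga by rewrite lt_def c1.
  exists FormC => /=.
  have [|||l [m [l0 m0 ea eb ec]]] :=
    @monomial_solve al be ga 0 3^-1 (2 / 3) b0 _ c2.
  + by [].
  + by [].
  + by rewrite a1 !mul0r.
  by exists (mx22 l 0 0 m), l, m; split=> //; left.
- have a2 : 0 < al by rewrite lt_def a1.
  exists FormC => /=.
  have [|||l [m [l0 m0 ea eb ec]]] :=
    @monomial_solve ga be al 0 3^-1 (2 / 3) b0 _ a2.
  + by [].
  + by [].
  + by rewrite c1 !mul0r.
  by exists (mx22 0 l m 0), l, m; split=> //; right.
have c2 : 0 < ga by rewrite lt_def c1.
have a2 : 0 < al by rewrite lt_def a1.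
have ac0 : 0 < al * ga / be ^+ 2 by rewrite divr_gt0 ?mulr_gt0 ?exprn_gt0.
have hK : 4^-1 - al * ga / be ^+ 2 < 4^-1 by lra.
exists (FormD hK) => /=.
have k0 := kap_gt hK; have kM := kapM hK; set k := kap _ in k0 kM *.
have kp : 0 < k by lra.
have [|||l [m [l0 m0 ea eb ec]]] := @monomial_solve al be ga
  ((2 * k - 1) / (4 * k)) (2 * k)^-1 ((2 * k - 1) / (4 * k)) b0 _ c2.
+ by rewrite invr_gt0 mulr_gt0.
+ by rewrite divr_gt0 //; lra.
+ have -> : al * ga = (4^-1 - k * (1 - k)) * be ^+ 2.
    by rewrite kM; field; rewrite gt_eqF.
  by field; rewrite gt_eqF.
by exists (mx22 l 0 0 m), l, m; split=> //; left.
Qed.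

Lemma nf_classification (H : set V) :
  quartic_ccgpsr_curve H -> exists c, equivalent H (nf_curve c).
Proof.
move=> [h /ccgpsr_sector [A [al [be [ga [[uA gd _ _] ->]]]]]].
have [c [B rel]] := null_classification gd; exists c.
have uB := monomial_rel_unit rel.
rewrite nf_curveE /nf_null -(monomial_rel_act rel).
exists (nf_matrix c *m B *m invmx A); first
  by rewrite !unitmx_mul nf_unit uB unitmx_inv.
by rewrite !actM mulmxKV.
Qed.

Lemma coefD_neq0 K : K < 4^-1 -> let a := (2 * kap K - 1) / (4 * kap K) in
  [/\ a <> 0, (2 * kap K)^-1 <> 0 & a * a <> 0].
Proof.
move=> hK; have k0 := kap_gt hK; move=> a.
have a0 : 0 < a by rewrite divr_gt0; lra.
have b0 : 0 < (2 * kap K)^-1 by rewrite invr_gt0; lra.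
by split; apply/eqP; rewrite gt_eqF // mulr_gt0.
Qed.

(** On the family d the invariant [al ga / be ^ 2] equals [(2 kap K - 1) ^ 2 / 4 = 1/4 - K], so it
    recovers [K]. *)
Lemma coefD_inj K K' : K < 4^-1 -> K' < 4^-1 ->
  let a K := (2 * kap K - 1) / (4 * kap K) in
  a K * a K * (2 * kap K')^-1 ^+ 2 = a K' * a K' * (2 * kap K)^-1 ^+ 2 ->
    K = K'.
Proof.
move=> hK hK' a; rewrite /a.
have k0 : 0 < kap K by have := kap_gt hK; lra.
have k'0 : 0 < kap K' by have := kap_gt hK'; lra.
have E0 K0 K1 : 0 < kap K0 -> 0 < kap K1 ->
    (2 * kap K0 - 1) / (4 * kap K0) * ((2 * kap K0 - 1) / (4 * kap K0)) *
      (2 * kap K1)^-1 ^+ 2 =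
    (2 * kap K0 - 1) ^+ 2 / (8 * kap K0 * kap K1) ^+ 2.
  by move=> ? ?; field; rewrite !gt_eqF.
rewrite !E0 // (_ : 8 * kap K' * kap K = 8 * kap K * kap K'); last by ring.
have n0 : 0 < 8 * kap K * kap K' by rewrite !mulr_gt0.
move/(congr1 (fun x => x * (8 * kap K * kap K') ^+ 2)).
rewrite !divfK ?expf_neq0 ?gt_eqF //.
have kE K0 : 2 * kap K0 - 1 = Num.sqrt (1 - 4 * K0) by rewrite /kap; field.
by rewrite !kE !sqr_sqrtr; lra.
Qed.

Lemma nf_equivalent_inj c c' : equivalent (nf_curve c) (nf_curve c') -> c = c'.
Proof.
move=> [A uA]; rewrite !nf_curveE actM => E.
have uB : invmx (nf_matrix c') *m (A *m nf_matrix c) \in unitmx.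
  by rewrite !unitmx_mul unitmx_inv !nf_unit uA.
have {}E : act (invmx (nf_matrix c') *m (A *m nf_matrix c)) (nf_null c) =
  nf_null c'.
  by rewrite -actM E actK // nf_unit.
have [] := monomial_rel_inv (act_nullcurve_rel uB (nf_good c) (nf_good c') E).
have g0 : 64 * Num.sqrt 6 / 9 <> 0 :> R.
  by apply/eqP; rewrite gt_eqF // divr_gt0 ?mulr_gt0 ?sqrtr_gt0.
have t0 : 3^-1 <> 0 :> R by apply/eqP; rewrite gt_eqF // invr_gt0.
have t1 : 2 / 3 <> 0 :> R by apply/eqP; rewrite gt_eqF // divr_gt0.
have o0 : 1 <> 0 :> R by apply/eqP; exact: oner_neq0.
have z0 : 0 * 0 = 0 :> R by rewrite mul0r.
have z1 : 0 * (2 / 3) = 0 :> R by rewrite mul0r.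
have zz : 0 = 0 :> R by [].
(* Different letters have different zero patterns, which [tauto] refutes; only two members of the
   family d need the numerical invariant. *)
case: c c' {A uA E uB} => [|||K hK] [|||K' hK'] //= H1 H2 H3 H4;
  try (have [p q pp] := coefD_neq0 hK);
    try (have [p' q' pp'] := coefD_neq0 hK');
  first [exfalso; tauto|idtac].
have KK : K = K' by exact: coefD_inj H4.
by subst K'; congr FormD; exact: bool_irrelevance.
Qed.

End NormalForms.

(** * Components of the hyperbolic locus and automorphisms of the quartic *)

Section Automorphisms.
Variable R : realType.
Local Notation V := 'cV[R]_2.
Local Notation M := 'M[R]_2.
Implicit Types (h : mpoly 2 R) (A B P sg : M) (v w : V) (al be ga : R).

Lemma aut_subgroup h : subgroup (linear_automorphisms h).
Proof.
split.
- by move=> A [].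
- by split=> [|v]; [exact: unitmx1|rewrite mul1mx].
- move=> A B [uA hA] [uB hB]; split=> [|v]; first by rewrite unitmx_mul uA.
  by rewrite -mulmxA hA hB.
- move=> A [uA hA]; split=> [|v]; first by rewrite unitmx_inv.
  by rewrite -hA mulKVmx.
Qed.

Lemma aut_opp h A : homogeneous_poly 4 h ->
  linear_automorphisms h A -> linear_automorphisms h (- A).
Proof.
move=> hh [uA hA]; split=> [|v].
  by rewrite unitmx22 -scaleN1r detZ sqrrN expr1n mul1r -unitmx22.
by rewrite mulNmx -scaleN1r peval_scale // (exprM _ 2 2) sqrrN !expr1n mul1r.
Qed.

Lemma aut_sector h A P al be ga : linear_automorphisms h A ->
  sector h P al be ga -> sector h (A *m P) al be ga.
Proof.
move=> [uA hA] [uP gd hh hP]; split=> //; first by rewrite unitmx_mul uA.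
by move=> v; rewrite -mulmxA hA.
Qed.

(** [N] is the product of the null coordinates of [P], positive exactly on the sector of [P] and its
    opposite. *)
Definition null_form (N : V -> R) P : Prop :=
  forall v, N (P *m v) = v 0 0 * v 1 0.

Lemma null_form_pos N P w : P \in unitmx -> null_form N P -> 0 < N w ->
  quad (invmx P *m w) \/ quad (invmx P *m - w).
Proof.
move=> uP HN; rewrite -{1}(mulKVmx uP w) HN mulmxN.
move: (invmx P *m w) => v; rewrite /quad /= ![(- v) _ _]mxE !oppr_gt0.
have [v0|v0|->] := ltrgtP (v 0 0) 0; last by rewrite mul0r ltxx.
  by rewrite nmulr_rgt0 // => ?; right; split.
by rewrite pmulr_rgt0 // => ?; left; split.
Qed.

Lemma null_form_quad N P w : P \in unitmx -> null_form N P ->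
  quad (invmx P *m w) -> 0 < N w.
Proof.
by move=> uP HN [v0 v1]; rewrite -(mulKVmx uP w) HN mulr_gt0.
Qed.

Lemma null_formN N P w : P \in unitmx -> null_form N P -> N (- w) = N w.
Proof.
by move=> uP HN; rewrite -(mulKVmx uP w) -mulmxN !HN !mxE mulrNN.
Qed.

Section Components.
Variables (h : mpoly 2 R) (P : M) (al be ga : R).
Hypothesis sec : sector h P al be ga.
Variables (k : nat) (g : nat -> M).
Hypothesis gaut : forall i, (i < k)%N -> linear_automorphisms h (g i).
Hypothesis gcover : forall w, 0 < peval h w ->
  exists2 i, (i < k)%N & quad (invmx P *m (invmx (g i) *m w)).
Hypothesis gdisj : forall i j w, (i < k)%N -> (j < k)%N ->
  quad (invmx P *m (invmx (g i) *m w)) ->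
    quad (invmx P *m (invmx (g j) *m w)) -> i = j.

Let comp i := act (g i *m P) (nullcurve al be ga).

Let comp_sec i : (i < k)%N -> sector h (g i *m P) al be ga.
Proof. by move=> ik; apply: aut_sector => //; exact: gaut. Qed.

Let compP i w : (i < k)%N -> comp i w <-> peval h w = 1 /\
  quad (invmx P *m (invmx (g i) *m w)).
Proof.
move=> ik; rewrite /comp (sector_curveP (comp_sec ik)).
have [uP _ _ _] := sec; have [ug _] := gaut ik.
suff -> : invmx (g i *m P) *m w = invmx P *m (invmx (g i) *m w) by [].
have ugP : g i *m P \in unitmx by rewrite unitmx_mul ug.
apply: (can_inj (mulKmx ugP)).
by rewrite mulKVmx // -mulmxA mulKVmx // mulKVmx.
Qed.

(** The translates of one sector by the [g i] cover the region [h > 0], which contains the level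
    set, and each translate carries a full component by [sector_component]. *)
Lemma components_sectors :
  components (hyperbolic_locus h) = [set comp i | i in `I_k].
Proof.
apply/seteqP; split=> [_ [p Sp ->]|_ [i /= ik <-]].
  have [hp _] := Sp.
  have [|i ik qi] := gcover (w := p); first by rewrite hp.
  exists i => //; symmetry; apply: (sector_component (comp_sec ik)).
  exact/compP.
have [[_ _ _ [p Hp] HS] _ _] := sector_ccgpsr (comp_sec ik).
exists p; first exact: HS.
by rewrite (sector_component (comp_sec ik) Hp).
Qed.

Lemma sector_components : equivalent_closed_components k (hyperbolic_locus h).
Proof.
have [uP gd _ _] := sec.
split; rewrite components_sectors.
- apply: inj_card_eq => i j; rewrite !inE /= => ik jk E.
  have [[_ _ _ [p Hp] _] _ _] := sector_ccgpsr (comp_sec ik).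
  have {}Hp : comp i p by [].
  have /(compP _ ik) [_ qi] := Hp; move: Hp; rewrite E => /(compP _ jk) [_ qj].
  exact: gdisj qi qj.
- by move=> _ [i /= ik <-]; exact: (sector_closed (comp_sec ik)).
- move=> _ _ [i /= ik <-] [j /= jk <-].
  have [ui _] := gaut ik; have [uj _] := gaut jk.
  exists (g j *m invmx (g i)); first by rewrite unitmx_mul unitmx_inv uj.
  by rewrite /comp actM mulmxA (mulmxKV ui).
Qed.

(** [A] carries the component in the sector to a component, which is that of some [g i]; undoing
    [g i] leaves a map that stabilises the curve in the quadrant. *)
Lemma aut_decomposition A : linear_automorphisms h A ->
  exists i B, [/\ (i < k)%N, monomial_rel B al be ga al be ga
    & A = g i *m (P *m B *m invmx P)].
Proof.
move=> autA; have [uA hA] := autA; have [uP gd _ hP] := sec.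
have [[_ _ _ [p Hp] _] _ _] := sector_ccgpsr (aut_sector autA sec).
have /(sector_curveP (aut_sector autA sec)) [hp qp] := Hp.
have [|i ik qi] := gcover (w := p); first by rewrite hp.
have [ug _] := gaut ik.
have E : act (A *m P) (nullcurve al be ga) = comp i.
  rewrite -(sector_component (aut_sector autA sec) Hp).
  by apply: (sector_component (comp_sec ik)); exact/compP.
pose B := invmx P *m (invmx (g i) *m (A *m P)).
have uB : B \in unitmx by rewrite !unitmx_mul !unitmx_inv uP ug uA.
have Bact : act B (nullcurve al be ga) = nullcurve al be ga.
  by rewrite /B -actM -(actM (invmx (g i))) E /comp -actM actK // actK.
exists i, B; split=> //; first exact: act_nullcurve_rel Bact.
by rewrite /B !mulmxA !(mulmxK uP) (mulmxV ug) mul1mx.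
Qed.

End Components.

Lemma invmxN A : invmx (- A) = - invmx A.
Proof.
have [uA|uA] := boolP (A \in unitmx).
  have uN : - A \in unitmx
    by rewrite unitmx22 -scaleN1r detZ sqrrN expr1n mul1r -unitmx22.
  by apply: (can_inj (mulKmx uN)); rewrite mulmxV // mulNmx mulmxN opprK mulmxV.
have uN : - A \notin unitmx
  by rewrite unitmx22 -scaleN1r detZ sqrrN expr1n mul1r -unitmx22.
by rewrite !invmx_out.
Qed.

Lemma quad_opp v : quad v -> ~ quad (- v).
Proof.
by move=> [v0 _] []; rewrite mxE oppr_gt0 => /(lt_trans v0); rewrite ltxx.
Qed.

Definition signs (i : nat) : M := if i is 0 then 1%:M else - 1%:M.

(** Here [h] is positive only inside the sector and its opposite, so the signs alone permute the
    components transitively. *)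
Lemma components2 h P al be ga N : sector h P al be ga -> null_form N P ->
  (forall w, 0 < peval h w -> 0 < N w) ->
  equivalent_closed_components 2 (hyperbolic_locus h) /\
  forall A, linear_automorphisms h A ->
  exists B, monomial_rel B al be ga al be ga /\
    (A = P *m B *m invmx P \/ A = - (P *m B *m invmx P)).
Proof.
move=> sec HN pos; have [uP gd hh _] := sec.
have inv0 : invmx (signs 0) = 1%:M by rewrite invmx1.
have inv1 : invmx (signs 1) = - 1%:M by rewrite invmxN invmx1.
have a1 : linear_automorphisms h 1%:M by have [] := aut_subgroup h.
have gaut i : (i < 2)%N -> linear_automorphisms h (signs i).
  by case: i => [|[|//]] _ //; exact: aut_opp.
have gcov w : 0 < peval h w ->
    exists2 i, (i < 2)%N & quad (invmx P *m (invmx (signs i) *m w)).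
  move=> /pos /(null_form_pos uP HN) [] q; [exists 0%N|exists 1%N] => //.
    by rewrite inv0 mul1mx.
  by rewrite inv1 mulNmx mul1mx.
have gdisj i j w : (i < 2)%N -> (j < 2)%N ->
    quad (invmx P *m (invmx (signs i) *m w)) ->
    quad (invmx P *m (invmx (signs j) *m w)) -> i = j.
  case: i j => [|[|//]] [|[|//]] _ _;
    rewrite ?inv0 ?inv1 ?mulNmx ?mul1mx ?mulmxN // => q1 q2.
    by case: (quad_opp q1).
  by case: (quad_opp q2).
split; first exact: (sector_components sec gaut gcov gdisj).
move=> A /(aut_decomposition sec gaut gcov) [i [B [ik rel ->]]]; exists B;
  split=> //.
by move: ik; case: i => [|[|//]] _ /=;
  [left; rewrite mul1mx|right; rewrite mulNmx mul1mx].
Qed.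

Definition signed_pair sg (i : nat) : M :=
  match i with 0 => 1%:M | 1 => - 1%:M | 2 => sg | _ => - sg end.

(** The region [h > 0] is covered by [N > 0] and its image under [sg], and the first sign hypothesis
    keeps the sectors in them apart. Each of the two contributes a sector and its opposite. *)
Lemma components4 h P al be ga N sg : sector h P al be ga -> null_form N P ->
  linear_automorphisms h sg ->
  (forall w, 0 < N w -> 0 < peval h w -> N (invmx sg *m w) < 0) ->
  (forall w, 0 < peval h w -> 0 < N w \/ 0 < N (invmx sg *m w)) ->
  equivalent_closed_components 4 (hyperbolic_locus h) /\
  forall A, linear_automorphisms h A ->
  exists B, monomial_rel B al be ga al be ga /\
   [\/ A = P *m B *m invmx P, A = - (P *m B *m invmx P),
      A = sg *m (P *m B *m invmx P) | A = - (sg *m (P *m B *m invmx P))].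
Proof.
move=> sec HN asg neg pos; have [uP gd hh hP] := sec.
pose g := signed_pair sg.
have inv0 : invmx (g 0%N) = 1%:M by rewrite invmx1.
have inv1 : invmx (g 1%N) = - 1%:M by rewrite invmxN invmx1.
have inv2 : invmx (g 2%N) = invmx sg by [].
have inv3 : invmx (g 3%N) = - invmx sg by rewrite invmxN.
have a1 : linear_automorphisms h 1%:M by have [] := aut_subgroup h.
have gaut i : (i < 4)%N -> linear_automorphisms h (g i).
  by case: i => [|[|[|[|//]]]] _ //; exact: aut_opp.
have gcov w : 0 < peval h w ->
    exists2 i, (i < 4)%N & quad (invmx P *m (invmx (g i) *m w)).
  move=> /pos[] /(null_form_pos uP HN) [] q.
  - by exists 0%N => //; rewrite inv0 mul1mx.
  - by exists 1%N => //; rewrite inv1 mulNmx mul1mx.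
  - by exists 2%N.
  - by exists 3%N => //; rewrite inv3 mulNmx.
have qneg w : quad (invmx P *m w) -> N (invmx sg *m w) < 0.
  move=> q; apply: neg; first exact: (null_form_quad uP HN).
  by have [q0 q1] := q; rewrite -(mulKVmx uP w) hP; exact: nullq_gt0.
have qpos w : quad (invmx P *m w) -> 0 < N w by exact: (null_form_quad uP HN).
have NN w : N (- w) = N w by exact: (null_formN w uP HN).
have gdisj i j w : (i < 4)%N -> (j < 4)%N ->
    quad (invmx P *m (invmx (g i) *m w)) ->
    quad (invmx P *m (invmx (g j) *m w)) -> i = j.
  have pn (x : R) : 0 < x -> x < 0 -> False by move=> x0 /(lt_trans x0);
    rewrite ltxx.
  case: i j => [|[|[|[|//]]]] [|[|[|[|//]]]] _ _;
    rewrite ?inv0 ?inv1 ?inv2 ?inv3 ?mulNmx ?mul1mx => // q1 q2; exfalso.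
  - by move: q2; rewrite mulmxN => /(quad_opp q1).
  - by have := qneg _ q1; have := qpos _ q2; exact: pn.
  - by have := qneg _ q1; have := qpos _ q2; rewrite NN; exact: pn.
  - by move: q1; rewrite mulmxN => /(quad_opp q2).
  - by have := qneg _ q1; have := qpos _ q2; rewrite mulmxN NN; exact: pn.
  - by have := qneg _ q1; have := qpos _ q2; rewrite mulmxN !NN; exact: pn.
  - by have := qneg _ q2; have := qpos _ q1; exact: pn.
  - by have := qneg _ q2; have := qpos _ q1; rewrite mulmxN NN; exact: pn.
  - by move: q2; rewrite mulmxN => /(quad_opp q1).
  - by have := qneg _ q2; have := qpos _ q1; rewrite NN; exact: pn.
  - by have := qneg _ q2; have := qpos _ q1; rewrite mulmxN !NN; exact: pn.
  - by move: q1; rewrite mulmxN => /(quad_opp q2).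
split; first exact: (sector_components sec gaut gcov gdisj).
move=> A /(aut_decomposition sec gaut gcov) [i [B [ik rel ->]]]; exists B;
  split=> //.
move: ik; case: i => [|[|[|[|//]]]] _ /=.
- by constructor 1; rewrite mul1mx.
- by constructor 2; rewrite mulNmx mul1mx.
- by constructor 3.
- by constructor 4; rewrite mulNmx.
Qed.

End Automorphisms.

(** * Finite matrix groups and semidirect products *)

Section MatrixGroups.
Variable R : realType.
Local Notation M := 'M[R]_2.
Implicit Types (A B x y : M) (G H N : set M).

Lemma group_iso_range (T : zmodType) (f : T -> M) : f 0 = 1%:M ->
  (forall a b, f (a + b) = f a *m f b) -> (forall a, f a = 1%:M -> a = 0) ->
  group_iso f (range f).
Proof.
move=> f0 fD finj.
have fV a : f a *m f (- a) = 1%:M by rewrite -fD subrr.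
have fu a : f a \in unitmx by have [] := mulmx1_unit (fV a).
have fI a : invmx (f a) = f (- a).
  by apply: (can_inj (mulKmx (fu a))); rewrite fV mulmxV.
split=> //; last split.
- split.
  + by move=> _ [a _ <-]; exact: fu.
  + by exists 0.
  + by move=> _ _ [a _ <-] [b _ <-]; exists (a + b).
  + by move=> _ [a _ <-]; exists (- a).
- by move=> a _; exists a.
- move=> a b _ _ fab; apply/eqP; rewrite -subr_eq0; apply/eqP; apply: finj.
  by rewrite fD fab fV.
- by move=> _ [a _ <-]; exists a.
Qed.

Lemma expr_Zp n x (a b : 'I_n.+2) : x ^+ n.+2 = 1 ->
  x ^+ (a + b)%R = x ^+ a *m x ^+ b.
Proof. by move=> xn; rewrite /= expr_mod // exprD. Qed.

Lemma klein_iso x y G : x *m x = 1%:M -> y *m y = 1%:M -> x *m y = y *m x ->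
  x <> 1%:M -> y <> 1%:M -> x *m y <> 1%:M ->
  (forall A, G A <-> [\/ A = 1%:M, A = x, A = y | A = x *m y]) ->
  let f := fun p : 'Z_2 * 'Z_2 => x ^+ p.1 *m y ^+ p.2 in
  [/\ group_iso f G, f (1, 0) = x & f (0, 1) = y].
Proof.
move=> xx yy xy x1 y1 xy1 GE f.
have f00 : f (0, 0) = 1%:M by rewrite /f /= mul1mx.
have f10 : f (1, 0) = x by rewrite /f /= expr1 expr0 mulmx1.
have f01 : f (0, 1) = y by rewrite /f /= expr1 expr0 mul1mx.
have f11 : f (1, 1) = x *m y by rewrite /f /= !expr1.
split=> //.
have -> : G = range f.
  apply/seteqP; split=> [A /GE|_ [[i j] _ <-]].
    by case=> ->; [exists (0, 0)|exists (1, 0)|exists (0, 1)|exists (1, 1)].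
  apply/GE; move: i j; apply: ord2P; apply: ord2P;
    rewrite ?f00 ?f10 ?f01 ?f11;
      by [constructor 1|constructor 2|constructor 3|constructor 4].
apply: group_iso_range => //.
- move=> [i j] [i' j'].
  rewrite /f /= (@expr_Zp 0 x) ?expr2 // (@expr_Zp 0 y) ?expr2 //.
  have cxy : GRing.comm (y ^+ j) (x ^+ i').
    by apply: commrX; apply/commr_sym; apply: commrX.
  by rewrite -!mulmxA; congr (_ *m _); rewrite !mulmxA; congr (_ *m _);
    exact/esym.
- by move=> [i j]; move: i j; apply: ord2P; apply: ord2P;
  rewrite ?f00 ?f10 ?f01 ?f11.
Qed.

Lemma cyclic_iso n x : x ^+ n.+2 = 1 ->
  (forall i : nat, (0 < i < n.+2)%N -> x ^+ i <> 1) ->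
  group_iso (fun i : 'I_n.+2 => x ^+ i) [set x ^+ i | i in [set: 'I_n.+2]].
Proof.
move=> xn xi; apply: group_iso_range => [|a b|a xa]; first by rewrite expr0.
  exact: expr_Zp.
apply/val_inj; apply/eqP; apply: contrapT => /negP a0; apply: (xi a) => //.
by rewrite ltn_ord andbT lt0n.
Qed.

Definition setM N H : set M := [set A *m B | A in N & B in H].

Lemma subgroup_setM N H : subgroup N -> subgroup H ->
  (forall A B, H A -> N B -> N (A *m B *m invmx A)) -> subgroup (setM N H).
Proof.
move=> [Nu N1 NM NV] [Hu H1 HM HV] nor; split.
- by move=> _ [A NA [B HB <-]]; rewrite /= unitmx_mul (Nu _ NA) (Hu _ HB).
- by exists 1 => //; exists 1 => //; exact: mulmx1.
- move=> _ _ [A NA [B HB <-]] [A' NA' [B' HB' <-]].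
  have uB := Hu _ HB.
  exists (A *m (B *m A' *m invmx B)); first by apply: NM => //; exact: nor.
  exists (B *m B'); first exact: HM.
  by rewrite !mulmxA mulmxKV.
- move=> _ [A NA [B HB <-]]; have uB : B \in unitmx := Hu _ HB;
  have uA : A \in unitmx := Nu _ NA.
  exists (invmx B *m invmx A *m invmx (invmx B)); first by apply: nor;
    [exact: HV|exact: NV].
  exists (invmx B); first exact: HV.
  have uAB : A *m B \in unitmx by rewrite unitmx_mul uA.
  apply: (can_inj (mulKmx uAB)); rewrite mulmxV //.
  by rewrite invmxK -!mulmxA mulmxV // mulmx1 (mulmxA B) mulmxV // mul1mx
    mulmxV.
Qed.

Lemma sdprod_setM N H : subgroup N -> subgroup H ->
  (forall A B, H A -> N B -> N (A *m B *m invmx A)) ->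
  (forall A, N A -> H A -> A = 1) -> is_sdprod N H (setM N H).
Proof.
move=> sN sH nor tr; split=> //; first exact: subgroup_setM.
split=> //; apply/seteqP; split=> [A [NA HA]|_ ->]; first exact: tr.
by split; [case: sN|case: sH].
Qed.

Lemma turn2 (q : R) : q != 0 -> turn q *m turn q = - 1%:M.
Proof.
move=> q0; rewrite /turn mul_mx22 mx22_1 [RHS]mx22_eta !mxE /=.
by congr mx22; field.
Qed.

Lemma flip_turn (q : R) : flip_y R *m turn q = - (turn q *m flip_y R).
Proof.
rewrite /turn /flip_y !mul_mx22 [RHS]mx22_eta !mxE /=.
by congr mx22; ring.
Qed.

Lemma flip_y2 : flip_y R *m flip_y R = 1%:M.
Proof. by rewrite /flip_y mul_mx22 mx22_1; congr mx22; ring. Qed.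

Lemma flip_xE : flip_x R = - flip_y R.
Proof. by rewrite [RHS]mx22_eta !mxE /= !oppr0 opprK. Qed.

Definition turn_flips (q : R) : set M :=
  setM [set turn q ^+ i | i in [set: 'I_4]] [set flip_y R ^+ i | i in [set:
    'I_2]].

(** As [turn q] squares to -1, the eight elements take the shape in which [components4] lists
    automorphisms. *)
Lemma turn_flipsP q A : q != 0 -> turn_flips q A <->
  exists s : M, (s = 1%:M \/ s = flip_y R) /\
    [\/ A = s, A = - s, A = turn q *m s | A = - (turn q *m s)].
Proof.
move=> q0; have t2 : turn q ^+ 2 = -1 by rewrite expr2; exact: turn2.
have t3 : turn q ^+ 3 = - turn q by rewrite exprS t2 mulrN1.
split.
  move=> [_ [i _ <-] [_ [j _ <-] <-]]; exists (flip_y R ^+ j); split.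
    by move: j; apply: ord2P; [left; rewrite expr0|right; rewrite expr1].
  case: i => [[|[|[|[|//]]]] ?] /=; rewrite ?expr0 ?expr1 ?t2 ?t3.
  - by constructor 1; rewrite mul1mx.
  - by constructor 3.
  - by constructor 2; rewrite mulNmx mul1mx.
  - by constructor 4; rewrite mulNmx.
move=> [s [sE AE]].
have [j sj] : exists j : 'I_2, s = flip_y R ^+ j.
  by case: sE => ->; [exists 0; rewrite expr0|exists 1; rewrite expr1].
have E (i : 'I_4) B : turn q ^+ i *m flip_y R ^+ j = B -> turn_flips q B.
  by move=> <-; exists (turn q ^+ i);
    [exists i|exists (flip_y R ^+ j); [exists j|]].
subst s; case: AE => ->.
- by apply: (E (@Ordinal 4 0 isT)); rewrite /= mul1mx.
- by apply: (E (@Ordinal 4 2 isT)); rewrite /= t2 mulNmx mul1mx.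
- by apply: (E (@Ordinal 4 1 isT)).
- by apply: (E (@Ordinal 4 3 isT)); rewrite /= t3 mulNmx.
Qed.

(** The dihedral group of order 8: [flip_y] conjugates [turn q] into [- turn q], its inverse, so the
    cyclic subgroup is normal. Diagonal entries tell the powers apart. *)
Lemma turn_flip_group_turn_flips q : q != 0 -> turn_flip_group q (turn_flips q).
Proof.
move=> q0; have t2 : turn q ^+ 2 = -1 by rewrite expr2; exact: turn2.
have t3 : turn q ^+ 3 = - turn q by rewrite exprS t2 mulrN1.
have t4 : turn q ^+ 4 = 1 by rewrite (exprM _ 2 2) t2 sqrrN expr1n.
have f2 : flip_y R ^+ 2 = 1 by rewrite expr2; exact: flip_y2.
have e00 A B : A = B -> A 0 0 = B 0 0 by move=> ->.
have e11 A B : A = B -> A 1 1 = B 1 1 by move=> ->.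
have one0 : 1 <> 0 :> R by apply/eqP; exact: oner_neq0.
have one2 : - 1 <> 1 :> R by apply/eqP;
  rewrite lt_eqF // (lt_trans (ltrN10 R) (ltr01)).
have isoC : group_iso (fun i : 'Z_4 =>
  turn q ^+ i) [set turn q ^+ i | i in [set: 'I_4]].
  apply: (@cyclic_iso 2) => // -[|[|[|[|//]]]] //= _.
  - by rewrite expr1 => /e00; rewrite !mxE /= => /esym.
  - by rewrite t2 => /e00; rewrite !mxE /=.
  - by rewrite t3 => /e00; rewrite !mxE /= oppr0 => /esym.
have isoS : group_iso (fun i : 'Z_2 =>
  flip_y R ^+ i) [set flip_y R ^+ i | i in [set: 'I_2]].
  apply: (@cyclic_iso 0) => // -[|[|//]] //= _.
  by rewrite expr1 => /e11; rewrite !mxE /=.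
exists [set turn q ^+ i | i in [set: 'I_4]],
  [set flip_y R ^+ i | i in [set: 'I_2]].
split=> //.
have [sC _ _] := isoC; have [sS _ _] := isoS.
have [Cu C1 CM CV] := sC.
have uf : flip_y R \in unitmx by have [] := mulmx1_unit flip_y2.
have fI : invmx (flip_y R) = flip_y R.
  by apply: (can_inj (mulKmx uf)); rewrite mulmxV // flip_y2.
have Cf B : [set turn q ^+ i | i in [set: 'I_4]] B ->
    [set turn q ^+ i | i in [set: 'I_4]] (flip_y R *m B *m flip_y R).
  have ft : flip_y R *m turn q *m flip_y R = - turn q.
    by rewrite flip_turn mulNmx -mulmxA flip_y2 mulmx1.
  have f1 : flip_y R *m 1%:M *m flip_y R = 1%:M by rewrite mulmx1 flip_y2.
  move=> [[[|[|[|[|//]]]] ?] _ <-] /=;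
    rewrite ?expr0 ?expr1 ?t2 ?t3 ?mulmxN ?mulNmx.
  - by exists (@Ordinal 4 0 isT) => //=; rewrite expr0 f1.
  - by exists (@Ordinal 4 3 isT) => //=; rewrite t3 ft.
  - by exists (@Ordinal 4 2 isT) => //=; rewrite t2 f1.
  - by exists (@Ordinal 4 1 isT) => //=; rewrite expr1 ft opprK.
apply: sdprod_setM => //.
  move=> A B [i _ <-] CB; move: i; apply: ord2P; last by rewrite expr1 fI;
    exact: Cf.
  by rewrite expr0 invmx1 mul1mx mulmx1.
move=> _ [[[|[|[|[|//]]]] ?] _ <-] [i _] /=; move: i; apply: ord2P;
  rewrite ?expr0 ?expr1 ?t2 ?t3 //.
- by move=> /e00; rewrite !mxE /= => E; case: one0.
- by move=> /e00; rewrite !mxE /= => E; case: one2.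
- by move=> /e00; rewrite !mxE /= oppr0 => E; case: one0.
Qed.

End MatrixGroups.

(** * Automorphisms of the forms c and d *)

Section DiscreteForms.
Variable R : realType.
Local Notation V := 'cV[R]_2.
Local Notation M := 'M[R]_2.
Implicit Types (A B : M) (v w : V) (k K q : R).

Definition swap : M := mx22 0 1 1 0.

Definition formD k (w : V) : R := w 0 0 ^+ 2 - k * w 1 0 ^+ 2.

Lemma null_formD k : 0 < k -> null_form (formD k) (matD k).
Proof.
move=> k0 v; have l2 : Num.sqrt k ^+ 2 = k by rewrite sqr_sqrtr // ltW.
have l0 : 0 < Num.sqrt k by rewrite sqrtr_gt0.
rewrite /formD {1 2}(pt_eta v) mul_mx22_pt !ptE.
move: (v 0 0) (v 1 0) => x y.
have -> : (2 * Num.sqrt k)^-1 * x + - (2 * Num.sqrt k)^-1 * y =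
  (Num.sqrt k)^-1 * ((x - y) / 2) by field; rewrite gt_eqF.
by rewrite exprMn exprVn l2; field; rewrite gt_eqF.
Qed.

Lemma peval_formD k w :
  peval (std_poly 0 (k * (1 - k))) w = formD k w * formD (1 - k) w.
Proof. by rewrite peval_std /quart /formD; ring. Qed.

Lemma matD_unit k : 2^-1 <= k -> matD k \in unitmx.
Proof. by move=> /sectorD[]. Qed.

Lemma conj_eq (P A B : M) : P \in unitmx -> A *m P = P *m B ->
  P *m B *m invmx P = A.
Proof. by move=> uP <-; rewrite mulmxK. Qed.

Lemma conj_swap k : 2^-1 <= k -> matD k *m swap *m invmx (matD k) = flip_y R.
Proof.
move=> /matD_unit uP; apply: conj_eq => //.
by rewrite /flip_y /matD /swap !mul_mx22; congr mx22; ring.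
Qed.

Lemma aut_flip_y K : linear_automorphisms (std_poly 0 K) (flip_y R).
Proof.
split=> [|v].
  by rewrite unitmx22 det_mx22E mulr0 subr0 mulf_neq0 // ?oppr_eq0 oner_neq0.
by rewrite !peval_std mulmx_col2 [(flip_y R *m v) 1 0]mulmx_col2 !mx22E /quart;
  ring.
Qed.

Lemma aut_turn q K : q != 0 -> q ^+ 4 = K ->
  linear_automorphisms (std_poly 0 K) (turn q).
Proof.
move=> q0 <-; split=> [|v].
  rewrite unitmx22 det_mx22E mul0r sub0r (_ : - _ = 1); first exact: oner_neq0.
  by field.
by rewrite !peval_std mulmx_col2 [(turn q *m v) 1 0]mulmx_col2 !mx22E /quart;
  field.
Qed.

Lemma turn_unit q : q != 0 -> turn q \in unitmx.
Proof. by move=> q0; have [] := aut_turn q0 erefl. Qed.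

Lemma invmx_turn q : q != 0 -> invmx (turn q) = - turn q.
Proof.
move=> q0; apply: (can_inj (mulKmx (turn_unit q0))).
by rewrite mulmxV ?turn_unit // mulmxN turn2 // opprK.
Qed.

(** The turn exchanges the factors [x^2 - k y^2] and [x^2 - (1 - k) y^2] up to negative constants,
    so it relates the region where both are negative to the one where both are positive. *)
Lemma formD_turn k q w : q != 0 -> q ^+ 4 = k * (1 - k) ->
  formD k (invmx (turn q) *m w) = - (k / q ^+ 2) * formD (1 - k) w.
Proof.
move=> q0 q4; rewrite invmx_turn // mulNmx /formD.
have -> : (- (turn q *m w)) 0 0 = q * w 1 0.
  by rewrite mxE mulmx_col2 !mx22E; ring.
have -> : (- (turn q *m w)) 1 0 = - (q^-1 * w 0 0).
  by rewrite mxE mulmx_col2 !mx22E; ring.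
have -> : (q * w 1 0) ^+ 2 = q ^+ 4 * w 1 0 ^+ 2 / q ^+ 2 by field.
by rewrite q4; field.
Qed.

(** For [k >= 1/2], positivity of the first factor implies that of the second. The quartic is
    positive where both factors are positive or both negative, and the turn exchanges these regions.
    The value [k = 1/2] serves form a. *)
Lemma std_components4 k q : 2^-1 <= k -> 0 < k * (1 - k) -> q != 0 ->
  q ^+ 4 = k * (1 - k) ->
  let t := ((2 * k - 1) / (4 * k), (2 * k)^-1, (2 * k - 1) / (4 * k)) in
  equivalent_closed_components 4 (hyperbolic_locus (std_poly 0 (k * (1 - k))))
    /\
  forall A, linear_automorphisms (std_poly 0 (k * (1 - k))) A ->
  exists B, monomial_rel B t.1.1 t.1.2 t.2 t.1.1 t.1.2 t.2 /\
   [\/ A = matD k *m B *m invmx (matD k), A = - (matD k *m B *m invmx (matD k)),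
      A = turn q *m (matD k *m B *m invmx (matD k))
    | A = - (turn q *m (matD k *m B *m invmx (matD k)))].
Proof.
move=> k1 K0 q0 q4; have k0 : 0 < k by lra.
have q2 : 0 < q ^+ 2 by rewrite exprn_even_gt0.
have kq : - (k / q ^+ 2) < 0 by rewrite oppr_lt0 divr_gt0.
apply: (components4 (sectorD k1) (null_formD k0) (aut_turn q0 q4)) => w.
  move=> N0 _; rewrite formD_turn // nmulr_rlt0 //.
  by move: N0; rewrite /formD; have := sqr_ge0 (w 1 0); nra.
rewrite peval_formD formD_turn // (nmulr_rgt0 _ kq).
have [N0|N0] := ltrP 0 (formD k w); first by left.
move=> h0; right; move: N0; rewrite le_eqVlt => /orP[/eqP N0|N0].
  by rewrite N0 mul0r ltxx in h0.
by rewrite nmulr_rgt0 in h0.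
Qed.

Lemma monomial_stab_sym (al be : R) B : 0 < al ->
  monomial_rel B al be al al be al ->
  B = 1%:M \/ B = swap.
Proof.
move=> a0 [l [m [l0 m0 D]]].
have E : l ^+ 3 * m = 1 -> l * m ^+ 3 = 1 -> l = 1 /\ m = 1.
  move=> e1 e2.
  have n0 : l * m != 0 by rewrite mulf_neq0 // gt_eqF.
  have lm : l ^+ 2 = m ^+ 2.
    apply: (mulfI n0); rewrite (_ : l * m * l ^+ 2 = l ^+ 3 * m); last by ring.
    by rewrite e1 -e2; ring.
  have {}lm : l = m by apply/eqP; rewrite -(@eqrXn2 _ 2) ?lm // ltW.
  have : m ^+ 4 = 1 by rewrite -e2 lm; ring.
  by move/eqP; rewrite pexpr_eq1 // ?ltW // lm => /eqP ->.
have X (x : R) : al = x * al -> x = 1.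
  by move=> e; apply: (mulIf (lt0r_neq0 a0)); rewrite mul1r -e.
case: D => [[-> /X e1 _ /X e2]|[-> /X e2 _ /X e1]]; have [-> ->] := E e1 e2.
  by left; rewrite mx22_1.
by right.
Qed.

Lemma formD_coef k : 2^-1 < k -> 0 < (2 * k - 1) / (4 * k).
Proof. by move=> k1; rewrite divr_gt0; lra. Qed.

Lemma conj_stab k (al be : R) B : 2^-1 <= k -> 0 < al ->
  monomial_rel B al be al al be al ->
  matD k *m B *m invmx (matD k) = 1%:M \/ matD k *m B *m invmx (matD k) =
    flip_y R.
Proof.
move=> k1 a0 /(monomial_stab_sym a0) [] ->; last by right; exact: conj_swap.
by left; rewrite mulmx1 mulmxV // matD_unit.
Qed.

Lemma turn_flips_aut q K : q != 0 -> q ^+ 4 = K ->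
  turn_flips q `<=` linear_automorphisms (std_poly 0 K).
Proof.
move=> q0 q4 A /(turn_flipsP A q0) [s [sE AE]].
have hh := std_homog 0 K.
have [_ a1 aM _] := aut_subgroup (std_poly 0 K).
have as_ : linear_automorphisms (std_poly 0 K) s by case: sE => -> //;
  exact: aut_flip_y.
have ats := aM _ _ (aut_turn q0 q4) as_.
by case: AE => ->; rewrite ?mulNmx //; apply: aut_opp.
Qed.

Lemma formD_pos K (hK : K < 4^-1) : 0 < K ->
  equivalent_closed_components 4 (hyperbolic_locus (nf_poly (FormD hK))) /\
  turn_flip_group (K `^ 4^-1) (linear_automorphisms (nf_poly (FormD hK))).
Proof.
move=> K0 /=; pose q := K `^ 4^-1.
have q0 : q != 0 by rewrite gt_eqF // powR_gt0.
have q4 : q ^+ 4 = K by rewrite -powR_mulrn ?powR_ge0 // -powRrM mulVf ?powRr1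
  ?ltW.
have k1 := kap_gt hK; have kM := kapM hK.
have K'0 : 0 < kap K * (1 - kap K) by rewrite kM.
have q4' : q ^+ 4 = kap K * (1 - kap K) by rewrite kM.
have [Hc HA] := std_components4 (ltW k1) K'0 q0 q4'; rewrite kM in Hc HA.
split=> //; rewrite (_ : linear_automorphisms _ = turn_flips q).
  exact: turn_flip_group_turn_flips.
apply/seteqP; split; last exact: turn_flips_aut.
move=> A /HA [B [rel AE]]; apply/turn_flipsP => //.
exists (matD (kap K) *m B *m invmx (matD (kap K))); split=> //.
exact: conj_stab (ltW k1) (formD_coef k1) rel.
Qed.

Lemma formD_npos K (hK : K < 4^-1) : K <= 0 ->
  equivalent_closed_components 2 (hyperbolic_locus (nf_poly (FormD hK))) /\
  (exists f : ('Z_2 * 'Z_2)%type -> M,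
    [/\ group_iso f (linear_automorphisms (nf_poly (FormD hK))),
        f (1, 0) = flip_y R & f (0, 1) = flip_x R]).
Proof.
move=> K0; have k1 := kap_gt hK; have kM := kapM hK.
have k0 : 0 < kap K by lra.
(* With [kap K >= 1] the factor [x^2 - (1 - kap K) y^2] is never negative, so the positive region
   consists of one sector and its opposite. *)
have k2 : 1 <= kap K.
  by rewrite leNgt; apply/negP => k2; move: K0;
    rewrite -kM leNgt mulr_gt0 // subr_gt0.
have pos w : 0 < peval (nf_poly (FormD hK)) w -> 0 < formD (kap K) w.
  rewrite /= -{1}kM peval_formD => h0.
  have f2 : 0 <= formD (1 - kap K) w.
    by rewrite /formD; have := sqr_ge0 (w 0 0); have := sqr_ge0 (w 1 0); nra.
  by rewrite ltNge; apply/negP => f1; have := mulr_le0_ge0 f1 f2;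
    rewrite leNgt h0.
have [Hc HA] := components2 (nf_sector (FormD hK)) (null_formD k0) pos.
split=> //.
have fx2 : flip_x R *m flip_x R = 1%:M
  by rewrite flip_xE mulmxN mulNmx opprK flip_y2.
have one2 : - 1 <> 1 :> R by apply/eqP;
  rewrite lt_eqF // (lt_trans (ltrN10 R) (ltr01)).
have e00 (A B : M) : A = B -> A 0 0 = B 0 0 by move=> ->.
have e11 (A B : M) : A = B -> A 1 1 = B 1 1 by move=> ->.
have yx : flip_y R *m flip_x R = - 1%:M by rewrite flip_xE mulmxN flip_y2.
have [iso f10 f01] : let f := fun p : 'Z_2 * 'Z_2 =>
  flip_y R ^+ p.1 *m flip_x R ^+ p.2 in
    [/\ group_iso f (linear_automorphisms (nf_poly (FormD hK))),
        f (1, 0) = flip_y R & f (0, 1) = flip_x R].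
  apply: klein_iso => //.
  - exact: flip_y2.
  - by rewrite yx flip_xE mulNmx flip_y2.
  - by move/e11; rewrite !mxE.
  - by move/e00; rewrite !mxE.
  - by rewrite yx => /e00; rewrite !mxE.
  - move=> A; rewrite yx flip_xE; split.
      move=> /HA [B [rel AE]].
      have := conj_stab (ltW k1) (formD_coef k1) rel.
      by case: AE => -> [] /= ->;
        [constructor 1|constructor 2|constructor 4|constructor 3].
    have [_ a1 _ _] := aut_subgroup (nf_poly (FormD hK)).
    have ay := aut_flip_y K.
    have hh := std_homog 0 K.
    by case=> -> //; apply: aut_opp.
by exists (fun p : 'Z_2 * 'Z_2 => flip_y R ^+ p.1 *m flip_x R ^+ p.2).
Qed.

(* Exchanges the factors u and u + 2 v of u v^2 (u + 2 v). *)
Definition sigmaC : M := mx22 1 2 0 (- 1).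

(** The boundary lines are zeros of different multiplicity, so they cannot be exchanged; the two
    remaining equations then force both scalings to be 1. *)
Lemma formC_stab B : monomial_rel B 0 3^-1 (2 / 3) 0 3^-1 (2 / 3) ->
  B = 1%:M :> M.
Proof.
have t0 : 3^-1 != 0 :> R by rewrite gt_eqF // invr_gt0.
have t1 : 2 / 3 != 0 :> R by rewrite gt_eqF // divr_gt0.
move=> [l [m [l0 m0 [[-> _ eb ec]|[_ + _ _]]]]]; last first.
  by move/esym/eqP; rewrite mulf_eq0 (negPf t1) orbF gt_eqF // mulr_gt0 //
    exprn_gt0.
have {}eb : (l * m) ^+ 2 = 1 by apply: (mulIf t0); rewrite mul1r exprMn -eb.
have {}ec : l * m ^+ 3 = 1 by apply: (mulIf t1); rewrite mul1r -ec.
have lm : l * m = 1 by apply/eqP;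
  rewrite -(@pexpr_eq1 _ _ 2) ?eb // ltW // mulr_gt0.
have m1 : m = 1.
  apply/eqP; rewrite -(@pexpr_eq1 _ _ 2) ?ltW //
    -ec (_ : l * m ^+ 3 = l * m * m ^+ 2); last by ring.
  by rewrite lm mul1r.
by rewrite m1 mulr1 in lm; rewrite lm m1 mx22_1.
Qed.

(** In null coordinates the quartic is [u v^2 (u + 2 v) / 3]. It is positive where [u] and [u + 2 v]
    have the same sign and [v] is nonzero; the line [v = 0] halves each of these two regions, and
    [sigmaC] exchanges the halves. *)
Lemma formC_components :
  equivalent_closed_components 4 (hyperbolic_locus (nf_poly (@FormC R))) /\
  (exists f : ('Z_2 * 'Z_2)%type -> M,
     group_iso f (linear_automorphisms (nf_poly (@FormC R)))).
Proof.
have sec := nf_sector (@FormC R); have [uP gd hh hP] := sec.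
move: (nf_matrix FormC) uP sec hP => P uP sec hP.
move: (nf_poly FormC) sec hh hP => h sec hh hP.
have ss : sigmaC *m sigmaC = 1%:M by rewrite /sigmaC mul_mx22 mx22_1;
  congr mx22; ring.
pose sg := P *m sigmaC *m invmx P.
have sg2 : sg *m sg = 1%:M.
  by rewrite /sg !mulmxA mulmxKV // -(mulmxA P) ss mulmx1 mulmxV.
have usg : sg \in unitmx by have [] := mulmx1_unit sg2.
have isg : invmx sg = sg by apply: (can_inj (mulKmx usg)); rewrite mulmxV.
have sgP v : sg *m (P *m v) = P *m (sigmaC *m v) by rewrite /sg -!mulmxA mulKmx.
have asg : linear_automorphisms h sg.
  split=> // w; rewrite -(mulKVmx uP w) sgP !hP /=.
  by move: (invmx P *m w) => v; rewrite !mulmx_col2 !mx22E /nullq; field.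
pose N w := (invmx P *m w) 0 0 * (invmx P *m w) 1 0.
have HN : null_form N P by move=> v; rewrite /N mulKmx.
have [||Hc HA] := @components4 _ h P _ _ _ N sg sec HN asg.
- move=> w; rewrite isg -(mulKVmx uP w) sgP !HN.
  move: (invmx P *m w) => z; rewrite !mulmx_col2 !mx22E;
    move: (z 0 0) (z 1 0) => u v uv _.
  have -> : (1 * u + 2 * v) * (0 * u + -1 * v) = - (u * v) - 2 * v ^+ 2 by ring.
  by have := sqr_ge0 v; lra.
- move=> w; rewrite isg -(mulKVmx uP w) sgP !HN hP /nullq /=.
  move: (invmx P *m w) => z; rewrite !mulmx_col2 !mx22E;
    move: (z 0 0) (z 1 0) => u v.
  have -> : u * v * (0 * u ^+ 2 + 3^-1 * (u * v) + 2 / 3 * v ^+ 2) =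
     v ^+ 2 * (u * (u + 2 * v)) / 3 by field.
  have -> : (1 * u + 2 * v) * (0 * u + -1 * v) = - (u * v) - 2 * v ^+ 2 by ring.
  move=> H; have [uv|uv] := ltrP 0 (u * v); [by left|right].
  have {}H : 0 < v ^+ 2 * (u * (u + 2 * v)) by lra.
  have v2 : 0 < v ^+ 2.
    rewrite lt_def sqr_ge0 andbT; apply/eqP => v0;
      by rewrite v0 mul0r ltxx in H.
  rewrite pmulr_rgt0 // in H.
  rewrite ltNge; apply/negP => K0.
  (* Multiplying the positive [u (u + 2 v)] by this nonnegative number gives
     [u v (u + 2 v) ^ 2 <= 0]. Hence [v (u + 2 v) = 0], which contradicts positivity. *)
  have Y0 : 0 <= v * (u + 2 * v) by lra.
  have XY : u * (u + 2 * v) * (v * (u + 2 * v)) <= 0.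
    rewrite (_ : _ * _ = u * v * (u + 2 * v) ^+ 2); last by ring.
    by rewrite mulr_le0_ge0 // sqr_ge0.
  rewrite pmulr_rle0 // in XY.
  have /eqP : v * (u + 2 * v) = 0 by apply/eqP; rewrite eq_le XY.
  rewrite mulf_eq0 => /orP[] /eqP z0; first by rewrite z0 expr0n ltxx in v2.
  by rewrite z0 mulr0 ltxx in H.
split=> //.
have one2 : - 1 <> 1 :> R by apply/eqP;
  rewrite lt_eqF // (lt_trans (ltrN10 R) (ltr01)).
have e00 (A B : M) : A = B -> A 0 0 = B 0 0 by move=> ->.
have e11 (A B : M) : A = B -> A 1 1 = B 1 1 by move=> ->.
exists (fun p : 'Z_2 * 'Z_2 => sg ^+ p.1 *m (- 1%:M) ^+ p.2).
have sgE : invmx P *m sg *m P = sigmaC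
  by rewrite /sg !mulmxA mulVmx // mul1mx mulmxKV.
apply: (_ : _ -> _) (@klein_iso _ sg (- 1%:M) (linear_automorphisms h) _ _ _ _
  _ _ _).
  by case.
- exact: sg2.
- by rewrite mulmxN mulNmx opprK mulmx1.
- by rewrite mulmxN mulNmx mulmx1 mul1mx.
- move=> s1; move: sgE; rewrite s1 mulmx1 mulVmx // => /e11.
  by rewrite !mxE /= => /esym.
- by move/e00; rewrite !mxE.
- move=> s1; have {}s1 : sg = - 1%:M by rewrite -s1 mulmxN mulmx1 opprK.
  move: sgE; rewrite s1 mulmxN mulNmx mulmx1 mulVmx // => /e00.
  by rewrite !mxE.
- move=> A; rewrite mulmxN mulmx1; split.
    move=> /HA [B [/formC_stab -> AE]]; rewrite mulmx1 mulmxV // mulmx1 in AE.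
    by case: AE => ->; [constructor 1|constructor 3|constructor 2|constructor
      4].
  by have [_ a1 _ _] := aut_subgroup h; case=> -> //; apply: aut_opp.
Qed.

End DiscreteForms.

(** * Automorphisms of form a: hyperbolic rotations and a dihedral group *)

Section FormA.
Variable R : realType.
Local Notation V := 'cV[R]_2.
Local Notation M := 'M[R]_2.
Implicit Types (A B : M) (x y t : R).

Definition rot x y : M := mx22 x (y / 2) y x.

Local Notation rotations := (hyperbolic_rotations (mx22 1 0 0 (- 2^-1 : R))).

Lemma mul_rot x y x' y' :
  rot x y *m rot x' y' = rot (x * x' + y * y' / 2) (x * y' + y * x').
Proof. by rewrite /rot mul_mx22; congr mx22; field. Qed.

(** The image [(x, y)] of the first basis vector determines the isometry: orthogonality and
    determinant 1 fix the second column. *)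
Lemma rotationsP A : rotations A <->
  exists x y, [/\ A = rot x y, x ^+ 2 - y ^+ 2 / 2 = 1 & 0 < x].
Proof.
split=> [[]|[x [y [-> E x0]]]]; last first.
  split; last by rewrite !mxE.
    have -> : (rot x y)^T = mx22 x y (y / 2) x.
      by rewrite [LHS]mx22_eta !mxE.
    rewrite /rot !mul_mx22.
    transitivity (mx22 (x ^+ 2 - y ^+ 2 / 2) 0 0
      (- 2^-1 * (x ^+ 2 - y ^+ 2 / 2))).
      by congr mx22; field.
    by rewrite E mulr1.
  by rewrite det_mx22E (_ : _ - _ = x ^+ 2 - y ^+ 2 / 2) //; field.
rewrite (mx22_eta A); move: (A 0 0) (A 0 1) (A 1 0) (A 1 1) => a b c d {A}.
have -> : (mx22 a b c d)^T = mx22 a c b d by rewrite [LHS]mx22_eta !mxE.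
rewrite !mul_mx22 det_mx22E mxE /= => E dt a0.
have e00 : a ^+ 2 - c ^+ 2 / 2 = 1.
  by have := congr1 (fun M : M => M 0 0) E; rewrite !mx22E => EE;
    apply: etrans EE; field.
have e01 : a * b - c * d / 2 = 0.
  by have := congr1 (fun M : M => M 0 1) E; rewrite !mx22E => EE;
    apply: etrans EE; field.
have db : d = a.
  transitivity ((a ^+ 2 - c ^+ 2 / 2) * d); first by rewrite e00 mul1r.
  transitivity (a * (a * d - b * c)); last by rewrite dt mulr1.
  have -> : (a ^+ 2 - c ^+ 2 / 2) * d =
    a * (a * d - b * c) + c * (a * b - c * d / 2) by field.
  by rewrite e01 mulr0 addr0.
exists a, c; split=> //; rewrite /rot db; congr mx22.
apply: (mulfI (lt0r_neq0 a0)); apply/eqP; rewrite -subr_eq0; apply/eqP.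
by apply: etrans e01; rewrite db; field.
Qed.

(** The rotation with [x = cosh t] and [y = sqrt 2 sinh t], normalised so that [x + y / sqrt 2] is
    [expR t] and [x - y / sqrt 2] is [expR (- t)]; the parameter is recovered as a logarithm. *)
Definition hyp_flow t : M :=
  rot ((expR t + expR (- t)) / 2) ((expR t - expR (- t)) / Num.sqrt 2).

Lemma hyp_flow_continuous : continuous hyp_flow.
Proof.
have ce : continuous (fun t : R => expR (- t)).
  move=> t; apply: (@continuous_comp _ _ _ -%R expR);
    first exact: opp_continuous.
  exact: continuous_expR.
have cx : continuous (fun t : R => (expR t + expR (- t)) / 2).
  move=> t; apply: cvgM; last exact: cvg_cst.
  by apply: cvgD; [exact: continuous_expR|exact: ce].
have cy : continuous (fun t : R => (expR t - expR (- t)) / Num.sqrt 2).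
  move=> t; apply: cvgM; last exact: cvg_cst.
  by apply: cvgB; [exact: continuous_expR|exact: ce].
move=> t; apply: (@cvg_mx _ _ (nbhs t)).
apply: ord2P; apply: ord2P; under eq_fun do rewrite !mx22E; rewrite !mx22E.
- exact: cx.
- by apply: cvgM; [exact: cy|exact: cvg_cst].
- exact: cy.
- exact: cx.
Qed.

Lemma hyp_flow_iso : group_iso hyp_flow rotations.
Proof.
have s0 : 0 < Num.sqrt 2 :> R by rewrite sqrtr_gt0.
have s2 : Num.sqrt 2 ^+ 2 = 2 :> R by rewrite sqr_sqrtr.
have -> : rotations = range hyp_flow.
  apply/seteqP; split=> [A /rotationsP [x [y [-> E x0]]]|_ [t _ <-]];
    last first.
    apply/rotationsP; eexists _, _; split; first by [].
      have -> : ((expR t + expR (- t)) / 2) ^+ 2 -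
          ((expR t - expR (- t)) / Num.sqrt 2) ^+ 2 / 2 =
        (expR t + expR (- t)) ^+ 2 / 4 -
          (expR t - expR (- t)) ^+ 2 / (2 * Num.sqrt 2 ^+ 2).
        by field; rewrite gt_eqF.
      rewrite s2 (_ : _ - _ = expR t * expR (- t)); last by field.
      exact: expRxMexpNx_1.
    by rewrite divr_gt0 // addr_gt0 // expR_gt0.
  have F : (x + y / Num.sqrt 2) * (x - y / Num.sqrt 2) = 1.
    rewrite (_ : _ * _ = x ^+ 2 - y ^+ 2 / Num.sqrt 2 ^+ 2); first
      by rewrite s2.
    by field; rewrite gt_eqF.
  have p0 : 0 < x + y / Num.sqrt 2.
    rewrite ltNge; apply/negP => p0.
    have : 0 < x - y / Num.sqrt 2 by lra.
    by move=> q0; have := mulr_le0_ge0 p0 (ltW q0); rewrite F leNgt ltr01.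
  exists (ln (x + y / Num.sqrt 2)) => //.
  have e1 : expR (ln (x + y / Num.sqrt 2)) = x + y / Num.sqrt 2
    by rewrite lnK // posrE.
  have e2 : expR (- ln (x + y / Num.sqrt 2)) = x - y / Num.sqrt 2.
    rewrite expRN e1; apply: (mulfI (lt0r_neq0 p0)).
    by rewrite divff ?F // gt_eqF.
  rewrite /hyp_flow e1 e2; congr rot; first by field; rewrite gt_eqF.
  rewrite (_ : _ / _ = 2 * y / Num.sqrt 2 ^+ 2); first by rewrite s2; field.
  by field; rewrite gt_eqF.
apply: group_iso_range => [|s t|t].
- by rewrite /hyp_flow oppr0 expR0 subrr mul0r /rot mul0r mx22_1; congr mx22;
  field.
- rewrite /hyp_flow mul_rot opprD !expRD; congr rot.
    move: (expR s) (expR (- s)) (expR t) (expR (- t)) => a b c d.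
    have -> : (a - b) / Num.sqrt 2 * ((c - d) / Num.sqrt 2) / 2 =
      (a - b) * (c - d) / (2 * Num.sqrt 2 ^+ 2) by field; rewrite gt_eqF.
    by rewrite s2; field.
  by field; rewrite gt_eqF.
- rewrite mx22_1 => E.
  have e0 : (expR t + expR (- t)) / 2 = 1.
    by have := congr1 (fun M : M => M 0 0) E; rewrite !mx22E.
  have e1 : (expR t - expR (- t)) / Num.sqrt 2 = 0.
    by have := congr1 (fun M : M => M 1 0) E; rewrite !mx22E.
  move/eqP: e1; rewrite mulf_eq0 invr_eq0 (gt_eqF s0) orbF subr_eq0 => /eqP e1.
  apply: expR_inj; rewrite expR0; lra.
Qed.

Lemma flip_rot x y : flip_y R *m rot x y = rot x (- y) *m flip_y R.
Proof. by rewrite /flip_y /rot !mul_mx22; congr mx22; field. Qed.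

Let q : R := (Num.sqrt 2)^-1.

Let q_neq0 : q != 0. Proof. by rewrite invr_eq0 gt_eqF // sqrtr_gt0. Qed.

Let q2 : q ^+ 2 = 2^-1. Proof. by rewrite exprVn sqr_sqrtr. Qed.

Lemma turn_rot x y : turn q *m rot x y = rot x (- y) *m turn q.
Proof.
have qV : q = (2 * q)^-1.
  by apply: (mulfI q_neq0); rewrite -expr2 q2; field; exact: q_neq0.
rewrite /turn /rot !mul_mx22; congr mx22;
  rewrite ?mul0r ?mulr0 ?addr0 ?add0r //.
- by rewrite {1}qV; field; exact: q_neq0.
- by ring.
- by ring.
- by rewrite {2}qV; field; exact: q_neq0.
Qed.

Let normalizes A := forall B, rotations B ->
  exists2 B', rotations B' & A *m B = B' *m A.

(** Both generators conjugate [rot x y] into [rot x (- y)], and normalising passes to products and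
    negatives. *)
Lemma turn_flips_normalize A B : turn_flips q A -> rotations B ->
  exists2 B', rotations B' & A *m B = B' *m A.
Proof.
have nM C D : normalizes C -> normalizes D -> normalizes (C *m D).
  move=> nC nD E /nD [E' /nC [E'' rE e1] e2]; exists E'' => //.
  by rewrite -mulmxA e2 mulmxA e1 mulmxA.
have nN C : normalizes C -> normalizes (- C).
  by move=> nC E /nC [E' rE e]; exists E' => //; rewrite mulNmx mulmxN e.
have nR C : (forall x y, C *m rot x y = rot x (- y) *m C) -> normalizes C.
  move=> HC E /rotationsP [x [y [-> e x0]]]; exists (rot x (- y));
    last exact: HC.
  by apply/rotationsP; exists x, (- y); rewrite sqrrN.
have n1 : normalizes 1%:M by move=> E rE; exists E => //; rewrite mul1mx mulmx1.
have nf := nR _ flip_rot; have nt := nR _ turn_rot.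
move=> /(turn_flipsP _ q_neq0) [s [sE AE]].
have ns : normalizes s by case: sE => ->.
have nts := nM _ _ nt ns.
have nA : normalizes A by case: AE => -> //; exact: nN.
exact: nA.
Qed.

Lemma turn_flips_subgroup : subgroup (turn_flips q).
Proof. by have [C [S [_ _ []]]] := turn_flip_group_turn_flips q_neq0. Qed.

(** A rotation has two positive diagonal entries; every element of the dihedral group other than 1
    has a diagonal entry that is not positive. *)
Lemma rotations_turn_flips A : rotations A -> turn_flips q A -> A = 1.
Proof.
move=> /rotationsP [x [y [AE _ x0]]] /(turn_flipsP _ q_neq0) [s [sE]].
have a0 : 0 < A 0 0 by rewrite AE mxE.
have a1 : 0 < A 1 1 by rewrite AE mxE.
have n1 : 0 < - (1 : R) = false by rewrite oppr_gt0 ltr10.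
case: sE => -> [] E; move: a0 a1; rewrite E ?mulmx1 //.
- by rewrite !mxE /= n1.
- by rewrite !mxE /= ltxx.
- by rewrite !mxE /= oppr0 ltxx.
- by rewrite !mxE /= n1.
- by rewrite !mxE /= n1.
- by rewrite /turn /flip_y mul_mx22 !mxE /= mulr0 mul0r addr0 ltxx.
- by rewrite /turn /flip_y mul_mx22 !mxE /= mulr0 mul0r addr0 oppr0 ltxx.
Qed.

Lemma rotations_aut A : rotations A ->
  linear_automorphisms (nf_poly (@FormA R)) A.
Proof.
move=> /rotationsP [x [y [-> E x0]]]; split=> [|v].
  rewrite unitmx22 det_mx22E (_ : _ - _ = x ^+ 2 - y ^+ 2 / 2); last by field.
  by rewrite E oner_neq0.
have P w : peval (std_poly 0 4^-1) w = formD 2^-1 w ^+ 2.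
  by rewrite peval_std /formD /quart; field.
rewrite /= !P; congr (_ ^+ 2); rewrite /formD !mulmx_col2 !mx22E.

transitivity ((x ^+ 2 - y ^+ 2 / 2) * (v 0 0 ^+ 2 - 2^-1 * v 1 0 ^+ 2)); first
  by field.
by rewrite E mul1r.
Qed.

(** In null coordinates, the light-cone coordinates of the Minkowski product, a rotation is a
    diagonal matrix of determinant 1. *)
Lemma conj_diag (l m : R) : 0 < l -> 0 < m -> l * m = 1 ->
  rotations (matD 2^-1 *m mx22 l 0 0 m *m invmx (matD 2^-1)).
Proof.
move=> l0 m0 lm; pose r : R := (2 * Num.sqrt 2^-1)^-1.
have r0 : 0 < r by rewrite invr_gt0 mulr_gt0 // sqrtr_gt0 invr_gt0.
have r2 : r ^+ 2 = 2^-1 by rewrite exprVn exprMn sqr_sqrtr ?invr_ge0 //; field.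
apply/rotationsP; exists ((l + m) / 2), ((l - m) / (2 * r)); split.
- apply: conj_eq; first exact: matD_unit.
  rewrite /rot /matD -/r !mul_mx22; congr mx22.
  + by field; rewrite gt_eqF.
  + by field; rewrite gt_eqF.
  + have -> : (l - m) / (2 * r) = (l - m) * r / (2 * r ^+ 2) by field;
    rewrite gt_eqF.
    by rewrite r2; field.
  + have -> : (l - m) / (2 * r) = (l - m) * r / (2 * r ^+ 2) by field;
    rewrite gt_eqF.
    by rewrite r2; field.
- have -> : ((l - m) / (2 * r)) ^+ 2 = (l - m) ^+ 2 / (4 * r ^+ 2) by field;
  rewrite gt_eqF.
  by rewrite r2; apply: etrans lm; field.
- by rewrite divr_gt0 // addr_gt0.
Qed.

(** With both outer coefficients zero only [l m = 1] remains, a one-parameter group; exchanging the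
    null coordinates is [flip_y]. *)
Lemma formA_stab B : monomial_rel B 0 1 0 0 1 0 ->
  exists n s : M, [/\ rotations n, s = 1%:M \/ s = flip_y R &
    matD 2^-1 *m B *m invmx (matD 2^-1) = n *m s].
Proof.
have uP : matD (2^-1 : R) \in unitmx by exact: matD_unit.
move=> [l [m [l0 m0 D]]].
have lm : l * m = 1.
  apply/eqP; rewrite -(@pexpr_eq1 _ _ 2) ?ltW ?mulr_gt0 // exprMn.
  by case: D => [[_ _ -> _]|[_ _ -> _]]; rewrite mulr1.
exists (matD 2^-1 *m mx22 l 0 0 m *m invmx (matD 2^-1)).
have rn := conj_diag l0 m0 lm.
case: D => [[-> _ _ _]|[-> _ _ _]].
  by exists 1%:M; split=> //; [left|rewrite mulmx1].
exists (flip_y R); split=> //; first by right.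
rewrite -(conj_swap (lexx 2^-1)) !mulmxA mulmxKV //; congr (_ *m _).
by rewrite -mulmxA; congr (_ *m _); rewrite /swap mul_mx22; congr mx22; ring.
Qed.

Lemma formA_components : equivalent_closed_components 4
    (hyperbolic_locus (nf_poly (@FormA R))) /\
  (exists N D : set M,
    [/\ N = hyperbolic_rotations (mx22 1 0 0 (- 2^-1)),
        (exists2 f : R -> M, continuous f & group_iso f N),
        turn_flip_group (Num.sqrt 2)^-1 D
      & is_sdprod N D (linear_automorphisms (nf_poly (@FormA R)))]).
Proof.
have kk : 2^-1 * (1 - 2^-1) = 4^-1 :> R by field.
have K0 : 0 < 2^-1 * (1 - 2^-1) :> R by rewrite kk invr_gt0.
have q4 : q ^+ 4 = 2^-1 * (1 - 2^-1) by rewrite (exprM _ 2 2) q2; field.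
have [Hc HA] := std_components4 (lexx 2^-1) K0 q_neq0 q4.
rewrite kk in Hc HA; split=> //.
exists rotations, (turn_flips q); split=> //.
- by exists hyp_flow; [exact: hyp_flow_continuous|exact: hyp_flow_iso].
- exact: turn_flip_group_turn_flips.
have [sN _ _] := hyp_flow_iso.
have asub := aut_subgroup (nf_poly (@FormA R)).
split=> //.
- exact: turn_flips_subgroup.
- move=> A B dA /(turn_flips_normalize dA) [B' rB' ->].
  by have [Du _ _ _] := turn_flips_subgroup; rewrite mulmxK //; exact: Du.
split.
  apply/seteqP; split=> [A [nA dA]|_ ->]; first exact: rotations_turn_flips.
  by split; [case: sN|case: turn_flips_subgroup].
apply/seteqP; split=> [A /HA [B [rel AE]]|_ [A nA [B dB <-]]]; last first.
  have [_ _ aM _] := asub; apply: aM; first exact: rotations_aut.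
  by apply: turn_flips_aut dB; rewrite // q4.
have {}rel : monomial_rel B 0 1 0 0 1 0.
  by move: rel => /=; rewrite divff // subrr mul0r invr1.
have [n [s [rn sE nE]]] := formA_stab rel.
rewrite nE in AE.
have tfs C : [\/ C = s, C = - s, C = turn q *m s | C = - (turn q *m s)] ->
  turn_flips q C.
  by move=> CE; apply/turn_flipsP => //; exists s.
have tt : turn_flips q (turn q).
  by apply/turn_flipsP => //; exists 1%:M; split;
    [left|constructor 3; rewrite mulmx1].
(* In the two cases with a turn the rotation has to be moved in front of it. *)
have [n' rn' n'E] := turn_flips_normalize tt rn.
case: AE => ->.
- by exists n => //; exists s => //; apply: tfs; constructor 1.
- by exists n => //; exists (- s); [apply: tfs; constructor 2|rewrite mulmxN].
- exists n' => //; exists (turn q *m s); first by apply: tfs; constructor 3.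
  by rewrite !mulmxA n'E.
- exists n' => //; exists (- (turn q *m s)); first by apply: tfs; constructor 4.
  by rewrite mulmxN !mulmxA n'E.
Qed.

End FormA.

(** * Automorphisms of form b: the exponential flow and the sign *)

Section FormB.
Variable R : realType.
Local Notation V := 'cV[R]_2.
Local Notation M := 'M[R]_2.
Implicit Types (A B P Q : M) (a b l m s t : R).

Local Notation P := (matB R).

Lemma matB_unit : P \in unitmx.
Proof. by case: (sectorB R). Qed.

Lemma sqrt3_sqrt2 : Num.sqrt 3 / Num.sqrt 2 = Num.sqrt 6 / 2 :> R.
Proof.
have s0 : 0 < Num.sqrt 2 :> R by rewrite sqrtr_gt0.
have s2 : Num.sqrt 2 ^+ 2 = 2 :> R by rewrite sqr_sqrtr.
transitivity (Num.sqrt 3 * Num.sqrt 2 / Num.sqrt 2 ^+ 2 : R).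
  by field; rewrite gt_eqF.
by rewrite s2 sqrt6E (mulrC (Num.sqrt 2)).
Qed.

Lemma invmx_matB : invmx P =
  mx22 4^-1 (3 / (4 * Num.sqrt 6)) (Num.sqrt 3 / (2 * Num.sqrt 2)) (- 4^-1).
Proof.
have w0 : 0 < Num.sqrt 6 :> R by rewrite sqrtr_gt0.
have w2 : Num.sqrt 6 ^+ 2 = 6 :> R by rewrite sqr_sqrtr.
have -> : Num.sqrt 3 / (2 * Num.sqrt 2) = Num.sqrt 6 / 4 :> R.
  transitivity (Num.sqrt 3 / Num.sqrt 2 / 2 : R).
    by field; rewrite gt_eqF // sqrtr_gt0.
  by rewrite sqrt3_sqrt2; field.
apply: (can_inj (mulKmx matB_unit)); rewrite mulmxV ?matB_unit //.
rewrite /matB mul_mx22 mx22_1; move: (Num.sqrt 6) w0 w2 => w w0 w2; congr mx22.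
- by transitivity (4^-1 + w ^+ 2 / 8); [rewrite w2; field|field].
- transitivity (3 / (4 * w) - w ^+ 2 / (8 * w)); last by field; rewrite gt_eqF.
  by rewrite w2; field; rewrite gt_eqF.
- by field.
- by field; rewrite gt_eqF.
Qed.

Lemma flow_bE t : flow_b t =
  P *m mx22 (expR (Num.sqrt 3 * t)) 0 0 (expR (- (t / Num.sqrt 3))) *m invmx P.
Proof. by rewrite invmx_matB /flow_b /matB sqrt3_sqrt2. Qed.

Lemma generator_bE : generator_b R =
  P *m mx22 (Num.sqrt 3) 0 0 (- (Num.sqrt 3)^-1) *m invmx P.
Proof.
symmetry; apply: conj_eq; first exact: matB_unit.
have s0 : 0 < Num.sqrt 3 :> R by rewrite sqrtr_gt0.
have s2 : Num.sqrt 3 ^+ 2 = 3 :> R by rewrite sqr_sqrtr.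
have r0 : 0 < Num.sqrt 2 :> R by rewrite sqrtr_gt0.
have r2 : Num.sqrt 2 ^+ 2 = 2 :> R by rewrite sqr_sqrtr.
have -> : generator_b R = mx22 0 (Num.sqrt 2 / 2) (Num.sqrt 2) (2 / Num.sqrt 3).
  rewrite [LHS]mx22_eta !mxE /=; congr mx22; first by rewrite mulr0.
  - by rewrite mulr1.
  - by rewrite mulrA -expr2 r2.
rewrite /matB sqrt6E !mul_mx22.
move: (Num.sqrt 3) s0 s2 (Num.sqrt 2) r0 r2 => s s0 s2 r r0 r2; congr mx22.
- by transitivity (r ^+ 2 * s / 2); [field|rewrite r2; field].
- by transitivity (- r / 2); [field|field; rewrite gt_eqF].
- transitivity (r + 2 * r); first by field; rewrite gt_eqF.
  by transitivity (r * s ^+ 2); [rewrite s2; ring|ring].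
- transitivity (r ^+ 2 * s / 2 - 2 / s); first by field; rewrite gt_eqF.
  transitivity ((s ^+ 2 - 2) / s); first by rewrite r2; field; rewrite gt_eqF.
  by rewrite s2; field; rewrite gt_eqF.
Qed.

Lemma mx22_diagX a b n : mx22 a 0 0 b ^+ n = mx22 (a ^+ n) 0 0 (b ^+ n).
Proof.
elim: n => [|n IH]; first by rewrite !expr0 mx22_1R.
rewrite exprS IH [LHS]mul_mx22 !exprS; congr mx22; ring.
Qed.

Lemma conjX (Q D : M) n : Q \in unitmx ->
  (Q *m D *m invmx Q) ^+ n = Q *m D ^+ n *m invmx Q.
Proof.
move=> uQ; elim: n => [|n IH]; first by rewrite !expr0 mulmx1 mulmxV.
rewrite !exprS IH -[LHS]/(_ *m _) -[D * _]/(_ *m _).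
by rewrite !mulmxA mulmxKV.
Qed.

Lemma series_conj_diag (Q : M) a b n : Q \in unitmx ->
  series (fun k => (k`!%:R)^-1 *: (Q *m mx22 a 0 0 b *m invmx Q) ^+ k) n =
  Q *m mx22 (series (exp_coeff a) n) 0 0 (series (exp_coeff b) n) *m invmx Q.
Proof.
move=> uQ; rewrite /series /=; elim: n => [|n IH].
  by rewrite !big_geq // [mx22 _ _ _ _](_ : _ = 0) ?mulmx0 ?mul0mx //;
     apply/matrixP => i j; rewrite !mxE; case: ifP; case: ifP.
rewrite !big_nat_recr //= IH conjX // mx22_diagX scalemxAl scalemxAr -mulmxDl
  -mulmxDr.
congr (_ *m _ *m _); rewrite [LHS]mx22_eta !mxE /= /exp_coeff /=.
by congr mx22; rewrite ?mulr0 ?addr0 //; congr (_ + _); rewrite mulrC.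
Qed.

Lemma mxexp_conj_diag (Q : M) a b : Q \in unitmx ->
  mxexp (Q *m mx22 a 0 0 b *m invmx Q) =
    Q *m mx22 (expR a) 0 0 (expR b) *m invmx Q.
Proof.
move=> uQ; apply: cvg_lim => //.
rewrite (_ : series _ = fun n =>
    Q *m mx22 (series (exp_coeff a) n) 0 0 (series (exp_coeff b) n) *m
      invmx Q); last first.
  by apply/funext => n; exact: series_conj_diag.
(* The conjugated matrix is linear in the two eigenvalues, which reduces the matrix limit to two
   scalar exponential series. *)
have entry x y : Q *m mx22 x 0 0 y *m invmx Q =
    x *: (Q *m mx22 1 0 0 0 *m invmx Q) + y *: (Q *m mx22 0 0 0 1 *m invmx Q).
  have L z (E : M) : z *: (Q *m E *m invmx Q) = Q *m (z *: E) *m invmx Q.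
    by rewrite scalemxAl scalemxAr.
  rewrite !L -mulmxDl -mulmxDr; congr (_ *m _ *m _).
  by rewrite [RHS]mx22_eta !mxE /=; congr mx22; ring.
rewrite entry; under eq_fun do rewrite entry.
have ce (x : R) : series (exp_coeff x) @ \oo --> expR x
  by exact: is_cvg_series_exp_coeff.
by apply: cvgD; apply: cvgZl; exact: ce.
Qed.

Lemma mxexp_flow_b t : mxexp (t *: generator_b R) = flow_b t.
Proof.
rewrite generator_bE flow_bE scalemxAl scalemxAr.
have -> : t *: mx22 (Num.sqrt 3) 0 0 (- (Num.sqrt 3)^-1) =
    mx22 (Num.sqrt 3 * t) 0 0 (- (t / Num.sqrt 3)) :> M.
  by rewrite [LHS]mx22_eta !mxE /=; congr mx22; ring.
by rewrite mxexp_conj_diag // matB_unit.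
Qed.

Let c : R := 64 * Num.sqrt 6 / 9.

Let c0 : 0 < c. Proof. by rewrite divr_gt0 ?mulr_gt0 ?sqrtr_gt0. Qed.

(** The quartic is [c x y^3] in null coordinates, so invariance means [l m^3 = 1]; the exponents
    satisfy [sqrt 3 - 3 / sqrt 3 = 0]. *)
Lemma flow_b_rel t : monomial_rel
  (mx22 (expR (Num.sqrt 3 * t)) 0 0 (expR (- (t / Num.sqrt 3)))) 0 0 c 0 0 c.
Proof.
exists (expR (Num.sqrt 3 * t)), (expR (- (t / Num.sqrt 3))); split;
  rewrite ?expR_gt0 //.
left; split; rewrite ?mulr0 // -expRM_natl -expRD.
have s2 : Num.sqrt 3 ^+ 2 = 3 :> R by rewrite sqr_sqrtr.
have s0 : 0 < Num.sqrt 3 :> R by rewrite sqrtr_gt0.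
rewrite (_ : _ + _ = (Num.sqrt 3 ^+ 2 - 3) / Num.sqrt 3 * t); last first.
  by field; rewrite gt_eqF.
by rewrite s2 subrr !mul0r expR0 mul1r.
Qed.

Lemma relB_flow B : monomial_rel B 0 0 c 0 0 c ->
  exists t, B = mx22 (expR (Num.sqrt 3 * t)) 0 0 (expR (- (t / Num.sqrt 3))).
Proof.
have s2 : Num.sqrt 3 ^+ 2 = 3 :> R by rewrite sqr_sqrtr.
have s0 : 0 < Num.sqrt 3 :> R by rewrite sqrtr_gt0.
move=> [l [m [l0 m0 [[-> _ _ e]|[_ /esym/eqP + _ _]]]]]; last first.
  by rewrite mulf_eq0 (gt_eqF c0) orbF gt_eqF // mulr_gt0 // exprn_gt0.
have {}e : l * m ^+ 3 = 1 by apply: (mulIf (lt0r_neq0 c0)); rewrite mul1r -e.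
(* Solves [expR (- (t / sqrt 3)) = m]; the other diagonal entry then follows from [l m^3 = 1]. *)
exists (- (Num.sqrt 3 * ln m)).
have -> : - (- (Num.sqrt 3 * ln m) / Num.sqrt 3) = ln m by field;
  rewrite gt_eqF.
have -> : Num.sqrt 3 * - (Num.sqrt 3 * ln m) = - (3 * ln m).
  by transitivity (- (Num.sqrt 3 ^+ 2 * ln m)); [ring|rewrite s2].
rewrite lnK ?posrE // expRN expRM_natl lnK ?posrE //; congr mx22.
have m3 : m ^+ 3 != 0 by rewrite expf_neq0 // gt_eqF.
by apply: (mulIf m3); rewrite e mulVf.
Qed.

Lemma flow_bD s t : flow_b (s + t) = flow_b s *m flow_b t.
Proof.
rewrite !flow_bE !mulmxA mulmxKV ?matB_unit //; congr (_ *m _).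
rewrite -[RHS]mulmxA mul_mx22; congr (_ *m _).
by congr mx22; rewrite ?mul0r ?mulr0 ?addr0 ?add0r // -expRD;
  congr expR; ring.
Qed.

Lemma formB_components :
  equivalent_closed_components 2 (hyperbolic_locus (nf_poly (@FormB R))) /\
  (exists f : (R * 'Z_2)%type -> M,
    [/\ group_iso f (linear_automorphisms (nf_poly (@FormB R))),
        forall t, f (t, 0) = mxexp (t *: generator_b R),
        forall t, mxexp (t *: generator_b R) = flow_b t
      & forall t, act (f (t, 0)) (nf_curve FormB) = nf_curve FormB]).
Proof.
have sec : sector (nf_poly (@FormB R)) P 0 0 c := nf_sector (@FormB R).
have [uP gd hh hP] := sec.
pose N (w : V) := (invmx P *m w) 0 0 * (invmx P *m w) 1 0.
have HN : null_form N P by move=> v; rewrite /N mulKmx.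
(* Here [c x y^3] is [c y^2] times [x y], so it is positive only where [x y] is. *)
have pos w : 0 < peval (nf_poly (@FormB R)) w -> 0 < N w.
  rewrite -{1}(mulKVmx uP w) hP /N /nullq /= -/c !mul0r !add0r.
  move: (invmx P *m w) => v; move: (v 0 0) (v 1 0) => x y H.
  have : 0 < c * (y ^+ 2) * (x * y) by move: H; congr (_ < _); ring.
  have y2 : 0 < c * y ^+ 2.
    rewrite pmulr_rgt0 // lt_def sqr_ge0 andbT; apply/eqP => y0.
    by move: H; rewrite y0 !mulr0 ltxx.
  by rewrite pmulr_rgt0.
have [Hc HA] := components2 sec HN pos; split=> //.
pose f := fun p : (R * 'Z_2)%type => flow_b p.1 *m (- 1%:M : M) ^+ p.2.
have f0 t : f (t, 0) = flow_b t by rewrite /f /= expr0 mulmx1.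
have f1 t : f (t, 1) = - flow_b t by rewrite /f /= expr1 mulmxN mulmx1.
have sgn2 : (- 1%:M : M) ^+ 2 = 1 by rewrite sqrrN expr1n.
have flow_act t : act (flow_b t) (nf_curve FormB) = nf_curve FormB.
  rewrite nf_curveE flow_bE /= -/P actM mulmxKV // -actM.
  by rewrite /nf_null /= -/c (monomial_rel_act (flow_b_rel t)).
have flow_aut t : linear_automorphisms (nf_poly (@FormB R)) (flow_b t).
  have uF := monomial_rel_unit (flow_b_rel t).
  split; first by rewrite flow_bE !unitmx_mul unitmx_inv uP uF.
  move=> w; rewrite flow_bE -{2}(mulKVmx uP w) -!mulmxA !hP.
  move: (invmx P *m w) => v /=.
  have [_ _ _ ec] : [/\ True, True, True & c = expR (Num.sqrt 3 * t) *
      expR (- (t / Num.sqrt 3)) ^+ 3 * c].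
    have [l [m [_ _ [[e _ _ e4]|[e _ _ _]]]]] := flow_b_rel t.
      have := congr1 (fun M : M => M 0 0) e;
        have := congr1 (fun M : M => M 1 1) e.
      by rewrite !mx22E => -> ->.
    have := congr1 (fun M : M => M 0 0) e; rewrite !mx22E => /eqP.
    by rewrite gt_eqF // expR_gt0.
  rewrite !mulmx_col2 !mx22E -/c /nullq {2}ec; ring.
exists f; split=> //.
- have -> : linear_automorphisms (nf_poly (@FormB R)) = range f.
    apply/seteqP; split=> [A /HA [B [/relB_flow [t ->] AE]]|_ [[t i] _ <-]].
      by case: AE => ->; [exists (t, 0)|exists (t, 1)];
        rewrite // ?f0 ?f1 flow_bE.
    by move: i; apply: ord2P; rewrite ?f0 ?f1 //; apply: aut_opp.
  apply: group_iso_range => [|[s i] [t j]|[t i]].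
  + by rewrite f0 flow_bE mulr0 mul0r oppr0 expR0 -mx22_1 mulmx1 mulmxV.
  + rewrite /f /= flow_bD (@expr_Zp _ 0) //.
    have cmt (B : M) : B *m (- 1%:M) ^+ i = (- 1%:M) ^+ i *m B.
      by apply: (@commrX M _ _ i); rewrite /GRing.comm mulrN1 mulN1r.
    move: (flow_b s) (flow_b t) => F G.
    by rewrite -!mulmxA; congr (_ *m _); rewrite !mulmxA cmt.
  (* For the kernel the flow is compared with the scalar matrices 1 and -1 in the eigenbasis: the
     first forces [t = 0], the second contradicts positivity of the exponential. *)
  + have D E : flow_b t = E *: 1%:M -> mx22 (expR (Num.sqrt 3 * t)) 0 0
        (expR (- (t / Num.sqrt 3))) = mx22 E 0 0 E.
      rewrite flow_bE => e; have {}e : mx22 (expR (Num.sqrt 3 * t)) 0 0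
          (expR (- (t / Num.sqrt 3))) = invmx P *m (E *: 1%:M) *m P.
        by rewrite -e !mulmxA mulVmx // mul1mx mulmxKV.
      rewrite e -scalemxAr mulmx1 -scalemxAl mulVmx //.
      by rewrite [LHS]mx22_eta !mxE /= mulr1 !mulr0.
    move: i; apply: ord2P; rewrite ?f0 ?f1 => e.
      have := D 1; rewrite scale1r => /(_ e) /(congr1 (fun M : M => M 0 0)).
      rewrite !mx22E -expR0 => /expR_inj /eqP.
      by rewrite mulf_eq0 gt_eqF ?sqrtr_gt0 //= => /eqP ->.
    have := D (-1); rewrite scaleN1r -e opprK =>
      /(_ erefl) /(congr1 (fun M : M => M 0 0)).
    by rewrite !mx22E => E; have := expR_gt0 (Num.sqrt 3 * t);
      rewrite E oppr_gt0 ltr10.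
- by move=> t; rewrite f0 mxexp_flow_b.
- exact: mxexp_flow_b.
- by move=> t; rewrite f0.
Qed.

End FormB.

(** * Homogeneity of the curves and singularity at infinity *)

Section Homogeneity.
Variable R : realType.
Local Notation V := 'cV[R]_2.
Local Notation M := 'M[R]_2.
Implicit Types (c : normal_form R) (A B P : M) (v w p : V) (h : mpoly 2 R).

Local Notation nf_rel B c :=
  (monomial_rel B (nf_coef c).1.1 (nf_coef c).1.2 (nf_coef c).2
    (nf_coef c).1.1 (nf_coef c).1.2 (nf_coef c).2).

Lemma nf_homogeneous c :
  (forall v w, nf_null c v -> nf_null c w -> exists2 B, nf_rel B c & B *m v =
    w) ->
  homogeneous_space (nf_curve c).
Proof.
have uP := nf_unit c.
move=> H p q; rewrite nf_curveE => -[v Hv <-] [w Hw <-].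
have [B rel Bv] := H v w Hv Hw.
have uB := monomial_rel_unit rel.
exists (nf_matrix c *m B *m invmx (nf_matrix c)); split.
- by rewrite !unitmx_mul unitmx_inv uP uB.
- by rewrite actM mulmxKV // -actM /nf_null (monomial_rel_act rel).
- by rewrite -!mulmxA mulKmx // Bv.
Qed.

(** If every symmetry in null coordinates fixes [(1, 1)], none can carry the curve point on the ray
    of [(1, 1)] to the one on the ray of [(1, 2)]. *)
Lemma nf_inhomogeneous c : (forall B, nf_rel B c -> B *m pt 1 1 = pt 1 1) ->
  ~ homogeneous_space (nf_curve c).
Proof.
have uP := nf_unit c; have gd := nf_good c.
move=> stab hom.
have [a a0 Ha] := nullcurve_scale gd (quad_pt (ltr01 : 0 < 1 :> R) ltr01).
have [b b0 Hb] := nullcurve_scale gd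
  (quad_pt (ltr01 : 0 < 1 :> R) (ltr0Sn R 1)).
have [||A [uA actA AE]] :=
  hom (nf_matrix c *m (a *: pt 1 1)) (nf_matrix c *m (b *: pt 1 2)).
- by rewrite nf_curveE; exists (a *: pt 1 1).
- by rewrite nf_curveE; exists (b *: pt 1 2).
pose B := invmx (nf_matrix c) *m (A *m nf_matrix c).
have uB : B \in unitmx by rewrite !unitmx_mul unitmx_inv uP uA.
have actB : act B (nf_null c) = nf_null c.
  by rewrite /B -actM -actM -nf_curveE actA nf_curveE actK.
have /stab B1 := act_nullcurve_rel uB gd gd actB.
have : B *m (a *: pt 1 1) = b *: pt 1 2.
  by rewrite /B -!mulmxA AE mulKmx.
rewrite -scalemxAr B1 => E.
have e0 : a = b.
  by have := congr1 (fun v : V => v 0 0) E; rewrite !scale_colE !ptE !mulr1.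
have e1 : a = b * 2.
  by have := congr1 (fun v : V => v 1 0) E; rewrite !scale_colE !ptE !mulr1.
by move: b0; rewrite -e0; lra.
Qed.

Lemma formA_homogeneous : homogeneous_space (nf_curve (@FormA R)).
Proof.
apply: nf_homogeneous => v w [[v0 v1] Hv] [[w0 w1] Hw].
(* The diagonal matrix that carries [v] to [w]; the curve equations at both points say that it
   preserves the quartic. *)
exists (mx22 (w 0 0 / v 0 0) 0 0 (w 1 0 / v 1 0)).
  exists (w 0 0 / v 0 0), (w 1 0 / v 1 0); split; rewrite ?divr_gt0 //.
  left; split; rewrite /= ?mulr0 //.
  move: Hv Hw; rewrite /nullq /= !mul0r !addr0 !add0r !mul1r => Hv Hw.
  transitivity ((w 0 0 * w 1 0 * (w 0 0 * w 1 0)) /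
    (v 0 0 * v 1 0 * (v 0 0 * v 1 0))).
    by rewrite Hv Hw divr1.
  by field; rewrite !gt_eqF.
by apply: eq_col2; rewrite mulmx_col2 !mx22E; field; rewrite !gt_eqF.
Qed.

Lemma formB_homogeneous : homogeneous_space (nf_curve (@FormB R)).
Proof.
apply: nf_homogeneous => v w [[v0 v1] Hv] [[w0 w1] Hw].
exists (mx22 (w 0 0 / v 0 0) 0 0 (w 1 0 / v 1 0)).
  exists (w 0 0 / v 0 0), (w 1 0 / v 1 0); split; rewrite ?divr_gt0 //.
  left; split; rewrite /= ?mulr0 //.
  move: Hv Hw; rewrite /nullq /=; set a := _ / 9 => Hv Hw.
  have {}Hv : a * (v 0 0 * v 1 0 ^+ 3) = 1 by rewrite -[RHS]Hv; ring.
  have {}Hw : a * (w 0 0 * w 1 0 ^+ 3) = 1 by rewrite -[RHS]Hw; ring.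
  have a0 : a != 0.
    by apply/eqP => a0; move/eqP: Hv; rewrite a0 mul0r eq_sym oner_eq0.
  have E := mulfI a0 (etrans Hv (esym Hw)).
  transitivity ((w 0 0 * w 1 0 ^+ 3) / (v 0 0 * v 1 0 ^+ 3) * a).
    by rewrite -E divff ?mul1r // mulf_neq0 ?expf_neq0 // gt_eqF.
  by field; rewrite !gt_eqF.
by apply: eq_col2; rewrite mulmx_col2 !mx22E; field; rewrite !gt_eqF.
Qed.

Lemma formC_inhomogeneous : ~ homogeneous_space (nf_curve (@FormC R)).
Proof. by apply: nf_inhomogeneous => B /formC_stab ->; rewrite mul1mx. Qed.

Lemma formD_inhomogeneous (K : R) (hK : K < 4^-1) :
  ~ homogeneous_space (nf_curve (FormD hK)).
Proof.
apply: nf_inhomogeneous =>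
  B /(monomial_stab_sym (formD_coef (kap_gt hK))) [] ->.
  by rewrite mul1mx.
by rewrite /swap mul_mx22_pt; congr pt; ring.
Qed.

(** For [al = 0] the quartic is divisible by [y^2], so it vanishes to second order at the boundary
    point [(1, 0)]. This point is the limit of the points [(1, e)] of the quadrant with [e > 0], and
    of points with [e < 0] outside it. *)
Lemma sector_singular h P (be ga : R) : sector h P 0 be ga ->
  singular_at_infinity h (act P (nullcurve 0 be ga)).
Proof.
move=> sec; have [uP gd _ hP] := sec.
rewrite /singular_at_infinity cone_sector //.
have cray : (fun e : R => P *m pt 1 e) @ 0 --> P *m pt 1 0.
  apply: (@continuous_comp _ _ _ (fun e : R => pt 1 e));
    last exact: continuous_mulmx.
  by apply: continuous_pt => ?; [exact: cvg_cst|exact: cvg_id].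
exists (P *m pt 1 0); split.
- move=> B /cray /nbhs_ballP [d /= d0 Hd].
  have d2 : 0 < d / 2 by rewrite divr_gt0.
  exists (P *m pt 1 (d / 2)); split; first by exists (pt 1 (d / 2)) => //;
    exact: quad_pt.
  by apply: Hd; rewrite /ball /= sub0r normrN gtr0_norm //; lra.
- move=> /cray /nbhs_ballP [d /= d0 Hd].
  have [|w [_ w1] E] := Hd (- (d / 2)).
    by rewrite /ball /= sub0r opprK gtr0_norm; lra.
  move/(can_inj (mulKmx uP)): E w1 => ->; rewrite ptE; lra.
- apply/eqP => /(congr1 (mulmx (invmx P))); rewrite mulKmx // mulmx0.
  move/(congr1 (fun v : V => v 0 0)); rewrite ptE mxE => /eqP.
  by rewrite oner_eq0.
- by rewrite hP !ptE /nullq; ring.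
have [e1 e2] := sector_gradient sec (pt 1 0).
have z1 : quartx 0 0 be ga (pt (1 : R) 0 0 0) (pt (1 : R) 0 1 0) = 0.
  by rewrite !ptE /quartx; ring.
have z2 : quarty 0 be ga 0 (pt (1 : R) 0 0 0) (pt (1 : R) 0 1 0) = 0.
  by rewrite !ptE /quarty; ring.
rewrite {}z1 in e1; rewrite {}z2 in e2.
(* The two equations say that the transpose of [P] annihilates the gradient of [h]; Cramer's rule
   gives each component. *)
have dP : \det P != 0 by rewrite -unitmx22.
apply: ord2P; apply: (mulfI dP); rewrite mulr0 det_mx22; move: e1 e2;
  set g0 := peval _ _; set g1 := peval _ _ => e1 e2.
  transitivity (P 1 1 * (P 0 0 * g0 + P 1 0 * g1) -
    P 1 0 * (P 0 1 * g0 + P 1 1 * g1)).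
    by ring.
  by rewrite -e1 -e2 !mulr0 subr0.
transitivity (P 0 0 * (P 0 1 * g0 + P 1 1 * g1) -
  P 0 1 * (P 0 0 * g0 + P 1 0 * g1)).
  by ring.
by rewrite -e1 -e2 !mulr0 subr0.
Qed.

(** A zero of [h] in the closed sector lies on an axis, where one partial derivative in null
    coordinates is [al x^3] or [ga y^3], nonzero away from the origin. *)
Lemma sector_nonsingular h P (al be ga : R) : sector h P al be ga ->
  0 < al -> 0 < ga -> ~ singular_at_infinity h (act P (nullcurve al be ga)).
Proof.
move=> sec a0 c0; have [uP gd _ hP] := sec.
rewrite /singular_at_infinity cone_sector // => -[p [clp _ pn0 hp gp]].
have [v0 v1] : 0 <= (invmx P *m p) 0 0 /\ 0 <= (invmx P *m p) 1 0.
  apply: (@closed_quad _ P p).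
  apply: closure_subset clp => _ [w [w0 w1] <-].
  by rewrite /= mulKmx //; split; exact: ltW.
have [e1 e2] := sector_gradient sec (invmx P *m p).
rewrite mulKVmx // !gp !mulr0 addr0 in e1 e2.
rewrite -(mulKVmx uP p) hP in hp.
have vn0 : invmx P *m p != 0.
  by apply: contraNneq pn0 => v; rewrite -(mulKVmx uP p) v mulmx0.
move: (invmx P *m p) v0 v1 e1 e2 hp vn0 => v v0 v1 e1 e2 hv vn0.
move: v0 v1; rewrite !le_eqVlt => /orP[/eqP v0|v0] /orP[/eqP v1|v1].
- by move/eqP: vn0; apply; apply: eq_col2; rewrite mxE.
- move: e1; rewrite -v0 (_ : quartx _ _ _ _ _ _ = ga * v 1 0 ^+ 3); last first.
    by rewrite /quartx; ring.
  by apply/eqP; rewrite gt_eqF // mulr_gt0 // exprn_gt0.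
- move: e2; rewrite -v1 (_ : quarty _ _ _ _ _ _ = al * v 0 0 ^+ 3); last first.
    by rewrite /quarty; ring.
  by apply/eqP; rewrite gt_eqF // mulr_gt0 // exprn_gt0.
- by have := nullq_gt0 gd v0 v1; rewrite hv ltxx.
Qed.

End Homogeneity.

Theorem theorem3p1 (R : realType) :
  [/\
    (* the listed curves are quartic CCGPSR curves in standard form *)
    forall c : normal_form R,
      ccgpsr 4 (nf_poly c) (nf_curve c) /\
      standard_form (nf_poly c) (nf_curve c),
    (* classification *)
    forall H : set 'cV[R]_2, quartic_ccgpsr_curve H ->
      exists! c : normal_form R, equivalent H (nf_curve c)
  & [/\
    (* a) *)
    [/\ equivalent_closed_components 4
          (hyperbolic_locus (nf_poly (@FormA R))),
        (exists N D : set 'M[R]_2,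
          [/\ N = hyperbolic_rotations (mx22 1 0 0 (- 2^-1)),
              (exists2 f : R -> 'M[R]_2, continuous f & group_iso f N),
              turn_flip_group (Num.sqrt 2)^-1 D
            & is_sdprod N D (linear_automorphisms (nf_poly (@FormA R)))]),
        homogeneous_space (nf_curve (@FormA R))
      & singular_at_infinity (nf_poly (@FormA R)) (nf_curve (@FormA R))],
    (* b) *)
    [/\ equivalent_closed_components 2
          (hyperbolic_locus (nf_poly (@FormB R))),
        (exists f : (R * 'Z_2)%type -> 'M[R]_2,
          [/\ group_iso f (linear_automorphisms (nf_poly (@FormB R))),
              forall t, f (t, 0) = mxexp (t *: generator_b R),
              forall t, mxexp (t *: generator_b R) = flow_b t
            & forall t, act (f (t, 0)) (nf_curve FormB) = nf_curve FormB]),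
        homogeneous_space (nf_curve (@FormB R))
      & singular_at_infinity (nf_poly (@FormB R)) (nf_curve (@FormB R))],
    (* c) *)
    [/\ equivalent_closed_components 4
          (hyperbolic_locus (nf_poly (@FormC R))),
        (exists f : ('Z_2 * 'Z_2)%type -> 'M[R]_2,
          group_iso f (linear_automorphisms (nf_poly (@FormC R)))),
        ~ homogeneous_space (nf_curve (@FormC R))
      & singular_at_infinity (nf_poly (@FormC R)) (nf_curve (@FormC R))]
    (* d) *)
  & forall (K : R) (hK : K < 4^-1),
    [/\ 0 < K ->
          equivalent_closed_components 4
            (hyperbolic_locus (nf_poly (FormD hK))) /\
          turn_flip_group (K `^ 4^-1)
            (linear_automorphisms (nf_poly (FormD hK))),
        K <= 0 ->
          equivalent_closed_components 2
            (hyperbolic_locus (nf_poly (FormD hK))) /\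
          (exists f : ('Z_2 * 'Z_2)%type -> 'M[R]_2,
            [/\ group_iso f (linear_automorphisms (nf_poly (FormD hK))),
                f (1, 0) = flip_y R & f (0, 1) = flip_x R]),
        ~ homogeneous_space (nf_curve (FormD hK))
      & ~ singular_at_infinity (nf_poly (FormD hK)) (nf_curve (FormD hK))]]].
Proof.
split; first exact: nf_ccgpsr.
  move=> H /nf_classification [c Hc]; exists c; split=> // c' Hc'.
  exact: nf_equivalent_inj (equivalent_trans (equivalent_sym Hc) Hc').
have singular c : (nf_coef c).1.1 = 0 ->
  singular_at_infinity (nf_poly c) (nf_curve c).
  move=> c0; have := nf_sector c; rewrite nf_curveE /nf_null c0.
  exact: sector_singular.
split.
- have [HA1 HA2] := formA_components R; split=> //.
    exact: formA_homogeneous.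
  exact: singular.
- have [HB1 HB2] := formB_components R; split=> //.
    exact: formB_homogeneous.
  exact: singular.
- have [HC1 HC2] := formC_components R; split=> //.
    exact: formC_inhomogeneous.
  exact: singular.
move=> K hK; split.
- exact: formD_pos.
- exact: formD_npos.
- exact: formD_inhomogeneous.
have a0 := formD_coef (kap_gt hK).
by rewrite nf_curveE; apply: (sector_nonsingular (nf_sector (FormD hK))).
Qed.
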